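(* Let $C$ be an irreducible and reduced projective Gorenstein rational curve over $\mathbb{C}$ of arithmetic genus $g\ge1$ with only unibranch singularities. Choose an affine coordinate $v$ on the normalization $\mathbb{P}^1$ such that the points corresponding to the singularities are at $v=0$ and at $v=t_1,\dots,t_s$ (with $0,t_1,\dots,t_s$ distinct complex numbers, $s\ge 0$); let $P_0$ be the (smooth) point at $v=\infty$, with coordinate $u=1/v$. Fix a basis $\omega_1,\dots,\omega_g$ of $H^0(C,\omega_C)$ with expansions $\omega_j=\big(\sum_{i\ge0}a_{ij}u^i\big)du$ at $P_0$, and let $\theta(z_1,\dots,z_g)$ be a (polynomial) theta function coming from the Abel map with base point $P_0$ and this basis. Let $\mathbf U=(a_{0j})_{j=1}^g$, $\mathbf V=(a_{1j})_{j=1}^g$, $\mathbf W=(a_{2j})_{j=1}^g$. Then the function $$f(x,y,t):=2\frac{\partial^2}{\partial x^2}\log\theta(\mathbf Ux+\mathbf Vy+\mathbf Wt)$$ is a rational solution to the KP equation $$\frac{\partial}{\partial x}\left(4f_t-6ff_x-f_{xxx}\right)=3f_{yy}.$$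
   Context: $\nu:\mathbb P^1\to C$ is the normalization; a singular point is unibranch if it has a single preimage. Sections of the dualizing sheaf $\omega_C$ are the meromorphic differentials $\omega$ on $\mathbb P^1$ with $\sum_{Q\in\nu^{-1}(P)}\operatorname{Res}_Q(\nu^*(f)\omega)=0$ for all $P\in C$, $f\in\mathcal O_{C,P}$. Let $C_0$ be the smooth locus. For these curves the period group (image of $H_1(C_0,\mathbb Z)$ in $H^0(C,\omega_C)^*$) is zero and $\operatorname{Jac}(C)=H^0(C,\omega_C)^*\cong\mathbb C^g$ via the basis. The theta divisor is the Zariski closure in $\mathbb C^g$ of the image of $C_0^{g-1}$ under $(P_1,\dots,P_{g-1})\mapsto\big(\sum_{k}\int_{P_0}^{P_k}\omega_j\big)_{j=1,\dots,g}$, and a theta function $\theta$ is a reduced polynomial whose zero divisor is the theta divisor (unique up to a nonzero scalar). *)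

(* Defs.v *)
From HB Require Import structures.
From mathcomp Require Import all_boot all_order all_algebra.
From mathcomp Require Import generic_quotient fraction complex.
From mathcomp Require Import all_classical all_reals all_analysis.
From mathcomp Require mpoly.
Import (canonicals, coercions, hints) mpoly.

Set Implicit Arguments.
Unset Strict Implicit.
Unset Printing Implicit Defensive.

Import Order.TTheory GRing.Theory Num.Theory.
Import numFieldNormedType.Exports.

Local Open Scope classical_set_scope.
Local Open Scope ring_scope.

Notation "x %:F" := (@FracField.tofrac _ x) : ring_scope.

(* The extension of a derivation [D] of [A] to the fraction field of [A]: the
   quotient rule applied to the representative chosen by the quotient type.
   When [D] is a derivation the value does not depend on the representative. *)
Definition fracder (A : idomainType) (D : A -> A) (h : {fraction A}) :
    {fraction A} :=
  let n := (frac (repr h)).1 in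
  let d := (frac (repr h)).2 in
  (D n * d - n * D d)%:F / d%:F ^+ 2.

Section ProjectiveLine.
Variable F : fieldType.

(* [Some a] is the point v = a, [None] is the point v = oo. *)
Definition P1 : Type := option F.

(* The function field F(v). *)
Definition ratfun : fieldType := {fraction {poly F}}.

Definition cst (c : F) : ratfun := (c%:P)%:F.

Definition coord : ratfun := ('X : {poly F})%:F.

(* The local ring of the projective line at a point. *)
Definition regular (P : P1) : set ratfun :=
  match P with
  | Some a => [set h | exists p q : {poly F},
                 q.[a] != 0 /\ h = p%:F / q%:F]
  | None => [set h | exists p q : {poly F},
                 [/\ q != 0, (size p <= size q)%N & h = p%:F / q%:F]]
  end.

(* The local parameter v - a, respectively u = 1/v. *)
Definition unif (P : P1) : ratfun :=
  if P is Some a then coord - cst a else coord^-1.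

(* The n-th power of the maximal ideal of [regular P]. *)
Definition max_pow (P : P1) (n : nat) : set ratfun :=
  [set h | exists2 k, regular P k & h = unif P ^+ n * k].

(* The value at [P] of a rational function that is regular at [P]. *)
Definition value (P : P1) (h : ratfun) : F :=
  xget 0 [set c | max_pow P 1 (h - cst c)].

(* A meromorphic differential is h dv, represented by h : ratfun.  With the
   local parameter p = unif P, one has h dv = (h / (dp/dv)) dp. *)
Definition local_coef (P : P1) (h : ratfun) : ratfun :=
  h / fracder (@deriv F) (unif P).

(* r = Res_P (h dv): the coefficient of p^-1 in a principal part of h dv. *)
Definition is_residue (P : P1) (h : ratfun) (r : F) : Prop :=
  exists (n : nat) (c : nat -> F),
    regular P (local_coef P h - \sum_(i < n.+1) cst (c i) / unif P ^+ i.+1)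
    /\ c 0%N = r.

(* h dv = (\sum_i a_i p^i) dp as formal expansion at P, with p = unif P. *)
Definition is_expansion (P : P1) (h : ratfun) (a : nat -> F) : Prop :=
  forall n, max_pow P n (local_coef P h - \sum_(i < n) cst (a i) * unif P ^+ i).

End ProjectiveLine.

Arguments cst {F} c.
Arguments coord {F}.
Arguments regular {F} P.
Arguments unif {F} P.

(* An integral projective curve with normalization nu : P^1 -> C and only
   unibranch singularities.  Since nu is a homeomorphism, the curve is the
   ringed space given by P^1 with a subsheaf of rings of its structure sheaf,
   i.e. by the stalks O_{C,P} inside O_{P^1,P}: F-subalgebras that contain a
   power of the maximal ideal (nu is finite and birational, so the conductor
   is nonzero) and that differ from O_{P^1,P} at finitely many points only. *)
Record unibranch_rational_curve (F : fieldType) := UnibranchRationalCurve {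
  stalk :> P1 F -> set (ratfun F);
  stalk_regular : forall P, stalk P `<=` regular P;
  stalk_cst : forall P c, stalk P (cst c);
  stalk_add : forall P h k, stalk P h -> stalk P k -> stalk P (h + k);
  stalk_mul : forall P h k, stalk P h -> stalk P k -> stalk P (h * k);
  stalk_conductor : forall P, exists n, max_pow P n `<=` stalk P;
  stalk_finite : exists s : seq (P1 F), forall P, P \notin s ->
    stalk P = regular P
}.

Section Curve.
Variables (F : fieldType) (C : unibranch_rational_curve F).

Definition smooth_point (P : P1 F) : Prop := C P = regular P.

(* The stalk at P of the dualizing sheaf. *)
Definition dualizing (P : P1 F) : set (ratfun F) :=
  [set h | forall f, C P f -> is_residue P (f * h) 0].

(* H^0(C, omega_C) *)
Definition dualizing_section : set (ratfun F) :=
  [set h | forall P, dualizing P h].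

(* The dualizing sheaf is invertible. *)
Definition gorenstein : Prop :=
  forall P, exists2 e, e != 0 &
    dualizing P = [set h | exists2 f, C P f & h = f * e].

(* Families almost all of whose members are regular on C (repartitions). *)
Definition repartition (r : P1 F -> ratfun F) : Prop :=
  exists s : seq (P1 F), forall P, P \notin s -> C P (r P).

(* g = dim H^1(C, O_C), where H^1(C, O_C) is the space of repartitions modulo
   the everywhere regular ones and the constant families (k)_P, k in F(v). *)
Definition arithmetic_genus (g : nat) : Prop :=
  exists e : 'I_g -> P1 F -> ratfun F,
    (forall j, repartition (e j)) /\
    forall r, repartition r ->
      exists! c : {ffun 'I_g -> F}, exists k : ratfun F,
        forall P, C P (r P - \sum_j cst (c j) * e j P - k).

Definition dualizing_basis (g : nat) (w : 'I_g -> ratfun F) : Prop :=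
  (forall j, dualizing_section (w j)) /\
  forall h, dualizing_section h ->
    exists! c : {ffun 'I_g -> F}, h = \sum_j cst (c j) * w j.

End Curve.

Section Abel.
Variable R : realType.
Local Notation CC := (R[i] : fieldType).

(* The point with coordinate u = 1/v; this chart misses only v = 0. *)
Definition point_u (z : R[i]) : P1 CC :=
  if z == 0 then None else Some z^-1.

Definition C1_path (p : R -> R[i]) : Prop :=
  let x := fun s => complex.Re (p s) in let y := fun s => complex.Im (p s) in
  [/\ forall s, derivable x s 1, forall s, derivable y s 1,
      continuous (derive1 x) & continuous (derive1 y)].

(* The integral of phi(z) dz along the restriction of p to [0, 1]. *)
Definition path_integral (p : R -> R[i]) (phi : R[i] -> R[i]) : R[i] :=
  let dp := fun s : R => Complex (derive1 (fun s => complex.Re (p s)) s)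
                                 (derive1 (fun s => complex.Im (p s)) s) in
  let I f := Rintegral lebesgue_measure `[0%R, 1%R] f in
  Complex (I (fun s => complex.Re (phi (p s) * dp s)))
          (I (fun s => complex.Im (phi (p s) * dp s))).

(* The coefficient of du in h dv, as a function of u. *)
Definition coef_u (h : ratfun CC) (z : R[i]) : R[i] :=
  value (point_u z) (local_coef None h).

(* Paths in the smooth locus from v = oo to P, written in the coordinate u;
   all of the smooth locus is in the domain of u when v = 0 is singular. *)
Definition smooth_path (C : unibranch_rational_curve CC) (P : P1 CC)
    (p : R -> R[i]) : Prop :=
  [/\ C1_path p, p 0 = 0, point_u (p 1) = P &
      forall s, 0 <= s <= 1 -> smooth_point C (point_u (p s))].

(* The image of the (g-1)-st power of the smooth locus under the Abel map with
   base point v = oo, in coordinates. *)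
Definition abel_image (C : unibranch_rational_curve CC) (g : nat)
    (w : 'I_g -> ratfun CC) : set ('I_g -> R[i]) :=
  [set z | exists (P : 'I_g.-1 -> P1 CC) (p : 'I_g.-1 -> R -> R[i]),
     (forall k, smooth_path C (P k) (p k)) /\
     forall j, z j = \sum_k path_integral (p k) (coef_u (w j))].

Definition zariski_closure (n : nat) (S : set ('I_n -> R[i])) :
    set ('I_n -> R[i]) :=
  [set z | forall q : mpoly.mpoly n R[i],
     (forall x, S x -> mpoly.meval x q = 0) -> mpoly.meval z q = 0].

Definition theta_divisor (C : unibranch_rational_curve CC) (g : nat)
    (w : 'I_g -> ratfun CC) : set ('I_g -> R[i]) :=
  zariski_closure (abel_image C w).

Definition reduced_mpoly (n : nat) (q : mpoly.mpoly n R[i]) : Prop :=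
  forall a b : mpoly.mpoly n R[i], q = a ^+ 2 * b -> a \is a GRing.unit.

Definition theta_function (C : unibranch_rational_curve CC) (g : nat)
    (w : 'I_g -> ratfun CC) (theta : mpoly.mpoly g R[i]) : Prop :=
  reduced_mpoly theta /\
  [set z | mpoly.meval z theta = 0] = theta_divisor C w.

End Abel.

Section KP.
Variable F : fieldType.

Definition ratfun3 : fieldType := {fraction (mpoly.mpoly 3 F)}.

Definition var_x : 'I_3 := Ordinal (isT : (0 < 3)%N).
Definition var_y : 'I_3 := Ordinal (isT : (1 < 3)%N).
Definition var_t : 'I_3 := Ordinal (isT : (2 < 3)%N).

Definition partial (i : 'I_3) : ratfun3 -> ratfun3 :=
  fracder (@mpoly.mderiv 3 F i).

(* The polynomial q(U x + V y + W t) in x, y, t. *)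
Definition restrict_xyt (n : nat) (U V W : 'I_n -> F)
    (q : mpoly.mpoly n F) : mpoly.mpoly 3 F :=
  let X i : mpoly.mpoly 3 F := mpoly.mpolyX F (mpoly.mnm1 i) in
  mpoly.comp_mpoly
    [tuple U j *: X var_x + V j *: X var_y + W j *: X var_t | j < n] q.

(* The second x-derivative of log T: the first derivative of log T is the
   logarithmic derivative of T, which is a rational function. *)
Definition dxx_log (T : ratfun3) : ratfun3 :=
  partial var_x (partial var_x T / T).

Definition KP_solution (f : ratfun3) : Prop :=
  let dx := partial var_x in
  let dy := partial var_y in
  let dt := partial var_t in
  dx (4%:R * dt f - 6%:R * f * dx f - dx (dx (dx f))) = 3%:R * dy (dy f).

End KP.

(* Main.v *)
Require Import Defs.
From mathcomp Require Import all_boot all_order all_algebra.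
From mathcomp Require Import fraction complex.
From mathcomp Require Import all_classical all_reals all_analysis.
From mathcomp Require mpoly.
From mathcomp Require Import perm separable qpoly ring zify.
Import (canonicals, coercions, hints) mpoly.

Set Implicit Arguments.
Unset Strict Implicit.
Unset Printing Implicit Defensive.

Import Order.TTheory GRing.Theory Num.Theory.
Local Open Scope ring_scope.

(** Everything takes place in the finite algebra [B = F[v]/D], where [D] is the product of the
    [(v - q_i)^n] over the singular points and [n] is a common conductor exponent. A section of the
    dualizing sheaf is [r/D dv] with [deg r <= deg D - 2]. Let [l j x] be the residue at infinity of
    [x w_j]; then [l j (v^(i+1)) = a i j] ([functional_expansion]), and by residue duality the
    common kernel [ann] of the [l j] is the ring of polynomials that are regular on the curve, taken
    modulo [D] ([functional_ann]). For nilpotent [eta j] dual to the [l j], the units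
    [E z = exp (\sum_j z_j eta_j)] parametrize the Jacobian: [E z] lies in [ann] only for [z = 0]
    ([ann_E]).

    The line bundle of degree [g - 1] with class [z] has as sections the polynomials [p] of degree
    less than [g] with [p E z] in [ann], so it has a nonzero one exactly where [Theta], the
    determinant of the [l j (v^k E z)] with [k < g], vanishes. Since [1 - u v] is a unit of [ann]
    times [E (- abel u)], where [abel] is the Abel integral in closed form ([one_sub_uv]), sums of
    [g - 1] Abel values carry the section [\prod_k (1 - u_k v)]. Conversely each zero of [Theta] is
    a limit of such sums ([Theta_closure]). These sums form an irreducible set, and [Theta] has a
    nonzero derivative at one of them ([Theta_smooth_point]); hence [Theta] generates the ideal of
    the theta divisor and [theta] is a constant multiple of it ([reduced_equation],
    [theta_proportional]).

    For KP, the vectors U, V, W are the directions [(l j (v^h))_j] with [h = 1, 2, 3].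
    Differentiating [E z] in such a direction multiplies it by [v^h] minus an element of [ann], so
    the matrix of all [l j (v^k E z)] has its columns shifted by [h], up to a constant linear change
    of rows ([entry_flow]). It thus moves by the KP flows on a Grassmannian. The affine coordinates
    satisfy Riccati equations, the logarithmic [x]-derivative of the determinant is one of them up
    to a constant, and the KP equation is a polynomial identity in these coordinates ([flow_KP],
    [riccati_KP]). *)

Definition derivation (A : comNzRingType) (D : A -> A) : Prop :=
  (forall a b, D (a + b) = D a + D b) /\
  (forall a b, D (a * b) = D a * b + a * D b).

(** * Derivations of commutative rings *)

Section Derivation.
Variables (A : comNzRingType) (D : A -> A).
Hypothesis DP : derivation D.

Lemma derD a b : D (a + b) = D a + D b. Proof. exact: DP.1. Qed.
Lemma derM a b : D (a * b) = D a * b + a * D b. Proof. exact: DP.2. Qed.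

Lemma der0 : D 0 = 0.
Proof. by apply: (addIr (D 0)); rewrite -derD !add0r. Qed.

Lemma derN a : D (- a) = - D a.
Proof. by apply: (addIr (D a)); rewrite -derD !addNr der0. Qed.

Lemma derB a b : D (a - b) = D a - D b.
Proof. by rewrite derD derN. Qed.

Lemma der1 : D 1 = 0.
Proof.
have := derM 1 1; rewrite !mulr1 mul1r => /eqP.
by rewrite addrC -subr_eq subrr => /eqP.
Qed.

Lemma der_nat n : D n%:R = 0.
Proof. by elim: n => [|n IH]; rewrite ?der0 // mulrS derD der1 IH addr0. Qed.

Lemma der_sum (I : Type) (r : seq I) (P : pred I) (F : I -> A) :
  D (\sum_(i <- r | P i) F i) = \sum_(i <- r | P i) D (F i).
Proof. exact: (big_morph D derD der0). Qed.

Lemma der_prod (I : finType) (P : pred I) (F : I -> A) :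
  D (\prod_(i | P i) F i) =
    \sum_(i | P i) D (F i) * \prod_(j | P j && (j != i)) F j.
Proof.
have [n] := ubnP #|P|; elim: n P => // n IH P.
rewrite ltnS => leP.
case: (pickP P) => [i Pi|P0]; last first.
  by rewrite !big_pred0 ?der1.
rewrite [in LHS](bigD1 i) //= [in RHS](bigD1 i) //= derM IH; last first.
  apply: leq_trans leP; apply: proper_card; apply/fintype.properP; split.
    by apply/fintype.subsetP => j /andP[].
  by exists i; rewrite // unfold_in eqxx andbF.
congr (_ + _); rewrite mulr_sumr; apply: eq_bigr => j /andP[Pj ji].
rewrite mulrCA; congr (_ * _).
rewrite [RHS](bigD1 i) /= ?Pi 1?eq_sym //; congr (_ * _).
by apply: eq_bigl => k; rewrite -!andbA [(k != j) && _]andbC.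
Qed.

(** By the Leibniz rule one row is differentiated at a time; each resulting determinant
    [\det (Mi i)] is expanded along that row. *)
Lemma der_det n (M : 'M[A]_n) :
  D (\det M) = \sum_i \sum_j D (M i j) * cofactor M i j.
Proof.
pose Mi i : 'M[A]_n := \matrix_(k, j) (if k == i then D (M k j) else M k j).
transitivity (\sum_i \det (Mi i)); last first.
  apply: eq_bigr => i _; rewrite (expand_det_row _ i).
  apply: eq_bigr => j _; rewrite mxE eqxx; congr (_ * _).
  rewrite /cofactor; congr (_ * \det _); apply/matrixP => k l.
  by rewrite !mxE eq_sym (negbTE (neq_lift _ _)).
rewrite /determinant der_sum exchange_big /=; apply: eq_bigr => s _.
have -> : D ((-1) ^+ odd_perm s * \prod_i M i (s i)) =
    (-1) ^+ odd_perm s * D (\prod_i M i (s i)).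
  by rewrite derM; case: (odd_perm s) => /=;
     rewrite ?expr1 ?expr0 ?derN ?der1 ?oppr0 mul0r add0r.
rewrite der_prod mulr_sumr; apply: eq_bigr => i _; congr (_ * _).
rewrite [RHS](bigD1 i) //= mxE eqxx; congr (_ * _).
by apply: eq_bigr => j ji; rewrite mxE (negbTE ji).
Qed.

End Derivation.

Lemma quotient_ruleD (K : fieldType) (n d m e n' d' m' e' : K) :
  d != 0 -> e != 0 ->
  ((n' * e + n * e' + (m' * d + m * d')) * (d * e)
     - (n * e + m * d) * (d' * e + d * e')) / (d * e) ^+ 2 =
  (n' * d - n * d') / d ^+ 2 + (m' * e - m * e') / e ^+ 2.
Proof. by move=> d0 e0; field; apply/andP. Qed.

Lemma quotient_ruleM (K : fieldType) (n d m e n' d' m' e' : K) :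
  d != 0 -> e != 0 ->
  ((n' * m + n * m') * (d * e) - n * m * (d' * e + d * e')) / (d * e) ^+ 2 =
  (n' * d - n * d') / d ^+ 2 * (m / e) + n / d * ((m' * e - m * e') / e ^+ 2).
Proof. by move=> d0 e0; field; apply/andP. Qed.

(** * Extension of a derivation to the fraction field *)

Section FractionDerivation.
Variables (A : idomainType) (D : A -> A).
Hypothesis DP : derivation D.
Local Notation Fr := (@FracField.tofrac A).
Local Notation DF := (@fracder A D).

Lemma frac_repr (h : {fraction A}) :
  h = Fr (frac (repr h)).1 / Fr (frac (repr h)).2.
Proof.
have := denom_ratioP (repr h); rewrite -[X in X = _]reprK; move: (repr h) => r r2.
apply: (mulIf (x := Fr (frac r).2)); first by rewrite tofrac_eq0.
rewrite divfK ?tofrac_eq0 //; unlock FracField.tofrac.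
rewrite -[LHS]FracField.pi_mul; apply/eqmodP.
rewrite /= FracField.equivfE /FracField.mulf /=.
rewrite !numden_Ratio ?mulr1 ?oner_neq0 ?r2 //.
by rewrite mulrC.
Qed.

Lemma frac_ind (h : {fraction A}) : exists n d, d != 0 /\ h = Fr n / Fr d.
Proof.
exists (frac (repr h)).1, (frac (repr h)).2; split; first exact: denom_ratioP.
exact: frac_repr.
Qed.

(** Two representatives satisfy [n d' = n' d]; differentiating this relation shows that the quotient
    rule gives the same value on both. *)
Lemma fracderE n d : d != 0 ->
  DF (Fr n / Fr d) = Fr (D n * d - n * D d) / Fr d ^+ 2.
Proof.
move=> d0; rewrite /fracder.
set h := Fr n / Fr d; set n' := (frac (repr h)).1; set d' := (frac (repr h)).2.
have d'0 : d' != 0 by apply: denom_ratioP.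
have e : n * d' = n' * d.
  have : h = Fr n' / Fr d' by apply: frac_repr.
  rewrite /h => /eqP; rewrite eqr_div ?tofrac_eq0 // -!tofracM tofrac_eq.
  by move/eqP.
have De : D n * d' + n * D d' = D n' * d + n' * D d by rewrite -!derM // e.
apply/eqP; rewrite eqr_div ?expf_neq0 ?tofrac_eq0 // -!tofracXn -!tofracM tofrac_eq.
apply/eqP.
transitivity (d * (D n' * d * d' - (n' * d) * D d')); first by ring.
rewrite -e; transitivity (d * d' * (D n' * d + n' * D d - n' * D d - n * D d')).
  by ring.
rewrite -De; transitivity (d' * (D n * d * d' - (n' * d) * D d)); first by ring.
by rewrite -e; ring.
Qed.

Lemma fracder_tofrac n : DF (Fr n) = Fr (D n).
Proof.
have := fracderE n (oner_neq0 A).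
by rewrite tofrac1 !divr1 expr1n divr1 mulr1 der1 // mulr0 subr0.
Qed.

Lemma fracderP : derivation DF.
Proof.
have nz := tofrac_eq0.
split=> a b; have [n [d [d0 ->]]] := frac_ind a;
  have [m [e [e0 ->]]] := frac_ind b.
  have -> : Fr n / Fr d + Fr m / Fr e = Fr (n * e + m * d) / Fr (d * e).
    by rewrite addf_div ?nz // -!tofracM -tofracD.
  rewrite !fracderE ?mulf_neq0 // !(derD DP, derM DP).
  rewrite !(tofracD, tofracM, tofracN).
  by apply: quotient_ruleD; rewrite nz.
have -> : Fr n / Fr d * (Fr m / Fr e) = Fr (n * m) / Fr (d * e).
  by rewrite mulf_div -!tofracM.
rewrite !fracderE ?mulf_neq0 // !(derD DP, derM DP).
rewrite !(tofracD, tofracM, tofracN).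
by apply: quotient_ruleM; rewrite nz.
Qed.

End FractionDerivation.

(** * The KP equation for solutions of Riccati equations *)

Section Riccati.
Variables (K : fieldType) (D1 D2 D3 : K -> K) (p : nat -> nat -> K).
Hypotheses (D1P : derivation D1) (D2P : derivation D2) (D3P : derivation D3).
Hypothesis D1p : forall i j,
  D1 (p i j) = p i j.+1 - p i.+1 j - p i 0 * p 0 j.
Hypothesis D2p : forall i j,
  D2 (p i j) = p i j.+2 - p i.+2 j - (p i 1 * p 0 j + p i 0 * p 1 j).
Hypothesis D3p : forall i j,
  D3 (p i j) = p i j.+3 - p i.+3 j
               - (p i 2 * p 0 j + p i 1 * p 1 j + p i 0 * p 2 j).

Let commutes x := D1 (D2 x) = D2 (D1 x).

(** Commutation of [D1] and [D2] is drawn from the Riccati equations: it holds on the coordinates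
    and passes to polynomials in them, which suffices for KP. *)
Lemma riccati_comm i j : commutes (p i j).
Proof.
rewrite /commutes D1p D2p !(derD D1P, derN D1P, derM D1P, D1p).
by rewrite !(derD D2P, derN D2P, derM D2P, D2p); ring.
Qed.

Lemma commutesD x y : commutes x -> commutes y -> commutes (x + y).
Proof.
by rewrite /commutes => cx cy; rewrite !(derD D1P, derD D2P) cx cy.
Qed.

Lemma commutesB x y : commutes x -> commutes y -> commutes (x - y).
Proof.
by rewrite /commutes => cx cy; rewrite !(derB D1P, derB D2P) cx cy.
Qed.

Lemma commutesM x y : commutes x -> commutes y -> commutes (x * y).
Proof.
rewrite /commutes => cx cy.
by rewrite !(derM D1P, derM D2P, derD D1P, derD D2P) cx cy; ring.
Qed.

(* The matrix Riccati equations are the KP flows on the big cell of the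
   Grassmannian; the KP equation becomes a polynomial identity in the affine
   coordinates [p]. *)
Lemma riccati_KP (f : K) : f = 2%:R * D1 (p 0 0) ->
  D1 (4%:R * D3 f - 6%:R * f * D1 f - D1 (D1 (D1 f))) = 3%:R * D2 (D2 f).
Proof.
move=> ->.
have c1 x : D1 (2%:R * x) = 2%:R * D1 x.
  by rewrite (derM D1P) (der_nat D1P) mul0r add0r.
have c2 x : D2 (2%:R * x) = 2%:R * D2 x.
  by rewrite (derM D2P) (der_nat D2P) mul0r add0r.
have c3 x : D3 (2%:R * x) = 2%:R * D3 x.
  by rewrite (derM D3P) (der_nat D3P) mul0r add0r.
(* Write [P] for [p 0 0]. [E2], [E3], [E4] expand the second to fourth [D1]-derivatives of [P]; [Ea]
   is [D3 (D1 P)], [Eb] and [Ec] are [D2 P] and [D2 (D2 P)]. *)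
have E2 : D1 (p 0 1 - p 1 0 - p 0 0 * p 0 0) =
      p 0 2 - 2%:R * p 1 1 + p 2 0 - 3%:R * p 0 0 * p 0 1 + 3%:R * p 0 0 * p 1 0
      + 2%:R * p 0 0 * p 0 0 * p 0 0.
  by rewrite !(derD D1P, derN D1P, derM D1P, der1 D1P, D1p); ring.
have E3 : D1 (p 0 2 - 2%:R * p 1 1 + p 2 0 - 3%:R * p 0 0 * p 0 1 + 3%:R * p 0 0 * p 1 0
      + 2%:R * p 0 0 * p 0 0 * p 0 0) =
      p 0 3 - 3%:R * p 1 2 + 3%:R * p 2 1 - p 3 0 - 4%:R * p 0 0 * p 0 2 + 6%:R
      * p 0 0 * p 1 1 - 4%:R * p 0 0 * p 2 0 - 3%:R * p 0 1 * p 0 1 + 8%:R * p 0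
      1 * p 1 0 - 3%:R * p 1 0 * p 1 0 + 12%:R * p 0 0 * p 0 0 * p 0 1 - 12%:R *
      p 0 0 * p 0 0 * p 1 0 - 6%:R * p 0 0 * p 0 0 * p 0 0 * p 0 0.
  by rewrite !(derD D1P, derN D1P, derM D1P, der1 D1P, D1p); ring.
have E4 : D1 (p 0 3 - 3%:R * p 1 2 + 3%:R * p 2 1 - p 3 0 - 4%:R * p 0 0 * p 0 2 + 6%:R
      * p 0 0 * p 1 1 - 4%:R * p 0 0 * p 2 0 - 3%:R * p 0 1 * p 0 1 + 8%:R * p 0
      1 * p 1 0 - 3%:R * p 1 0 * p 1 0 + 12%:R * p 0 0 * p 0 0 * p 0 1 - 12%:R *
      p 0 0 * p 0 0 * p 1 0 - 6%:R * p 0 0 * p 0 0 * p 0 0 * p 0 0) =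
      p 0 4 - 4%:R * p 1 3 + 6%:R * p 2 2 - 4%:R * p 3 1 + p 4 0 - 5%:R * p 0 0
      * p 0 3 + 10%:R * p 0 0 * p 1 2 - 10%:R * p 0 0 * p 2 1 + 5%:R * p 0 0 * p
      3 0 - 10%:R * p 0 1 * p 0 2 + 20%:R * p 0 1 * p 1 1 - 15%:R * p 0 1 * p 2
      0 + 15%:R * p 0 2 * p 1 0 - 20%:R * p 1 0 * p 1 1 + 10%:R * p 1 0 * p 2 0
      + 20%:R * p 0 0 * p 0 0 * p 0 2 - 30%:R * p 0 0 * p 0 0 * p 1 1 + 20%:R *
      p 0 0 * p 0 0 * p 2 0 + 30%:R * p 0 0 * p 0 1 * p 0 1 - 70%:R * p 0 0 * p
      0 1 * p 1 0 + 30%:R * p 0 0 * p 1 0 * p 1 0 - 60%:R * p 0 0 * p 0 0 * p 0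
      0 * p 0 1 + 60%:R * p 0 0 * p 0 0 * p 0 0 * p 1 0 + 24%:R * p 0 0 * p 0 0
      * p 0 0 * p 0 0 * p 0 0.
  by rewrite !(derD D1P, derN D1P, derM D1P, der1 D1P, D1p); ring.
have Ea : D3 (p 0 1 - p 1 0 - p 0 0 * p 0 0) =
      p 0 4 - p 1 3 - p 3 1 + p 4 0 - 2%:R * p 0 0 * p 0 3 + p 0 0 * p 1 2 - p 0
      0 * p 2 1 + 2%:R * p 0 0 * p 3 0 - p 0 1 * p 0 2 - p 0 1 * p 1 1 + p 1 0 *
      p 1 1 + p 1 0 * p 2 0 + 2%:R * p 0 0 * p 0 0 * p 0 2 + 2%:R * p 0 0 * p 0
      0 * p 2 0 + 2%:R * p 0 0 * p 0 1 * p 1 0.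
  by rewrite !(derD D3P, derN D3P, derM D3P, der1 D3P, D3p); ring.
have Eb : D2 (p 0 0) =
      p 0 2 - p 2 0 - p 0 0 * p 0 1 - p 0 0 * p 1 0.
  by rewrite !(derD D2P, derN D2P, derM D2P, der1 D2P, D2p); ring.
have Ec : D2 (p 0 2 - p 2 0 - p 0 0 * p 0 1 - p 0 0 * p 1 0) =
      p 0 4 - 2%:R * p 2 2 + p 4 0 - p 0 0 * p 0 3 - 2%:R * p 0 0 * p 1 2 + 2%:R
      * p 0 0 * p 2 1 + p 0 0 * p 3 0 - 2%:R * p 0 1 * p 0 2 + p 0 1 * p 2 0 - p
      0 2 * p 1 0 + 2%:R * p 1 0 * p 2 0 + 2%:R * p 0 0 * p 0 0 * p 1 1 + 2%:R *
      p 0 0 * p 0 1 * p 0 1 + 2%:R * p 0 0 * p 0 1 * p 1 0 + 2%:R * p 0 0 * p 1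
      0 * p 1 0.
  by rewrite !(derD D2P, derN D2P, derM D2P, der1 D2P, D2p); ring.
(* This is KP integrated once in [x]: with [f = 2 P_x] the bracket equals [6 P_yy]. Applying [D1]
   and commuting it past both [D2] gives the equation. *)
have -> : 4%:R * D3 (2%:R * D1 (p 0 0))
    - 6%:R * (2%:R * D1 (p 0 0)) * D1 (2%:R * D1 (p 0 0))
    - D1 (D1 (D1 (2%:R * D1 (p 0 0)))) = 2%:R * (3%:R * D2 (D2 (p 0 0))).
  by rewrite !(c1, c3) D1p Ea E2 E3 E4 Eb Ec; ring.
rewrite !c2 -riccati_comm.
have -> : D2 (D1 (D2 (p 0 0))) = D1 (D2 (D2 (p 0 0))).
  symmetry; rewrite D2p; apply: commutesB; first by apply: commutesB; apply: riccati_comm.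
  by apply: commutesD; apply: commutesM; apply: riccati_comm.
by rewrite c1 (derM D1P 3%:R) (der_nat D1P) mul0r add0r mulrCA.
Qed.

End Riccati.

Lemma rank_indep (K : fieldType) (g k : nat) (f : nat -> 'rV[K]_g) :
  (forall m, (m < k)%N -> ~~ (f m <= \matrix_(i < m) f i)%MS) ->
  \rank (\matrix_(i < k) f i) = k.
Proof.
elim: k => [|k IH] indep; first by apply/eqP; rewrite -leqn0 rank_leq_row.
have {}IH := IH (fun m lem => indep m (leqW lem)).
apply/eqP; rewrite eqn_leq rank_leq_row /= ltnNge; apply/negP => le.
have sub : (\matrix_(i < k) f i <= \matrix_(i < k.+1) f i)%MS.
  apply/row_subP => i; rewrite rowK.
  by rewrite -(rowK (fun i : 'I_k.+1 => f i) (widen_ord (leqnSn k) i)) row_sub.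
have := mxrank_leqif_sup sub; rewrite IH => /leqifP.
case: ifP => [sub' _|_]; last by rewrite ltnNge le.
case/negP: (indep k (leqnn _)); apply: submx_trans sub'.
by rewrite -[f k](rowK (fun i : 'I_k.+1 => f i) ord_max) row_sub.
Qed.

(** * Shift flows on a matrix and their Grassmannian coordinates *)

Section MatrixFlow.
Variables (K : fieldType) (g : nat) (M : 'I_g -> nat -> K).

Definition colblock (n s : nat) : 'M[K]_(g, n) := \matrix_(j, k) M j (k + s)%N.

Local Notation M0 := (colblock g 0).
Local Notation Mc c := (\col_j M j c).
Local Notation N c := (invmx M0 *m Mc c).

(** Affine coordinates on the big cell: the coefficient of column [g - 1 - i] when column [g + j] is
    expanded in the first [g] columns. Rows are counted backwards so that [i] and [j] both measure
    the distance from the gap at [g]; the value is 0 for [i >= g], where there is no such column. *)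
Definition grass_coord (i j : nat) : K :=
  if insub i is Some r then N (g + j) (rev_ord r) 0 else 0.

Definition is_flow (D : K -> K) (s : nat) (S : 'M[K]_g) : Prop :=
  forall j k, D (M j k) = M j (k + s)%N - \sum_i S j i * M i k.

Section Flow.
Variables (D : K -> K) (s : nat) (S : 'M[K]_g).
Hypotheses (DP : derivation D) (flow : is_flow D s S).

Lemma map_der_mulmx m n q (A : 'M[K]_(m, n)) (B : 'M[K]_(n, q)) :
  map_mx D (A *m B) = map_mx D A *m B + A *m map_mx D B.
Proof.
apply/matrixP => i j; rewrite !mxE (der_sum DP) -big_split /=.
by apply: eq_bigr => k _; rewrite !mxE (derM DP).
Qed.

Lemma flow_block n r : map_mx D (colblock n r) = colblock n (r + s) - S *m colblock n r.
Proof.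
apply/matrixP => i j; rewrite !mxE flow addnA; congr (_ - _).
by apply: eq_bigr => k _; rewrite !mxE.
Qed.

Lemma flow_col c : map_mx D (Mc c) = Mc (c + s) - S *m Mc c.
Proof.
apply/matrixP => i j; rewrite !mxE flow; congr (_ - _).
by apply: eq_bigr => k _; rewrite !mxE.
Qed.

Hypothesis M0u : M0 \in unitmx.

Lemma coord_small (k : 'I_g) i : N k i 0 = (i == k)%:R.
Proof.
have -> : Mc k = col k M0 by apply/matrixP => r ?; rewrite !mxE addn0.
by rewrite colE mulmxA mulVmx // mul1mx mxE eqxx andbT.
Qed.

(** Differentiate [M0 N = M_c]: the two terms with [S] cancel, being the same change of frame on
    both sides. *)
Lemma flow_coordE c i : D (N c i 0) =
  N (c + s) i 0 - \sum_(k < g) N (k + s) i 0 * N c k 0.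
Proof.
have e : map_mx D (N c) = N (c + s) - invmx M0 *m colblock g s *m N c.
  apply: (can_inj (mulKmx M0u)).
  have: map_mx D (M0 *m N c) = map_mx D (Mc c) by rewrite mulKVmx.
  rewrite map_der_mulmx flow_block flow_col add0n mulmxBl => e.
  apply: (addrI (colblock g s *m N c - S *m M0 *m N c)).
  by rewrite e mulmxBr -!mulmxA !mulKVmx // [RHS]addrC addrA subrK.
have := congr1 (fun A : 'cV_g => A i 0) e; rewrite [LHS]mxE => ->.
rewrite mxE [X in _ + X]mxE [X in _ - X]mxE.
congr (_ - _); apply: eq_bigr => k _; congr (_ * _).
by rewrite !mxE; apply: eq_bigr => l _; rewrite !mxE.
Qed.

Lemma flow_grass_coord i j : D (grass_coord i j) =
  grass_coord i (j + s) - grass_coord (i + s) j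
    - \sum_(b < s) grass_coord i (s - b.+1) * grass_coord b j.
Proof.
rewrite {1 2 4}/grass_coord; case: insubP => [r ltig /= ri|]; last first.
  rewrite -leqNgt => legi; rewrite (der0 DP) {1}/grass_coord insubF; last first.
    by apply/negbTE; rewrite -leqNgt (leq_trans legi) ?leq_addr.
  by rewrite big1 ?subr0 // => b _; rewrite mul0r.
rewrite flow_coordE addnA -!addrA; congr (_ + _); rewrite -opprD; congr (- _).
(* For [k + s < g] the column [k + s] is a basis column, so its coordinates form a unit vector and
   the sum collapses to the shift in [i]; the other [k] give the quadratic term. *)
rewrite (bigID (fun k : 'I_g => (k + s < g)%N)) /=; congr (_ + _).
  rewrite /grass_coord; case: insubP => [q ltq /= qE|].
    have hq : (rev_ord q + s < g)%N.
      by rewrite /= qE; have := ltn_ord r; lia.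
    have rq : rev_ord r = Ordinal hq by apply: val_inj => /=; lia.
    rewrite (bigD1 (rev_ord q)) //= big1 ?addr0.
      by rewrite -[(g - q.+1 + s)%N]/(nat_of_ord (Ordinal hq)) coord_small -rq eqxx mul1r.
    move=> k /andP[ltk /negP nk].
    rewrite -[(k + s)%N]/(nat_of_ord (Ordinal ltk)) coord_small.
    case: eqP => [e|]; last by rewrite mul0r.
    case: nk; apply/eqP; apply: val_inj => /=.
    by have /= := congr1 val e; rewrite qE -ri; lia.
  rewrite -leqNgt => legis; apply: big1 => k ltk.
  rewrite -[(k + s)%N]/(nat_of_ord (Ordinal ltk)) coord_small.
  case: eqP => [e|]; last by rewrite mul0r.
  by have /= := congr1 val e; have := ltn_ord r; rewrite -ri in legis *; lia.
pose F b := N (g + (s - b.+1)) (rev_ord r) 0 * grass_coord b j.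
rewrite (reindex_inj rev_ord_inj) /=.
rewrite [RHS](big_ord_widen_cond (g + s) xpredT F) ?leq_addl //=.
(* Both sums are compared inside a range of length [g + s]; the indices [b >= g] contribute 0 by the
   default value of [grass_coord]. *)
rewrite [RHS](bigID (fun b : 'I_(g + s) => (b < g)%N)) /=.
rewrite [X in _ = _ + X]big1 ?addr0; last first.
  move=> b /andP[_ gb]; rewrite /F /grass_coord insubF ?mulr0 //.
  exact/negbTE.
transitivity (\sum_(k < g | (k < s)%N) F k).
  apply: eq_big => k; first by have := ltn_ord k; lia.
  move=> hk; rewrite /F /grass_coord.
  case: insubP => [q _ /= qk|]; last by rewrite ltn_ord.
  have -> : q = k by apply: val_inj.
  have -> : (g - k.+1 + s = g + (s - k.+1))%N by have := ltn_ord k; lia.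
  by [].
by rewrite (big_ord_widen_cond (g + s) (fun k => (k < s)%N) F) ?leq_addr.
Qed.

End Flow.

(** Jacobi's formula. In the trace of [invmx M0 *m colblock g 1] the shifted column [k + 1 < g] is a
    basis column with diagonal coordinate 0, so only the last column contributes, with
    [grass_coord 0 0]. *)
Lemma flow_logdet (D : K -> K) (S : 'M[K]_g) :
  derivation D -> is_flow D 1 S -> M0 \in unitmx -> (0 < g)%N ->
  D (\det M0) / \det M0 = grass_coord 0 0 - \tr S.
Proof.
move=> DP flow M0u g0.
have -> : D (\det M0) = \tr (map_mx D M0 *m \adj M0).
  rewrite (der_det DP) /mxtrace; apply: eq_bigr => i _; rewrite mxE.
  by apply: eq_bigr => j _; rewrite !mxE.
have d0 : \det M0 != 0 by rewrite -unitfE -unitmxE.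
have -> : \adj M0 = \det M0 *: invmx M0.
  by rewrite /invmx M0u scalerA mulfV // scale1r.
rewrite -scalemxAr mxtraceZ mulrC mulKf //.
rewrite (flow_block flow) mulmxBl -mulmxA mulmxV // mulmx1.
rewrite raddfB /= mxtrace_mulC; congr (_ - _).
have E k : (invmx M0 *m colblock g 1) k k = N k.+1 k 0.
  by rewrite !mxE; apply: eq_bigr => l _; rewrite !mxE addn1.
pose l : 'I_g := rev_ord (Ordinal g0).
rewrite /mxtrace (bigD1 l) //= E big1 ?addr0.
  rewrite /grass_coord; case: insubP => [r _ /= r0|]; last by rewrite g0.
  have -> : rev_ord r = l by apply: val_inj => /=; lia.
  have le : l.+1 = g by rewrite /=; lia.
  by rewrite {1}le addn0.
move=> k kl; rewrite E; have hk : (k.+1 < g)%N.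
  rewrite ltn_neqAle ltn_ord andbT; apply: contra kl => /eqP e.
  by apply/eqP/val_inj => /=; lia.
rewrite -[k.+1]/(nat_of_ord (Ordinal hk)) coord_small //.
by case: eqP => // /(congr1 val) /=; lia.
Qed.

(** The correction [\tr S1] in [flow_logdet] is killed by [D1], so [f] is twice [D1] of
    [grass_coord 0 0]. *)
Lemma flow_KP (D1 D2 D3 : K -> K) (S1 S2 S3 : 'M[K]_g) :
  derivation D1 -> derivation D2 -> derivation D3 ->
  is_flow D1 1 S1 -> is_flow D2 2 S2 -> is_flow D3 3 S3 ->
  M0 \in unitmx -> (0 < g)%N -> D1 (\tr S1) = 0 ->
  let f := 2%:R * D1 (D1 (\det M0) / \det M0) in
  D1 (4%:R * D3 f - 6%:R * f * D1 f - D1 (D1 (D1 f))) = 3%:R * D2 (D2 f).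
Proof.
move=> D1P D2P D3P fl1 fl2 fl3 M0u g0 trS f.
have F1 := flow_grass_coord D1P fl1 M0u.
have F2 := flow_grass_coord D2P fl2 M0u.
have F3 := flow_grass_coord D3P fl3 M0u.
apply: (riccati_KP (p := grass_coord) D1P D2P D3P).
- by move=> i j; rewrite F1 big_ord1 addn1 addn1.
- by move=> i j; rewrite F2 !big_ord_recl big_ord0 addr0 !addn2.
- by move=> i j; rewrite F3 !big_ord_recl big_ord0 addr0 !addn3 addrA.
by rewrite /f (flow_logdet D1P fl1) // (derB D1P) trS subr0.
Qed.

Definition rowblock n : 'M[K]_(n, g) := \matrix_(k, j) M j k.

(* If the columns below [n] already span column [n], they span all of them:
   differentiating a linear relation shifts it. *)
Lemma flow_rank (D : K -> K) (S : 'M[K]_g) n :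
  derivation D -> is_flow D 1 S -> \rank (rowblock n) = g -> M0 \in unitmx.
Proof.
move=> DP flow rkn.
pose rw c : 'rV[K]_g := \row_j M j c.
have row_rw m (k : 'I_m) : row k (rowblock m) = rw k.
  by apply/rowP => j; rewrite !mxE.
have Drw c : map_mx D (rw c) = rw c.+1 - rw c *m S^T.
  apply/rowP => j; rewrite !mxE flow addn1; congr (_ - _).
  by apply: eq_bigr => k _; rewrite !mxE mulrC.
have span m : (rw m <= rowblock m)%MS -> forall c, (rw c <= rowblock m)%MS.
  move=> lem; have le c : (c <= m)%N -> (rw c <= rowblock m)%MS.
    rewrite leq_eqVlt => /orP[/eqP-> //|ltcm].
    by rewrite -[rw c](row_rw m (Ordinal ltcm)) row_sub.
  have shift : (\matrix_(k < m) rw k.+1 <= rowblock m)%MS.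
    by apply/row_subP => k; rewrite rowK le.
  elim=> [|c IH]; first exact: le.
  case/submxP: (IH) => C eC.
  have DX : map_mx D (rowblock m) = \matrix_(k < m) rw k.+1 - rowblock m *m S^T.
    apply/row_matrixP => k; rewrite -map_row row_rw Drw linearB /= rowK.
    by rewrite row_mul row_rw.
  have := Drw c; rewrite {1}eC (map_der_mulmx DP) DX => /eqP.
  rewrite eq_sym subr_eq => /eqP ->.
  rewrite mulmxBr mulmxA -eC addrA subrK.
  by rewrite addmx_sub ?submxMl // mulmx_sub.
have indep m : (m < g)%N -> ~~ (rw m <= rowblock m)%MS.
  move=> ltmg; apply/negP => /span all.
  have : (rowblock n <= rowblock m)%MS.
    by apply/row_subP => k; rewrite row_rw all.
  by move/mxrankS; rewrite rkn leqNgt (leq_ltn_trans (rank_leq_row _)).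
have rk : \rank (rowblock g) = g.
  have -> : rowblock g = \matrix_(i < g) rw i.
    by apply/row_matrixP => k; rewrite row_rw rowK.
  apply: rank_indep => m /indep; congr (~~ (_ <= _)%MS).
  by apply/row_matrixP => k; rewrite row_rw rowK.
have -> : M0 = (rowblock g)^T by apply/matrixP => i j; rewrite !mxE addn0.
by rewrite unitmx_tr -row_free_unit -row_leq_rank rk.
Qed.

End MatrixFlow.

(** * Polynomials in several variables and their restrictions to lines *)

Local Notation mpoly n F := (mpoly.mpoly n F).
Local Notation ev := mpoly.meval.
Local Notation mX i := (mpoly.mpolyX _ (mpoly.mnm1 i)).

Lemma mpoly_ring_ind n (F : comNzRingType) (P : mpoly n F -> Prop) :
  (forall c, P (mpoly.mpolyC n c)) -> (forall i, P (mX i)) ->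
  (forall p q, P p -> P q -> P (p + q)) ->
  (forall p q, P p -> P q -> P (p * q)) -> forall p, P p.
Proof.
move=> PC PX PD PM p; rewrite [p]mpoly.mpolyE.
have P1 : P 1 by rewrite -mpoly.mpolyC1; apply: PC.
have P0 : P 0 by rewrite -(mpoly.mpolyC0 n); apply: PC.
apply: (big_ind P) => // m _; rewrite -mpoly.mul_mpolyC mpoly.mpolyXE_id.
apply: (PM) => //; apply: (@big_ind _ P _ _ P1 PM) => i _.
by elim: (mpoly.fun_of_multinom m i) => [|k IH]; rewrite ?expr0 // exprS; apply: PM.
Qed.

Lemma mmap_chain_rule n (F S : comNzRingType) (f : {rmorphism F -> S})
    (h : 'I_n -> S) (D : S -> S) (p : mpoly n F) :
  derivation D -> (forall c, D (f c) = 0) ->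
  D (mpoly.mmap f h p) = \sum_i D (h i) * mpoly.mmap f h (mpoly.mderiv i p).
Proof.
move=> DP Df; elim/mpoly_ring_ind: p => [c|i|p q IHp IHq|p q IHp IHq].
- rewrite mpoly.mmapC Df big1 // => i _.
  by rewrite mpoly.mderivC mpoly.mmap0 mulr0.
- rewrite mpoly.mmapX mpoly.mmap1U (bigD1 i) //= [X in _ = _ + X]big1 ?addr0.
    rewrite mpoly.mderivX mpoly.mnm1E eqxx scale1r.
    suff -> : mpoly.mnm_sub (mpoly.mnm1 i) (mpoly.mnm1 i) = @mpoly.mnm0 n.
      by rewrite mpoly.mpolyX0 rmorph1 mulr1.
    by apply/mpoly.mnmP => j; rewrite mpoly.mnmBE mpoly.mnm0E subnn.
  move=> j ji; rewrite mpoly.mderivX mpoly.mnm1E eq_sym (negbTE ji) scale0r.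
  by rewrite mpoly.mmap0 mulr0.
- rewrite mpoly.mmapD (derD DP) IHp IHq -big_split; apply: eq_bigr => i _ /=.
  by rewrite mpoly.mderivD mpoly.mmapD mulrDr.
rewrite rmorphM (derM DP) IHp IHq mulr_suml mulr_sumr -big_split.
apply: eq_bigr => i _ /=.
by rewrite mpoly.mderivM mpoly.mmapD !rmorphM /=; ring.
Qed.

Lemma deriv_derivation (F : comNzRingType) : derivation (@deriv F).
Proof. by split=> p q; [exact: poly.derivD | exact: derivM]. Qed.

Lemma mderiv_derivation n (F : comNzRingType) i : derivation (@mpoly.mderiv n F i).
Proof. by split=> p q; [exact: mpoly.mderivD | exact: mpoly.mderivM]. Qed.

Section Lines.
Variables (n : nat) (F : numFieldType).
Implicit Types (p q : mpoly n F) (z d : 'I_n -> F).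

Fact line_key : unit. Proof. exact: tt. Qed.

Definition line : ('I_n -> F) -> ('I_n -> F) -> mpoly n F -> {poly F} :=
  locked_with line_key (fun z d =>
    mpoly.mmap (@polyC F) (fun i => (z i)%:P + d i *: 'X)).

Lemma line_def z d p :
  line z d p = mpoly.mmap (@polyC F) (fun i => (z i)%:P + d i *: 'X) p.
Proof. by rewrite /line unlock. Qed.

Lemma lineD z d p q : line z d (p + q) = line z d p + line z d q.
Proof. by rewrite !line_def mpoly.mmapD. Qed.

Lemma lineM z d p q : line z d (p * q) = line z d p * line z d q.
Proof. by rewrite !line_def rmorphM. Qed.

Lemma lineE z d p s : (line z d p).[s] = ev (fun i => z i + s * d i) p.
Proof.
elim/mpoly_ring_ind: p => [c|i|p q IHp IHq|p q IHp IHq].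
- by rewrite line_def mpoly.mmapC hornerC mpoly.mevalC.
- rewrite line_def mpoly.mmapX mpoly.mmap1U mpoly.mevalXU.
  by rewrite !hornerE mulrC.
- by rewrite lineD hornerD IHp IHq mpoly.mevalD.
by rewrite lineM hornerM IHp IHq mpoly.mevalM.
Qed.

Definition dird d p : mpoly n F := \sum_i d i *: mpoly.mderiv i p.

Lemma line_deriv z d p : (line z d p)^`() = line z d (dird d p).
Proof.
rewrite !line_def (mmap_chain_rule _ _ (deriv_derivation F)); last first.
  by move=> c; rewrite derivC.
rewrite raddf_sum; apply: eq_bigr => i _ /=.
by rewrite poly.derivD derivC derivZ derivX add0r mpoly.mmapZ alg_polyC.
Qed.

Lemma dirdE z d p : ev z (dird d p) = (line z d p)^`().[0].
Proof.
by rewrite line_deriv lineE; apply: mpoly.meval_eq => i; rewrite mul0r addr0.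
Qed.

Lemma ev_dird z d p : ev z (dird d p) = \sum_i d i * ev z (mpoly.mderiv i p).
Proof. by rewrite raddf_sum; apply: eq_bigr => i _; rewrite /= mpoly.mevalZ. Qed.

Lemma poly_eq0_natr (p : {poly F}) : (forall k : nat, p.[k%:R] = 0) -> p = 0.
Proof.
move=> p0; apply/eqP; apply: contraT => nz.
have := max_poly_roots nz (rs := [seq k%:R | k <- iota 0 (size p)]).
rewrite size_map size_iota ltnn; apply.
  by apply/allP => _ /mapP[k _ ->]; apply/rootP.
by rewrite map_inj_uniq ?iota_uniq //; apply: mulrIn; rewrite oner_eq0.
Qed.

Lemma poly_ext (p q : {poly F}) : (forall x, p.[x] = q.[x]) -> p = q.
Proof.
move=> e; apply/eqP; rewrite -subr_eq0; apply/eqP/poly_eq0_natr => k.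
by rewrite hornerD hornerN e subrr.
Qed.

Lemma poly_eq0_infinite (p : {poly F}) :
  (forall k, exists2 m : nat, (k <= m)%N & p.[m%:R] = 0) -> p = 0.
Proof.
move=> inf; apply/eqP; apply: contraT => nz.
have [s us] : exists2 s : seq nat, uniq s & size s = size p /\
    all (fun m => p.[m%:R] == 0) s.
  elim: (size p) => [|k [s us [sz al]]]; first by exists [::].
  have [m lem pm] := inf (\max_(i <- s) i).+1.
  exists (m :: s) => /=; last by rewrite sz pm eqxx.
  rewrite us andbT; apply/negP => ms.
  by have := leq_trans lem (@leq_bigmax_seq _ s xpredT (fun i : nat => i) m ms isT); rewrite ltnn.
move=> [sz al]; have := max_poly_roots nz (rs := [seq k%:R | k <- s]).
rewrite size_map sz ltnn; apply; last first.
  by rewrite map_inj_uniq //; apply: mulrIn; rewrite oner_eq0.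
by rewrite all_map; apply: sub_all al => m /=; rewrite /root.
Qed.

Lemma poly_neq0_eventually (p : {poly F}) : p != 0 ->
  exists k0, forall m, (k0 <= m)%N -> p.[m%:R] != 0.
Proof.
move=> /eqP nz; apply: contrapT => nex; apply: nz; apply: poly_eq0_infinite => k.
apply: contrapT => nk; apply: nex; exists k => m lekm.
by apply/eqP => pm; apply: nk; exists m.
Qed.

Let delta i : 'I_n -> F := fun j => (j == i)%:R.

Lemma dird_delta i p : dird (delta i) p = mpoly.mderiv i p.
Proof.
rewrite /dird (bigD1 i) //= [X in _ + X]big1 ?addr0.
  by rewrite /delta eqxx scale1r.
by move=> j /negbTE ji; rewrite /delta ji scale0r.
Qed.

(* In characteristic 0 a polynomial function determines its partial
   derivatives, which lowers the degree. *)
Lemma ev_eq0 p : (forall z, ev z p = 0) -> p = 0.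
Proof.
have : forall m, mpoly.mcoeff m p != 0 -> (mpoly.mdeg m < mpoly.msize p)%N.
  by move=> m; rewrite -mpoly.mcoeff_msupp => /mpoly.msize_mdeg_lt.
elim: (mpoly.msize p) {1 3 4}p => [|k IH] q lek q0.
  by apply/mpoly.mpolyP => m; rewrite mpoly.mcoeff0; apply/eqP;
     apply: contraT => /lek.
have D0 i : mpoly.mderiv i q = 0.
  apply: IH => [m|z].
    rewrite mpoly.mcoeff_mderiv => nz.
    have /lek : mpoly.mcoeff (mpoly.mnm_add m (mpoly.mnm1 i)) q != 0.
      by apply: contraNneq nz => ->; rewrite mul0rn.
    by rewrite mpoly.mdegD mpoly.mdeg1 addn1 ltnS.
  rewrite -dird_delta dirdE; suff -> : line z (delta i) q = 0.
    by rewrite derivC horner0.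
  by apply: poly_eq0_natr => m; rewrite lineE.
have nz m : m != @mpoly.mnm0 n -> mpoly.mcoeff m q = 0.
  move=> m0; have [i mi] : exists i, mpoly.fun_of_multinom m i != 0%N.
    apply: contrapT => nex; case/eqP: m0; apply/mpoly.mnmP => i.
    by rewrite mpoly.mnm0E; apply/eqP; apply: contrapT => mi; apply: nex; exists i; apply/negP.
  have := congr1 (mpoly.mcoeff (mpoly.mnm_sub m (mpoly.mnm1 i))) (D0 i).
  rewrite mpoly.mcoeff_mderiv mpoly.mcoeff0 mpoly.submK.
    by move/eqP; rewrite mulrn_eq0 /= => /eqP.
  by apply/mpoly.mnm_lepP => j; rewrite mpoly.mnm1E; case: eqP => // <-; rewrite lt0n.
have e : q = mpoly.mpolyC n (mpoly.mcoeff (@mpoly.mnm0 n) q).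
  apply/mpoly.mpolyP => l; rewrite mpoly.mcoeffC.
  have [->|nl] := eqVneq l (@mpoly.mnm0 n); first by rewrite mulr1.
  by rewrite mulr0 nz.
by have := q0 (fun=> 0); rewrite e mpoly.mevalC => ->; rewrite mpoly.mpolyC0.
Qed.

Lemma ev_ext p q : (forall z, ev z p = ev z q) -> p = q.
Proof.
move=> e; apply/eqP; rewrite -subr_eq0; apply/eqP/ev_eq0 => z.
by rewrite mpoly.mevalB e subrr.
Qed.

Lemma ev_neq0 p : p != 0 -> exists z, ev z p != 0.
Proof.
move=> /eqP nz; apply: contrapT => nex; apply: nz; apply: ev_eq0 => z.
by apply/eqP; apply: contrapT => /negP ez; apply: nex; exists z.
Qed.

End Lines.

(** * The ideal of an irreducible hypersurface with a smooth point *)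

Section Hypersurface.
Variables (n : nat) (F : numClosedFieldType).
Local Notation A := (mpoly n F).
Implicit Types (p q : A) (z d : 'I_n -> F) (G H : {poly A}).

(** Restriction of a polynomial to the line in direction [d] through the generic point; [spec z]
    moves that point to [z]. *)
Definition lineX : ('I_n -> F) -> A -> {poly A} :=
  locked_with line_key (fun d =>
    mpoly.mmap (polyC \o @mpoly.mpolyC n F)
      (fun i => (mX i)%:P + (mpoly.mpolyC n (d i)) *: 'X)).

Lemma lineX_def d p : lineX d p = mpoly.mmap (polyC \o @mpoly.mpolyC n F)
  (fun i => (mX i)%:P + (mpoly.mpolyC n (d i)) *: 'X) p.
Proof. by rewrite /lineX unlock. Qed.

Definition spec z : {poly A} -> {poly F} := map_poly (ev z).

Lemma lineX_D d p q : lineX d (p + q) = lineX d p + lineX d q.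
Proof. by rewrite !lineX_def mpoly.mmapD. Qed.

Lemma lineX_M d p q : lineX d (p * q) = lineX d p * lineX d q.
Proof. by rewrite !lineX_def rmorphM. Qed.

Lemma specD z G H : spec z (G + H) = spec z G + spec z H.
Proof. exact: rmorphD. Qed.

Lemma specM z G H : spec z (G * H) = spec z G * spec z H.
Proof. exact: rmorphM. Qed.

Lemma spec_coef z G k : (spec z G)`_k = ev z G`_k.
Proof. by rewrite coef_map. Qed.

Lemma specC z p : spec z p%:P = (ev z p)%:P.
Proof. by rewrite /spec map_polyC. Qed.

Lemma spec_lineX z d p : spec z (lineX d p) = line z d p.
Proof.
elim/mpoly_ring_ind: p => [c|i|p q IHp IHq|p q IHp IHq].
- by rewrite lineX_def line_def !mpoly.mmapC specC mpoly.mevalC.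
- rewrite lineX_def line_def !mpoly.mmapX !mpoly.mmap1U specD specC mpoly.mevalXU.
  by rewrite /spec map_polyZ map_polyX /= mpoly.mevalC.
- by rewrite lineX_D specD lineD IHp IHq.
by rewrite lineX_M specM lineM IHp IHq.
Qed.

Lemma lineX_at0 d p : (lineX d p).[0] = p.
Proof.
apply: ev_ext => z.
rewrite -horner_map /= rmorph0 -/(spec z _) spec_lineX lineE.
by apply: mpoly.meval_eq => i; rewrite mul0r addr0.
Qed.

(* A generic line meets a hypersurface in the expected number of points, the
   coefficient of highest degree being that of the top form of [p]. *)
Definition top_form p : A :=
  \sum_(m <- mpoly.msupp p | mpoly.mdeg m == (mpoly.msize p).-1)
    mpoly.mcoeff m p *: mpoly.mpolyX F m.

Let leads (k : nat) (P : {poly F}) (c : F) := (size P <= k.+1)%N /\ P`_k = c.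

Let leads_mul k l P Q c e : leads k P c -> leads l Q e -> leads (k + l) (P * Q) (c * e).
Proof.
move=> [sP <-] [sQ <-]; split.
  by apply: leq_trans (size_polyMleq _ _) _; lia.
rewrite coefM (bigD1 (inord k)) //= [X in _ + X]big1 ?addr0.
  by rewrite inordK ?ltnS ?leq_addr // addKn.
move=> i; rewrite -val_eqE /= inordK ?ltnS ?leq_addr // => ik.
case: (ltngtP i k) ik => // [lt|gt] _.
  by rewrite [Q`_ _]nth_default ?mulr0 // (leq_trans sQ) //; lia.
by rewrite nth_default ?mul0r // (leq_trans sP).
Qed.

Lemma line_top z d p :
  (size (line z d p) <= (mpoly.msize p).-1.+1)%N /\
  (line z d p)`_(mpoly.msize p).-1 = ev d (top_form p).
Proof.
set D := (mpoly.msize p).-1.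
have mono m : leads (mpoly.mdeg m) (line z d (mpoly.mpolyX F m))
    (ev d (mpoly.mpolyX F m)).
  rewrite line_def mpoly.mmapX mpoly.mevalX /mpoly.mmap1 mpoly.mdegE.
  elim/big_rec3: _ => [|i k c P _ IH].
    by split; rewrite ?size_poly1 // coef1.
  apply: leads_mul IH.
  elim: (mpoly.fun_of_multinom m i) => [|k' IH'].
    by split; rewrite ?expr0 ?size_poly1 // coef1.
  rewrite !exprS -add1n; apply: leads_mul IH'; split.
    rewrite (leq_trans (size_polyD _ _)) // geq_max (leq_trans (size_polyC_leq1 _)) //=.
    by rewrite (leq_trans (size_scale_leq _ _)) // size_polyX.
  by rewrite coefD coefC coefZ coefX /= add0r mulr1.
have supp m : m \in mpoly.msupp p -> (mpoly.mdeg m <= D)%N.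
  by move=> /mpoly.msize_mdeg_lt; rewrite /D; case: (mpoly.msize p).
have -> : line z d p = \sum_(m <- mpoly.msupp p)
    mpoly.mcoeff m p *: line z d (mpoly.mpolyX F m).
  rewrite {1}[p]mpoly.mpolyE line_def raddf_sum; apply: eq_bigr => m _ /=.
  by rewrite mpoly.mmapZ mul_polyC line_def.
rewrite /top_form raddf_sum /= coef_sum; split.
  apply: (leq_trans (size_sum _ _ _)); apply/bigmax_leqP_seq => m mp _.
  rewrite (leq_trans (size_scale_leq _ _)) // (leq_trans (mono m).1) //.
  by rewrite ltnS supp.
rewrite [RHS]big_mkcond big_seq [RHS]big_seq; apply: eq_bigr => m mp.
rewrite coefZ; case: eqP => [e|/eqP ne]; first by rewrite /D -e (mono m).2 mpoly.mevalZ.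
rewrite nth_default ?mulr0 // (leq_trans (mono m).1) //.
by rewrite ltn_neqAle ne supp.
Qed.

Lemma top_form_neq0 p : p != 0 -> top_form p != 0.
Proof.
move=> nz; have lp := mpoly.mlead_supp nz.
apply/eqP => /(congr1 (mpoly.mcoeff (mpoly.mlead p))).
rewrite raddf_sum /= mpoly.mcoeff0 big_mkcond (bigD1_seq (mpoly.mlead p)) //=.
  rewrite -(mpoly.mlead_deg nz) eqxx mpoly.mcoeffZ mpoly.mcoeffX eqxx mulr1.
  rewrite big1 ?addr0; first by apply/eqP; rewrite -mpoly.mcoeff_msupp.
  move=> m /negbTE ne; case: ifP => // _.
  by rewrite mpoly.mcoeffZ mpoly.mcoeffX ne mulr0.
Qed.

Section MainHypersurface.
Variables (T : A) (W : set ('I_n -> F)).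
Hypothesis W0 : forall w, W w -> ev w T = 0.
Hypothesis Wcl : forall q, (forall w, W w -> ev w q = 0) ->
  forall z, ev z T = 0 -> ev z q = 0.
Hypothesis Wirr : forall p q, (forall w, W w -> ev w p * ev w q = 0) ->
  (forall w, W w -> ev w p = 0) \/ (forall w, W w -> ev w q = 0).

Variable d : 'I_n -> F.

(* The ideal of the incidence variety {(z, x) | T (z + x d) = 0}. *)
Definition incid G := forall z x, (line z d T).[x] = 0 -> (spec z G).[x] = 0.

Lemma incidMl G H : incid G -> incid (G * H).
Proof. by move=> iG z x Tx; rewrite specM hornerM iG // mul0r. Qed.

Lemma incidD G H : incid G -> incid H -> incid (G + H).
Proof. by move=> iG iH z x Tx; rewrite specD hornerD iG // iH // addr0. Qed.

Lemma incidB G H : incid G -> incid H -> incid (G - H).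
Proof.
move=> iG iH z x Tx; rewrite /spec rmorphB /= -!/(spec _ _).
by rewrite hornerD hornerN iG // iH // subrr.
Qed.

Let slide (x : F) G : A :=
  mpoly.comp_mpoly [tuple mX i - mpoly.mpolyC n (x * d i) | i < n]
    G.[mpoly.mpolyC n x].

Let slideE x G w : ev w (slide x G) = (spec (fun i => w i - x * d i) G).[x].
Proof.
rewrite /slide mpoly.comp_mpoly_meval.
set v := fun i => _; have -> : ev v G.[mpoly.mpolyC n x] = (spec v G).[x].
  by rewrite -horner_map /= mpoly.mevalC.
congr ((map_poly _ G).[x]); apply/funext => p; apply: mpoly.meval_eq => i.
by rewrite /v tnth_mktuple mpoly.mevalB mpoly.mevalXU mpoly.mevalC.
Qed.

(** The incidence variety is the product of the hypersurface and the affine line, by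
    [(w, x) -> (w - x d, x)]; [slide x] pulls a slice back to the hypersurface, where [W] is dense
    by [Wcl]. *)
Lemma incidP G : incid G <-> forall x w, W w -> ev w (slide x G) = 0.
Proof.
split=> [iG x w Ww|GW z x].
  rewrite slideE; apply: iG; rewrite lineE -[RHS](W0 Ww).
  by apply: mpoly.meval_eq => i; rewrite subrK.
rewrite lineE => Tzx; have := Wcl (GW x) Tzx; rewrite slideE => e; rewrite -[RHS]e.
congr ((map_poly _ G).[x]); apply/funext => p; apply: mpoly.meval_eq => i.
by rewrite addrK.
Qed.

(** For each integer [x] one factor vanishes on the slice, by irreducibility of [W]; so one of them
    does for arbitrarily large integers. At a fixed [w] its value is polynomial in [x], hence
    zero. *)
Lemma incid_prime G H : incid (G * H) -> incid G \/ incid H.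
Proof.
move=> /incidP GH.
pose vanish G (k : nat) := forall w, W w -> ev w (slide k%:R G) = 0.
have alt (k : nat) : vanish G k \/ vanish H k.
  apply: Wirr => w Ww; rewrite -[RHS](GH k%:R w Ww) !slideE.
  by rewrite specM hornerM.
have inf (Q : {poly A}) : (forall k, exists2 m, (k <= m)%N & vanish Q m) -> incid Q.
  move=> iQ; apply/incidP => x w Ww.
  have [P PE] : exists P : {poly F}, forall y, ev w (slide y Q) = P.[y].
    exists (\sum_(k < size Q) line w (fun i => - d i) Q`_k * 'X^k) => y.
    rewrite slideE horner_sum (@horner_coef_wide _ (size Q)); last exact: size_poly.
    apply: eq_bigr => k _; rewrite spec_coef hornerM hornerXn lineE.
    by congr (_ * _); apply: mpoly.meval_eq => i; rewrite mulrN.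
  suff P0 : P = 0 by rewrite PE P0 horner0.
  apply: poly_eq0_infinite => k; have [m lekm vm] := iQ k.
  by exists m => //; rewrite -PE vm.
have [infG|fin] := pselect (forall k, exists2 m, (k <= m)%N & vanish G m).
  by left; apply: inf.
right; apply: inf => k.
move/existsNP: fin => [l /forall2NP nl].
exists (maxn k l); first exact: leq_maxl.
have [vG|//] := alt (maxn k l).
have [/negP|nv] := nl (maxn k l); first by rewrite leq_maxr.
by have := nv vG.
Qed.

(** Modulo a prime ideal, an algebraic relation for a nonzero [G] can be divided by [G] until its
    constant term is nonzero; then [G] divides that constant term. *)
Lemma incid_inv_of_algebraic (P : {poly A}) G :
  P != 0 -> ~ incid G -> incid ((map_poly polyC P).[G]) ->
  exists c H, c != 0 /\ incid (c%:P + G * H).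
Proof.
move=> P0 nG; elim/poly_ind: P P0 => [|P c IH]; first by rewrite eqxx.
rewrite rmorphD rmorphM /= map_polyX map_polyC /= hornerD hornerM hornerX hornerC.
have [->|c0] := eqVneq c 0; last first.
  by move=> _ iP; exists c, (map_poly polyC P).[G]; rewrite addrC mulrC.
rewrite !addr0 => PX; have P0 : P != 0 by apply: contraNneq PX => ->; rewrite mul0r.
by case/incid_prime => // /(IH P0).
Qed.

Variables (D : nat) (c0 : F).
Hypothesis c0_neq0 : c0 != 0.
Hypothesis lineT : forall z, size (line z d T) = D.+2 /\ lead_coef (line z d T) = c0.

Local Notation f := ((mpoly.mpolyC n c0^-1)%:P * lineX d T).

Let spec_f z : spec z f = c0^-1 *: line z d T.
Proof. by rewrite specM specC mpoly.mevalC spec_lineX mul_polyC. Qed.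

Let size_f : size f = D.+2.
Proof.
have ef k : (forall z, (spec z f)`_k = 0) -> f`_k = 0.
  by move=> e; apply: ev_eq0 => z; rewrite -spec_coef.
have sz z : size (spec z f) = D.+2.
  by rewrite spec_f size_scale ?invr_eq0 // (lineT z).1.
apply/eqP; rewrite eqn_leq; apply/andP; split.
  by apply/leq_sizeP => k lek; apply: ef => z; rewrite nth_default // sz.
by rewrite -(sz (fun=> 0)) size_poly.
Qed.

Let monic_f : f \is monic.
Proof.
rewrite monicE /lead_coef size_f; apply/eqP/ev_ext => z.
rewrite -spec_coef spec_f coefZ mpoly.meval1.
by have [sz <-] := lineT z; rewrite /lead_coef sz mulVf // -[X in _`_X]/(D.+2.-1)
  -sz -/(lead_coef _) (lineT z).2.
Qed.

Let incid_f : incid f.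
Proof. by move=> z x Tx; rewrite spec_f hornerZ Tx mulr0. Qed.

(* Every [G] is integral over the constants modulo [f], by Cayley-Hamilton for
   the multiplication by [G]. *)
Lemma integral_mod_f G : exists P : {poly A}, P != 0 /\ incid ((map_poly polyC P).[G]).
Proof.
pose red (H : {poly A}) := Pdiv.CommonRing.rmodp H f.
have sred H : (size (red H) <= D.+1)%N.
  by have := Pdiv.CommonRing.ltn_rmodp H f; rewrite monic_neq0 // size_f.
have incid_red H : incid (red H) -> incid H.
  move=> iH; rewrite [H](Pdiv.RingMonic.rdivp_eq monic_f); apply: incidD iH.
  by rewrite mulrC; apply: incidMl.
have redD H1 H2 : red (H1 + H2) = red H1 + red H2.
  exact: Pdiv.RingMonic.rmodpD.
have redM H1 H2 : red (red H1 * H2) = red (H1 * H2).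
  by rewrite mulrC [in RHS]mulrC /red Pdiv.RingMonic.rmodp_mulmr.
pose M : 'M[A]_D.+1 := \matrix_(i < D.+1) poly_rV (red ('X^i * G)).
have MP (v : {poly A}) : (size v <= D.+1)%N -> poly_rV v *m M = poly_rV (red (v * G)).
  move=> sv; rewrite mulmx_sum_row; transitivity (poly_rV (d := D.+1) (\sum_(i < D.+1) v`_i *: red ('X^i * G))).
    rewrite linear_sum; apply: eq_bigr => i _.
    by rewrite mxE rowK linearZ.
  congr poly_rV.
  have redZ a H : red (a *: H) = a *: red H by exact: Pdiv.RingMonic.rmodpZ.
  have redS (u : 'I_D.+1 -> {poly A}) : red (\sum_i u i) = \sum_i red (u i).
    by apply: (big_morph red redD); rewrite /red Pdiv.CommonRing.rmod0p.
  rewrite (_ : v * G = \sum_(i < D.+1) v`_i *: ('X^i * G)).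
    by rewrite redS; apply: eq_bigr => i _; rewrite redZ.
  rewrite {1}(_ : v = \sum_(i < D.+1) v`_i *: 'X^i) ?mulr_suml.
    by apply: eq_bigr => i _; rewrite scalerAl.
  rewrite -(poly_def D.+1); apply/polyP => k; rewrite coef_poly.
  by case: ltnP => // lek; rewrite nth_default // (leq_trans sv).
have CH (P : {poly A}) : poly_rV (red 1) *m horner_mx M P =
    poly_rV (red (map_poly polyC P).[G]).
  elim/poly_ind: P => [|P c IH].
    by rewrite !rmorph0 mulmx0 horner0 /red Pdiv.CommonRing.rmod0p linear0.
  rewrite !rmorphD !rmorphM /= horner_mx_X horner_mx_C map_polyX map_polyC /=.
  rewrite -mulmxE hornerD hornerM hornerX hornerC redD mulmxDr mulmxA IH [RHS]linearD.
  rewrite MP ?sred // redM; congr (_ + _).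
  rewrite mul_mx_scalar -linearZ; congr poly_rV.
  by rewrite /red -Pdiv.RingMonic.rmodpZ // -mul_polyC mulr1.
exists (char_poly M); split; first exact: monic_neq0 (char_poly_monic M).
apply: incid_red; have := CH (char_poly M).
rewrite Cayley_Hamilton mulmx0 => e.
suff -> : red (map_poly polyC (char_poly M)).[G] = 0.
  by move=> z x _; rewrite /spec rmorph0 horner0.
apply/polyP => k; rewrite coef0; case: (ltnP k D.+1) => lek.
  by have /matrixP/(_ 0 (Ordinal lek)) := e; rewrite !mxE /= => <-.
by rewrite nth_default // (leq_trans (sred _)).
Qed.

Lemma incid_inv G : ~ incid G -> exists c H, c != 0 /\ incid (c%:P + G * H).
Proof.
move=> nG; have [P [P0 iP]] := integral_mod_f G.
exact: incid_inv_of_algebraic P0 nG iP.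
Qed.

Hypothesis smooth_pt : exists2 w0, W w0 & ev w0 (dird d T) != 0.

(** At the smooth point [f'] does not vanish, so by [incid_inv] it divides some [c != 0] modulo the
    ideal. Where [c] is nonzero, [f] thus has [D + 1] distinct roots, and the remainder of [G] by
    [f], of degree at most [D], vanishes at all of them. *)
Lemma incid_ideal G : incid G -> exists H, G = H * f.
Proof.
have [w0 Ww0 dT] := smooth_pt.
have nf' : ~ incid f^`().
  move=> /(_ w0 0); rewrite {1}lineE => /(_ _)/eqP.
  rewrite /spec -deriv_map -/(spec _ _) spec_f derivZ hornerZ -dirdE.
  rewrite mulf_eq0 invr_eq0 (negbTE c0_neq0) (negbTE dT) => /(_ _)/negP; apply=> //.
  by rewrite -[RHS](W0 Ww0); apply: mpoly.meval_eq => i; rewrite mul0r addr0.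
have [c [H [cn0 icH]]] := incid_inv nf'.
move=> iG; exists (Pdiv.CommonRing.rdivp G f).
set Q := Pdiv.CommonRing.rdivp G f; pose r := Pdiv.CommonRing.rmodp G f.
have eG : G = Q * f + r := Pdiv.RingMonic.rdivp_eq monic_f G.
have ir : incid r.
  have -> : r = G - f * Q by rewrite [in RHS]eG mulrC addrC addKr.
  by apply: incidB => //; apply: incidMl.
have sr : (size r <= D.+1)%N.
  by have := Pdiv.CommonRing.ltn_rmodp G f; rewrite monic_neq0 // size_f.
suff r0 : r = 0 by rewrite {1}eG r0 addr0.
apply/polyP => k; rewrite coef0.
suff : c * r`_k = 0 by move/eqP; rewrite mulf_eq0 (negbTE cn0) => /eqP.
apply: ev_eq0 => z; rewrite mpoly.mevalM -spec_coef.
have [->|cz] := eqVneq (ev z c) 0; first by rewrite mul0r.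
suff -> : spec z r = 0 by rewrite coef0 mulr0.
have [rs frs] := closed_field_poly_normal (spec z f).
have mz : spec z f \is monic.
  by rewrite monicE spec_f lead_coefZ (lineT z).2 mulVf.
rewrite (monicP mz) scale1r in frs.
have root_rs x : x \in rs -> (line z d T).[x] = 0.
  rewrite -root_prod_XsubC -frs spec_f => /rootP /eqP.
  by rewrite hornerZ mulf_eq0 invr_eq0 (negbTE c0_neq0) => /eqP.
have urs : uniq rs.
  rewrite -separable_prod_XsubC -frs separable_poly.unlock.
  apply/Pdiv.ClosedField.coprimepP => x.
  rewrite frs root_prod_XsubC -frs => /root_rs Tx; apply/eqP => f'x.
  have := icH z x Tx; rewrite specD specM specC hornerD hornerM hornerC.
  rewrite /spec -[in map_poly _ f^`()]deriv_map -/(spec z f) f'x mul0r addr0.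
  by move/eqP; rewrite (negbTE cz).
apply/eqP; apply: contraT => nz.
have := max_poly_roots nz (rs := rs); rewrite urs.
have -> : all (root (spec z r)) rs.
  by apply/allP => x /root_rs Tx; apply/rootP; apply: ir.
have szf : size rs = D.+1.
  have := size_prod_XsubC rs id; rewrite -frs => /eqP.
  rewrite /spec size_map_poly_id0 ?size_f; first by move/eqP => [].
  by rewrite (monicP monic_f) rmorph1 oner_neq0.
move=> /(_ isT isT); rewrite szf ltnNge => /negP; case.
by apply: leq_trans sr; apply: size_poly.
Qed.

Lemma divides_of_vanishing p : incid (lineX d p) -> exists q, p = T * q.
Proof.
move=> /incid_ideal[H e]; exists (H.[0] * mpoly.mpolyC n c0^-1).
rewrite -[LHS](lineX_at0 d) e !hornerM hornerC lineX_at0; ring.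
Qed.

(** [S] divides some [c != 0] modulo the ideal, and its zeros are zeros of [T]; so on lines in
    direction [d] through points with [c != 0] it has no root and is constant. A zero of [S] would
    then fill a whole line of zeros of [T]; so [S] has no zero, and over an algebraically closed
    field it is constant. *)
Lemma vanishing_const S :
  (forall z, ev z S = 0 -> ev z T = 0) -> ~ incid (lineX d S) ->
  exists2 c, c != 0 & S = mpoly.mpolyC n c.
Proof.
move=> ST /incid_inv[c [H [cn0 icH]]].
have const (P : {poly F}) : (forall x, P.[x] != 0) -> (size P <= 1)%N.
  move=> nz; have [/eqP->//|/closed_rootP[x /rootP Px]] := boolP (size P == 1%N).
  by have := nz x; rewrite Px eqxx.
have lS k : (lineX d S)`_k.+1 = 0.
  suff : c * (lineX d S)`_k.+1 = 0 by move/eqP; rewrite mulf_eq0 (negbTE cn0) => /eqP.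
  apply: ev_eq0 => z; rewrite mpoly.mevalM -spec_coef spec_lineX.
  have [->|cz] := eqVneq (ev z c) 0; first by rewrite mul0r.
  rewrite [X in _ * X]nth_default ?mulr0 //.
  apply: leq_trans (const _ _) _ => // x; apply/eqP => Sx.
  have Tx : (line z d T).[x] = 0 by rewrite lineE; apply: ST; rewrite -lineE.
  have := icH z x Tx; rewrite specD specM specC spec_lineX hornerD hornerM hornerC Sx.
  by rewrite mul0r addr0 => /eqP; rewrite (negbTE cz).
have Snz z : ev z S != 0.
  apply/eqP => Sz; have : line z d T = 0.
    apply: poly_ext => x; rewrite horner0 lineE; apply: ST.
    rewrite -lineE -spec_lineX (_ : spec z (lineX d S) = (ev z S)%:P) ?hornerC //.
    apply/polyP => -[|k]; rewrite spec_coef coefC /=.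
      by rewrite -horner_coef0 lineX_at0.
    by rewrite lS mpoly.meval0.
  by move=> e; have := (lineT z).1; rewrite e size_poly0.
pose o : 'I_n -> F := fun=> 0.
exists (ev o S); first exact: Snz.
apply: ev_ext => z; rewrite mpoly.mevalC.
have /size1_polyC cl : (size (line o z S) <= 1)%N.
  by apply: const => x; rewrite lineE.
have e0 := lineE o z S (0 : F); have := lineE o z S (1 : F).
rewrite cl !hornerC in e0 *; move=> e1.
transitivity (line o z S)`_0.
  by rewrite e1; apply: mpoly.meval_eq => i; rewrite add0r mul1r.
by rewrite e0; apply: mpoly.meval_eq => i; rewrite add0r mul0r.
Qed.

End MainHypersurface.

(* The hypersurface [T = 0] is irreducible and smooth at some point, so its
   ideal is generated by [T]. *)
Theorem reduced_equation (T S : A) (W : set ('I_n -> F)) :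
  (forall w, W w -> ev w T = 0) ->
  (forall q, (forall w, W w -> ev w q = 0) -> forall z, ev z T = 0 -> ev z q = 0) ->
  (forall p q, (forall w, W w -> ev w p * ev w q = 0) ->
    (forall w, W w -> ev w p = 0) \/ (forall w, W w -> ev w q = 0)) ->
  (exists w e, W w /\ ev w (dird e T) != 0) ->
  (forall a b, S = a ^+ 2 * b -> a \is a GRing.unit) ->
  (forall z, ev z S = 0 <-> ev z T = 0) ->
  exists2 c, c != 0 & S = mpoly.mpolyC n c * T.
Proof.
move=> W0 Wcl Wirr [w0 [e [Ww0 eT]]] Sred zST.
have T0 : T != 0.
  apply: contraNneq eT => ->; rewrite /dird big1 ?mpoly.meval0 // => i _.
  by rewrite mpoly.mderiv0 scaler0.
(* If [g] is nonzero at [d], then [T] keeps its full degree on all lines parallel to [d] and has a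
   nonzero derivative along [d] at [w0]. *)
pose g : A := top_form T * \sum_i mX i * mpoly.mpolyC n (ev w0 (mpoly.mderiv i T)).
have gE d : ev d g = ev d (top_form T) * ev w0 (dird d T).
  rewrite mpoly.mevalM ev_dird; congr (_ * _); rewrite raddf_sum; apply: eq_bigr => i _ /=.
  by rewrite mpoly.mevalM mpoly.mevalXU mpoly.mevalC.
have [d] : exists d, ev d g != 0.
  apply: ev_neq0; rewrite mulf_neq0 ?top_form_neq0 //.
  apply: contraNneq eT => g0; rewrite ev_dird.
  have := congr1 (ev e) g0; rewrite mpoly.meval0 raddf_sum /= => e0.
  apply/eqP; rewrite -[RHS]e0; apply: eq_bigr => i _ /=.
  by rewrite mpoly.mevalM mpoly.mevalXU mpoly.mevalC.
rewrite gE mulf_eq0 negb_or => /andP[c0 dT].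
have lineT z : size (line z d T) = (mpoly.msize T).-1.+1 /\
    lead_coef (line z d T) = ev d (top_form T).
  have [sz lc] := line_top z d T.
  suff sE : size (line z d T) = (mpoly.msize T).-1.+1 by rewrite /lead_coef sE.
  apply/eqP; rewrite eqn_leq sz /= ltnNge; apply/negP => le.
  by move: c0; rewrite -lc nth_default ?eqxx.
have : (0 < (mpoly.msize T).-1)%N.
  rewrite lt0n; apply: contraNneq dT => D0; have [sz _] := lineT w0.
  rewrite dirdE; rewrite D0 in sz.
  have /size1_polyC -> : (size (line w0 d T) <= 1)%N by rewrite sz.
  by rewrite derivC horner0.
case ED : (mpoly.msize T).-1 => [//|D] _; rewrite {}ED in lineT.
have smooth_pt : exists2 w0, W w0 & ev w0 (dird d T) != 0 by exists w0.
have [q qE] : exists q, S = T * q.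
  apply: (divides_of_vanishing W0 Wcl Wirr c0 lineT smooth_pt) => z x.
  by rewrite spec_lineX !lineE => /zST.
have qT z : ev z q = 0 -> ev z T = 0.
  by move=> qz; apply/zST; rewrite qE mpoly.mevalM qz mulr0.
have [c cn0 qc] : exists2 c, c != 0 & q = mpoly.mpolyC n c.
  apply: (vanishing_const W0 Wcl Wirr c0 lineT qT) => iq.
  (* If [q] were in the ideal too, [S] would be divisible by [T ^+ 2], and reducedness would make
     [T] a unit although it vanishes at [w0]. *)
  have [q' q'E] := divides_of_vanishing W0 Wcl Wirr c0 lineT smooth_pt iq.
  have /divrr Tu : T \is a GRing.unit.
    by apply: (Sred T q'); rewrite qE q'E; ring.
  have := congr1 (ev w0) Tu; rewrite mpoly.mevalM W0 // mul0r mpoly.meval1.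
  by move/eqP; rewrite eq_sym oner_eq0.
by exists c; rewrite // qE qc mulrC.
Qed.

End Hypersurface.

(** * Exponential and logarithm of nilpotent elements *)

Section TruncatedExp.
Variables (R : comNzRingType) (c : nat -> R) (n : nat) (r : R).
Hypotheses (c0 : c 0%N = 1) (cS : forall k, c k.+1 *+ k.+1 = c k).
Hypothesis rn : r ^+ n = 0.

Definition texp (x : R) : R := \sum_(k < n) c k * x ^+ k.

Definition nilr (x : R) : Prop := exists y, x = y * r.

Lemma nilr0 : nilr 0. Proof. by exists 0; rewrite mul0r. Qed.

Lemma nilrD x y : nilr x -> nilr y -> nilr (x + y).
Proof. by move=> [a ->] [b ->]; exists (a + b); rewrite mulrDl. Qed.

Lemma nilrMl a x : nilr x -> nilr (a * x).
Proof. by move=> [b ->]; exists (a * b); rewrite mulrA. Qed.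

Lemma nilrN x : nilr x -> nilr (- x).
Proof. by move=> [b ->]; exists (- b); rewrite mulNr. Qed.

Lemma nilr_sum (I : Type) (s : seq I) (P : pred I) (f : I -> R) :
  (forall i, P i -> nilr (f i)) -> nilr (\sum_(i <- s | P i) f i).
Proof. by move=> h; apply: (big_ind nilr) => //; [exact: nilr0 | exact: nilrD]. Qed.

Lemma nilr_exp x k : nilr x -> (n <= k)%N -> x ^+ k = 0.
Proof. by move=> [a ->] /subnK <-; rewrite exprD [_ ^+ n]exprMn rn !mulr0. Qed.

Lemma texp0 : (0 < n)%N -> texp 0 = 1.
Proof.
rewrite /texp; case: n => // m _; rewrite big_ord_recl expr0 mulr1 c0 big1 ?addr0 //.
by move=> i _; rewrite expr0n /= mulr0.
Qed.

End TruncatedExp.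

Section TruncatedExpAlgebra.
Variables (F : numFieldType) (B : comUnitAlgType F) (n : nat) (r : B).
Hypotheses (rn : r ^+ n = 0) (n_gt0 : (0 < n)%N).

Definition cexp (k : nat) : B := (k`!%:R^-1)%:A.

Lemma cexp0 : cexp 0 = 1.
Proof. by rewrite /cexp invr1 scale1r. Qed.

Lemma cexpS k : cexp k.+1 *+ k.+1 = cexp k.
Proof.
by rewrite /cexp -scaler_nat scalerA factS natrM invfM mulrA mulfV ?mul1r.
Qed.

Local Notation exp := (texp cexp n).
Local Notation nil := (nilr r).
Local Notation pexp := (texp (polyC \o cexp) n).
Local Notation pnil := (nilr r%:P).

Lemma texp_deriv (g : {poly B}) : pnil g -> pnil g^`() ->
  (pexp g)^`() = g^`() * pexp g.
Proof.
move=> ng ng'; rewrite /texp.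
have rPn : r%:P ^+ n.-1.+1 = 0 :> {poly B}.
  by rewrite prednK // -polyC_exp rn polyC0.
rewrite -(prednK n_gt0); set m := n.-1 in rPn *.
rewrite [in LHS]big_ord_recl [in RHS]big_ord_recr /= mulrDr.
have [[a g'E] [b gE]] := (ng', ng); rewrite g'E.
(* The top term contains [n] factors [r]: one from [g'] and [n - 1] from [g ^+ m]. *)
have -> : a * r%:P * ((cexp m)%:P * g ^+ m) = 0.
  rewrite gE exprMn.
  have -> : a * r%:P * ((cexp m)%:P * (b ^+ m * r%:P ^+ m)) =
    a * (cexp m)%:P * b ^+ m * (r%:P * r%:P ^+ m) by ring.
  by rewrite -exprS rPn !mulr0.
rewrite addr0 poly.derivD expr0 mulr1 derivC add0r raddf_sum mulr_sumr.
apply: eq_bigr => i _; rewrite /= derivM derivC mul0r add0r deriv_exp /= g'E.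
by rewrite -(cexpS i) polyCMn !(mulrnAr, mulrnAl); congr (_ *+ _); ring.
Qed.

Lemma deriv_eq0_const (p : {poly B}) x y : p^`() = 0 -> p.[x] = p.[y].
Proof.
move=> p'; suff -> : p = (p`_0)%:P by rewrite !hornerC.
apply/polyP => -[|k]; rewrite coefC //=.
have := congr1 (fun q : {poly B} => (k.+1%:R^-1 : F) *: q`_k) p'.
by rewrite coef_deriv coef0 scaler0 -scaler_nat scalerA mulVf ?scale1r.
Qed.

Lemma pexp_horner (g : {poly B}) x : (pexp g).[x] = exp g.[x].
Proof.
by rewrite horner_sum; apply: eq_bigr => k _; rewrite hornerM hornerC horner_exp.
Qed.

Lemma nilrZ (a : F) x : nil x -> nil (a *: x).
Proof. by move=> [y ->]; exists (a *: y); rewrite scalerAl. Qed.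

Let pnilC x : nil x -> pnil x%:P.
Proof. by move=> [y ->]; exists y%:P; rewrite -polyCM. Qed.

Let pnilX x : nil x -> pnil (x%:P * 'X).
Proof. by move=> nx; rewrite mulrC; apply: nilrMl; apply: pnilC. Qed.

Lemma texpD x y : nil x -> nil y -> exp (x + y) = exp x * exp y.
Proof.
have conv a b : nil a -> nil b -> exp (a + b) * exp (- b) = exp a.
  (* [exp (a + b X) exp (- b X)] has derivative 0 in [X]; compare its values at 1 and 0. *)
  move=> na nb; pose P := pexp (a%:P + b%:P * 'X) * pexp ((- b)%:P * 'X).
  have e : P.[1] = P.[0].
    apply: deriv_eq0_const; rewrite derivM !texp_deriv.
    - rewrite poly.derivD !derivM !derivC !derivX polyCN.
      by rewrite !mul0r !add0r !mulr1; ring.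
    - by apply: pnilX; apply: nilrN.
    - by rewrite derivM derivC derivX mul0r add0r mulr1; apply/pnilC/nilrN.
    - by apply: nilrD; [apply: pnilC | apply: pnilX].
    by rewrite poly.derivD derivM !derivC derivX mul0r !add0r mulr1; apply: pnilC.
  move: e; rewrite /P !hornerM !pexp_horner !hornerD !hornerM !hornerX !hornerC.
  by rewrite !mulr1 !mulr0 addr0 (texp0 cexp0) ?mulr1.
move=> nx ny; rewrite -(conv x y nx ny) -mulrA.
have := conv 0 y (nilr0 r) ny; rewrite add0r (texp0 cexp0) // mulrC => ->.
by rewrite mulr1.
Qed.

Lemma texpN x : nil x -> exp x * exp (- x) = 1.
Proof.
by move=> nx; rewrite -texpD ?subrr ?(texp0 cexp0) //; apply: nilrN.
Qed.

Lemma texpMn x k : nil x -> exp (x *+ k) = exp x ^+ k.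
Proof.
move=> nx; elim: k => [|k IH]; first by rewrite mulr0n expr0 (texp0 cexp0).
rewrite mulrS texpD // ?IH ?exprS //.
by rewrite -mulr_natl; apply: nilrMl.
Qed.

Lemma texp_sum (I : Type) (s : seq I) (f : I -> B) :
  (forall i, nil (f i)) -> exp (\sum_(i <- s) f i) = \prod_(i <- s) exp (f i).
Proof.
move=> nf; elim: s => [|i s IH]; first by rewrite !big_nil (texp0 cexp0).
by rewrite !big_cons texpD ?IH //; apply: nilr_sum.
Qed.

(** The series of [log (1 - x)], cut off where powers of multiples of [r] vanish. *)
Definition tlog (x : B) : B := - \sum_(m < n.-1) (m.+1%:R^-1 : F) *: x ^+ m.+1.

Lemma nil_tlog x : nil x -> nil (tlog x).
Proof.
move=> nx; apply/nilrN/nilr_sum => m _.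
by rewrite exprSr; apply/nilrZ/nilrMl.
Qed.

(* [exp (- log (1 - x t)) (1 - x t)] has derivative 0 in [t]. *)
Lemma texp_log x : nil x -> exp (tlog x) = 1 - x.
Proof.
move=> nx.
pose L : {poly B} :=
  \sum_(m < n.-1) ((m.+1%:R^-1 : F) *: x ^+ m.+1)%:P * 'X^(m.+1).
have L' : L^`() = x%:P * \sum_(m < n.-1) (x%:P * 'X) ^+ m.
  rewrite raddf_sum mulr_sumr; apply: eq_bigr => m _.
  rewrite /= derivM derivC mul0r add0r derivXn /= exprMn -polyC_exp.
  rewrite mulrnAr -mulrnAl -polyCMn -scaler_nat scalerA mulfV ?pnatr_eq0 //.
  by rewrite scale1r exprS polyCM mulrA.
have nL' : pnil L^`() by rewrite L' mulrC; apply/nilrMl/pnilC.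
have nL : pnil L.
  apply: nilr_sum => m _; rewrite mulrC; apply: nilrMl; apply: pnilC.
  by rewrite exprSr; apply/nilrZ/nilrMl.
have inv : exp (- tlog x) * (1 - x) = 1.
  pose P := pexp L * (1 - x%:P * 'X).
  have e : P.[1] = P.[0].
    apply: deriv_eq0_const; rewrite derivM texp_deriv // derivB derivM.
    rewrite -[X in X^`() - _]polyC1 !derivC derivX mul0r !add0r mulr1.
    suff -> : L^`() * pexp L * (1 - x%:P * 'X) = x%:P * pexp L.
      by rewrite mulrN mulrC subrr.
    have geo : (\sum_(m < n.-1) (x%:P * 'X) ^+ m) * (1 - x%:P * 'X) =
        1 - (x%:P * 'X) ^+ n.-1 :> {poly B}.
      by rewrite mulrC -(opprB (x%:P * 'X) 1) mulNr -subrX1 opprB.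
    have -> : L^`() * pexp L * (1 - x%:P * 'X) =
        x%:P * pexp L * ((\sum_(m < n.-1) (x%:P * 'X) ^+ m) * (1 - x%:P * 'X)).
      by rewrite L'; ring.
    rewrite geo mulrBr mulr1 exprMn.
    have -> : x%:P * pexp L * (x%:P ^+ n.-1 * 'X ^+ n.-1) =
        pexp L * (x%:P * x%:P ^+ n.-1) * 'X ^+ n.-1 by ring.
    by rewrite -exprS prednK // -polyC_exp (nilr_exp rn nx) // mulr0 mul0r subr0.
  move: e; rewrite /P !hornerM !pexp_horner !hornerD !hornerN !hornerM.
  rewrite !hornerX !hornerC mulr0 mulr1 subr0 mulr1.
  have -> : L.[1] = - tlog x.
    rewrite /tlog opprK horner_sum; apply: eq_bigr => m _.
    by rewrite hornerM hornerC hornerXn expr1n mulr1.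
  have -> : L.[0] = 0.
    rewrite horner_sum big1 // => m _.
    by rewrite hornerM hornerXn expr0n mulr0.
  by rewrite (texp0 cexp0).
rewrite -[LHS]mulr1 -[1 in LHS]inv mulrA texpN ?mul1r //; exact: nil_tlog.
Qed.

End TruncatedExpAlgebra.

(** * Partial fractions with simple poles *)

Section LinearFactors.
Variable F : fieldType.

Lemma size_prod_one_sub (J : finType) (P : pred J) (u : J -> F) :
  (size (\prod_(j | P j) (1 - u j *: 'X))%R <= #|P|.+1)%N.
Proof.
have sz j : (size (1 - u j *: 'X)%R <= 2)%N.
  rewrite (leq_trans (size_polyD _ _)) // geq_max size_poly1 size_polyN /=.
  by rewrite (leq_trans (size_scale_leq _ _)) // size_polyX.
apply: (leq_trans (size_poly_prod_leq _ _)).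
have : (\sum_(j | P j) size (1 - u j *: 'X)%R <= \sum_(j | P j) 2)%N.
  by apply: leq_sum => j _.
rewrite sum_nat_const; lia.
Qed.

(** Lagrange interpolation at the poles [(u k)^-1]. *)
Lemma partial_fractions N (u : 'I_N -> F) (p : {poly F}) :
  injective u -> (forall k, u k != 0) -> (size p <= N)%N ->
  exists r : 'I_N -> F,
    p = \sum_k r k *: \prod_(j | j != k) (1 - u j *: 'X).
Proof.
move=> inju u0 sp.
pose L k : {poly F} := \prod_(j | j != k) (1 - u j *: 'X).
have LE k l : (L k).[(u l)^-1] = \prod_(j | j != k) (1 - u j / u l).
  by rewrite horner_prod; apply: eq_bigr => j _; rewrite !hornerE.
have Lnz k : (L k).[(u k)^-1] != 0.
  rewrite LE; apply/prodf_neq0 => j jk; rewrite subr_eq0 eq_sym.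
  by rewrite -(inj_eq (mulIf (u0 k))) divfK // mul1r (inj_eq inju).
have L0 k l : l != k -> (L k).[(u l)^-1] = 0.
  by move=> lk; rewrite LE (bigD1 l) //= mulfV // subrr mul0r.
exists (fun k => p.[(u k)^-1] / (L k).[(u k)^-1]).
apply/eqP; rewrite -subr_eq0; apply: contraT => nz.
have := max_poly_roots nz (rs := [seq (u k)^-1 | k <- enum 'I_N]).
rewrite size_map size_enum_ord map_inj_uniq ?enum_uniq; last first.
  by move=> k l /invr_inj /inju.
have -> : all (root (p - \sum_k p.[(u k)^-1] / (L k).[(u k)^-1] *: L k))
    [seq (u k)^-1 | k <- enum 'I_N].
  apply/allP => _ /mapP[l _ ->]; apply/rootP; rewrite !hornerE horner_sum.
  rewrite (bigD1 l) //= big1 ?addr0 => [|k kl].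
    by rewrite hornerZ divfK // subrr.
  by rewrite hornerZ (L0 k l) ?mulr0 // eq_sym.
move=> /(_ isT isT); rewrite ltnNge => /negP; case.
rewrite (leq_trans (size_polyD _ _)) // geq_max sp size_polyN.
apply: (leq_trans (size_sum _ _ _)); apply/bigmax_leqP => k _.
rewrite (leq_trans (size_scale_leq _ _)) // (leq_trans (size_prod_one_sub _ _)) //.
have := cardC1 k; rewrite card_ord => ->; have := ltn_ord k; lia.
Qed.

End LinearFactors.

(** * Continuity estimates and roots tending to infinity *)

Section Estimates.
Variable F : numClosedFieldType.

Lemma common_bound (a b : F) : 0 < a -> 0 < b ->
  exists d, [/\ 0 < d, d <= a & d <= b].
Proof.
move=> a0 b0; have ab0 : 0 < a + b by rewrite addr_gt0.
(* This lies below both [a] and [b] without comparing them. *)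
exists (a * b / (a + b)); split.
- by rewrite divr_gt0 // mulr_gt0.
- by rewrite ler_pdivrMr // ler_pM2l // lerDr ltW.
by rewrite ler_pdivrMr // mulrC ler_pM2l // lerDl ltW.
Qed.

Definition vanishes_at0 (h : F -> F) : Prop :=
  forall e, 0 < e -> exists2 d, 0 < d & forall u, `|u| < d -> `|h u| < e.

Lemma vanishes_at0D h1 h2 : vanishes_at0 h1 -> vanishes_at0 h2 ->
  vanishes_at0 (fun u => h1 u + h2 u).
Proof.
move=> v1 v2 e e0; have e20 : 0 < e / 2 by rewrite divr_gt0.
have [d1 d10 h1d] := v1 _ e20; have [d2 d20 h2d] := v2 _ e20.
have [d [d0 dd1 dd2]] := common_bound d10 d20; exists d => // u ud.
rewrite (le_lt_trans (ler_normD _ _)) // [e]splitr ltrD //.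
- exact: h1d (lt_le_trans ud dd1).
exact: h2d (lt_le_trans ud dd2).
Qed.

Lemma vanishes_at0_cst : vanishes_at0 (fun=> 0).
Proof. by move=> e e0; exists 1 => // u _; rewrite normr0. Qed.

Lemma vanishes_at0_sum (J : Type) (r : seq J) (h : J -> F -> F) :
  (forall i, vanishes_at0 (h i)) -> vanishes_at0 (fun u => \sum_(i <- r) h i u).
Proof.
move=> vh; elim: r => [|i r IH] e e0.
  have [d d0 _] := vanishes_at0_cst e0; exists d => // u _.
  by rewrite big_nil normr0.
have [d d0 hd] := vanishes_at0D (vh i) IH e0.
by exists d => // u /hd; rewrite big_cons.
Qed.

Lemma vanishes_at0Z c h : vanishes_at0 h -> vanishes_at0 (fun u => c * h u).
Proof.
move=> vh e e0; have c0 : 0 < `|c| + 1 by rewrite ltr_wpDl.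
have [d d0 hd] := vh (e / (`|c| + 1)) (divr_gt0 e0 c0).
exists d => // u /hd; rewrite ltr_pdivlMr // normrM; apply: le_lt_trans.
by rewrite mulrC ler_wpM2l // lerDl.
Qed.

Lemma vanishes_at0X h k : vanishes_at0 h -> vanishes_at0 (fun u => h u ^+ k.+1).
Proof.
move=> vh e e0; have [b [b0 b1 be]] := common_bound (@ltr01 F) e0.
have [d d0 hd] := vh _ b0; exists d => // u /hd hu.
rewrite normrX exprS; apply: le_lt_trans (lt_le_trans hu be).
by rewrite ler_piMr // exprn_ile1 // (le_trans (ltW hu)).
Qed.

Lemma vanishes_at0_moebius q : vanishes_at0 (fun u => u / (1 - u * q)).
Proof.
move=> e e0.
have q10 : 0 < `|q| + 1 by rewrite ltr_wpDl.
have [d [d0 de dq]] := common_bound (divr_gt0 e0 (@ltr0Sn F 1))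
  (divr_gt0 (@ltr01 F) (mulr_gt0 (@ltr0Sn F 1) q10)).
exists d => // u ud.
have uq : `|u * q| <= 2^-1.
  rewrite normrM (le_trans (y := d * (`|q| + 1))) //.
    by apply: ler_pM => //; [exact: ltW | rewrite lerDl].
  by rewrite (le_trans (ler_wpM2r (ltW q10) dq)) // mul1r invfM mulfVK // gt_eqF.
have den : 2^-1 <= `|1 - u * q|.
  have := lerB_dist 1 (u * q); rewrite normr1; apply: le_trans.
  by rewrite lerBrDr [X in _ <= X]splitr mul1r lerD2l.
have den0 : 0 < `|1 - u * q| by apply: lt_le_trans den; rewrite invr_gt0.
rewrite normrM normfV ltr_pdivrMr //.
apply: lt_le_trans (ler_wpM2l (ltW e0) den).
exact: lt_le_trans ud de.
Qed.

Lemma ev_continuous n (p : mpoly n F) (z0 : 'I_n -> F) e : 0 < e ->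
  exists2 d, 0 < d & forall z, (forall i, `|z i - z0 i| < d) ->
    `|ev z p - ev z0 p| < e.
Proof.
elim/mpoly_ring_ind: p e => [c|i|p q IHp IHq|p q IHp IHq] e e0.
- by exists 1 => // z _; rewrite !mpoly.mevalC subrr normr0.
- by exists e => // z /(_ i); rewrite !mpoly.mevalXU.
- have e20 : 0 < e / 2 by rewrite divr_gt0.
  have [d1 d10 h1] := IHp _ e20; have [d2 d20 h2] := IHq _ e20.
  have [d [d0 dd1 dd2]] := common_bound d10 d20; exists d => // z zd.
  rewrite !mpoly.mevalD opprD addrACA (le_lt_trans (ler_normD _ _)) //.
  rewrite [e]splitr ltrD //.
    by apply: h1 => i; apply: lt_le_trans (zd i) dd1.
  by apply: h2 => i; apply: lt_le_trans (zd i) dd2.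
set a0 := ev z0 p; set b0 := ev z0 q.
have c0 : 0 < `|a0| + `|b0| + 1 by rewrite ltr_wpDl // addr_ge0.
have [f [f0 f1 fe]] := common_bound (@ltr01 F) (divr_gt0 e0 c0).
have [d1 d10 h1] := IHp _ f0; have [d2 d20 h2] := IHq _ f0.
have [d [d0 dd1 dd2]] := common_bound d10 d20; exists d => // z zd.
have ap : `|ev z p - a0| < f by apply: h1 => i; apply: lt_le_trans (zd i) dd1.
have bq : `|ev z q - b0| < f by apply: h2 => i; apply: lt_le_trans (zd i) dd2.
rewrite !mpoly.mevalM -/a0 -/b0.
have -> : ev z p * ev z q - a0 * b0 =
    (ev z p - a0) * b0 + a0 * (ev z q - b0) + (ev z p - a0) * (ev z q - b0).
  by ring.
have le3 : `|(ev z p - a0) * b0 + a0 * (ev z q - b0)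
    + (ev z p - a0) * (ev z q - b0)| <= f * `|b0| + `|a0| * f + f * `|ev z q - b0|.
  rewrite (le_trans (ler_normD _ _)) // lerD //.
    rewrite (le_trans (ler_normD _ _)) // !normrM lerD //.
      by rewrite ler_wpM2r // ltW.
    by rewrite ler_wpM2l // ltW.
  by rewrite normrM ler_wpM2r // ltW.
apply: (le_lt_trans le3).
have -> : f * `|b0| + `|a0| * f + f * `|ev z q - b0| =
    f * (`|a0| + `|b0| + `|ev z q - b0|) by ring.
apply: (lt_le_trans (y := f * (`|a0| + `|b0| + 1))).
  by rewrite ltr_pM2l // ltrD2l (lt_le_trans bq).
by rewrite -ler_pdivlMr.
Qed.

(* Iterated division by the [X - v]; evaluating the result is a divided
   difference. *)
Definition strip (s : seq F) (p : {poly F}) : {poly F} :=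
  foldl (fun p v => p %/ ('X - v%:P)) p s.

Lemma stripD s p q : strip s (p + q) = strip s p + strip s q.
Proof. by elim: s p q => //= v s IH p q; rewrite divpD IH. Qed.

Lemma stripZ s c p : strip s (c *: p) = c *: strip s p.
Proof. by elim: s p => //= v s IH p; rewrite divpZl IH. Qed.

Lemma strip_mulX v s p c :
  strip (v :: s) (p * 'X + c%:P) = strip s p + v *: strip (v :: s) p.
Proof.
rewrite /= -stripZ -stripD; congr (strip s _).
have -> : p * 'X + c%:P = p * ('X - v%:P) + (v *: p + c%:P).
  by rewrite mulrBr [p * v%:P]mulrC mul_polyC addrA subrK.
rewrite divpD mulpK ?polyXsubC_eq0 // divpD divpZl [c%:P %/ _]divp_small ?addr0 //.
by rewrite size_XsubC (leq_ltn_trans (size_polyC_leq1 _)).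
Qed.

(** A bound on divided differences, uniform over nodes in the disc of radius [r]; [strip_mulX]
    reduces to a polynomial of lower degree. *)
Lemma strip_bounded (r : F) (p : {poly F}) : 0 <= r -> forall k,
  exists C, forall s a, size s = k -> all (fun v => `|v| <= r) s -> `|a| <= r ->
    `|(strip s p).[a]| <= C.
Proof.
move=> r0; elim/poly_ind: p => [|p c IH] k.
  exists 0 => s a _ _ _; have -> : strip s 0 = 0.
    by elim: s => //= v s IH; rewrite div0p.
  by rewrite horner0 normr0.
case: k => [|k].
  have [C CP] := IH 0%N; exists (C * r + `|c|) => -[|//] a _ _ ar.
  rewrite /= !hornerE (le_trans (ler_normD _ _)) // lerD // normrM.
  by apply: ler_pM => //; apply: (CP [::]).
have [C CP] := IH k; have [C' C'P] := IH k.+1.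
exists (C + r * C') => -[//|v s] a [sk] /andP[vr sr] ar.
rewrite strip_mulX hornerD hornerZ (le_trans (ler_normD _ _)) // lerD //.
  exact: CP.
rewrite normrM; apply: ler_pM => //.
by apply: C'P => //=; [rewrite sk | rewrite vr].
Qed.

Lemma strip_prod s p : strip s (\prod_(v <- s) ('X - v%:P) * p) = p.
Proof.
elim: s p => [|v s IH] p; first by rewrite big_nil mul1r.
by rewrite big_cons /= -mulrA mulrC mulpK ?polyXsubC_eq0 // IH.
Qed.

Lemma strip_lead s (p : {poly F}) : size p = (size s).+1 ->
  strip s p = (lead_coef p)%:P.
Proof.
elim: s p => [|v s IH] p sp.
  by rewrite /lead_coef sp /=; apply: size1_polyC; rewrite sp.
set q := p %/ ('X - v%:P).
have sq : size q = (size s).+1.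
  by rewrite size_divp ?polyXsubC_eq0 // size_XsubC sp /= subn1.
have q0 : q != 0 by rewrite -size_poly_eq0 sq.
rewrite [LHS]/= -/q IH //; congr (_%:P).
rewrite [in RHS](divp_eq p ('X - v%:P)) -/q lead_coefDl.
  by rewrite lead_coef_Mmonic // monicXsubC.
rewrite size_Mmonic ?monicXsubC // sq size_XsubC addn2 /=.
have := ltn_modp p ('X - v%:P); rewrite polyXsubC_eq0 size_XsubC /=.
by move/leq_trans; apply.
Qed.

(* All but [deg P] of the roots of [P + eps Q] tend to infinity with [eps]. *)
Lemma few_bounded_roots (P Q : {poly F}) (r : F) : P != 0 -> 0 <= r ->
  exists2 d, 0 < d & forall eps s H, `|eps| < d -> all (fun v => `|v| <= r) s ->
    P + eps *: Q = \prod_(v <- s) ('X - v%:P) * H -> (size s < size P)%N.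
Proof.
move=> P0 r0; have [C CP] := strip_bounded Q r0 (size P).-1.
have spp : (0 < size P)%N by rewrite size_poly_gt0.
have C0 : 0 <= C.
  have := CP (nseq (size P).-1 0) 0; rewrite size_nseq normr0 r0 => /(_ erefl).
  rewrite all_nseq normr0 r0 orbT => /(_ isT isT); exact: le_trans.
have C1 : 0 < C + 1 by rewrite ltr_wpDl.
exists (`|lead_coef P| / (C + 1)).
  by rewrite divr_gt0 // normr_gt0 lead_coef_eq0.
move=> eps s H eps_small sr e; rewrite ltnNge; apply/negP => le.
(* Split off [deg P] bounded roots [s1] and one more, [a]. Stripping [s1] leaves [lead_coef P] from
   [P]; evaluation at [a] then equates it with [- eps] times a quantity bounded by [C], which is too
   small. *)
have [s1 [a [s2 [es s1P]]]] : exists s1 a s2, s = s1 ++ a :: s2 /\ size s1 = (size P).-1.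
  have lt : ((size P).-1 < size s)%N by rewrite prednK.
  exists (take (size P).-1 s), (nth 0 s (size P).-1), (drop (size P) s).
  rewrite size_takel ?(ltnW lt) //; split=> //.
  by rewrite -[in LHS](cat_take_drop (size P).-1 s) (drop_nth 0) // prednK.
move: sr e; rewrite es all_cat /= => /and3P[s1r ar _].
rewrite big_cat big_cons /= -mulrA => /(congr1 (strip s1)).
rewrite strip_prod stripD stripZ (strip_lead (p := P)) ?s1P ?prednK //.
move=> /(congr1 (fun p : {poly F} => p.[a])).
rewrite !hornerE subrr !mul0r => /eqP; rewrite addr_eq0 => /eqP lP.
move: eps_small; rewrite ltr_pdivlMr // lP normrN normrM => lt.
have := CP s1 a s1P s1r ar => le'.
have le2 : `|eps| * C <= `|eps| * (C + 1) by rewrite ler_wpM2l // lerDl.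
have := lt_le_trans lt (le_trans (ler_wpM2l (normr_ge0 eps) le') le2).
by rewrite ltxx.
Qed.

End Estimates.

(** * The finite algebra at the singular points and its subring [ann] *)

(* [B] is a finite algebra with idempotents [e i], generated by an element with
   semisimple part [loc q] and nilpotent part [rho]; the common kernel [ann] of
   the functionals [l j] is a subring containing the idempotents. *)
Section LocalAlgebra.
Variables (F : numClosedFieldType) (B : comUnitAlgType F) (I : finType).
Variables (q : I -> F) (e : I -> B) (rho : B) (n g : nat) (l : 'I_g -> B -> F).
Hypotheses (n_gt1 : (1 < n)%N) (rho_nil : rho ^+ n = 0).
Hypotheses (e_orth : forall i j, e i * e j = if i == j then e i else 0)
  (e_sum : \sum_i e i = 1).
Hypothesis l_lin : forall j a x y, l j (a *: x + y) = a * l j x + l j y.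

Definition ann (x : B) : Prop := forall j, l j x = 0.

Hypotheses (annM : forall x y, ann x -> ann y -> ann (x * y))
  (ann_e : forall i, ann (e i)).

Definition loc (c : I -> F) : B := \sum_i c i *: e i.

Local Notation v := (loc q + rho).
Local Notation nil := (nilr rho).
Local Notation exp := (texp (@cexp F B) n).

Let n_gt0 : (0 < n)%N := ltnW n_gt1.

Lemma l0 j : l j 0 = 0.
Proof.
have := l_lin j 1 0 0; rewrite scaler0 addr0 mul1r => /eqP.
by rewrite -subr_eq0 opprD addrA subrr sub0r oppr_eq0 => /eqP.
Qed.

Lemma lD j x y : l j (x + y) = l j x + l j y.
Proof. by rewrite -[x]scale1r l_lin mul1r scale1r. Qed.

Lemma lZ j a x : l j (a *: x) = a * l j x.
Proof. by rewrite -[_ *: _]addr0 l_lin l0 addr0. Qed.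

Lemma lN j x : l j (- x) = - l j x.
Proof. by rewrite -scaleN1r lZ mulN1r. Qed.

Lemma lMn j x k : l j (x *+ k) = k%:R * l j x.
Proof.
elim: k => [|k IH]; first by rewrite mulr0n l0 mul0r.
by rewrite mulrS lD IH mulrS mulrDl mul1r.
Qed.

Lemma l_sum j (J : Type) (s : seq J) (P : pred J) (f : J -> B) :
  l j (\sum_(i <- s | P i) f i) = \sum_(i <- s | P i) l j (f i).
Proof. exact: (big_morph _ (lD j) (l0 j)). Qed.

Lemma annD x y : ann x -> ann y -> ann (x + y).
Proof. by move=> ax ay j; rewrite lD ax ay addr0. Qed.

Lemma annZ a x : ann x -> ann (a *: x).
Proof. by move=> ax j; rewrite lZ ax mulr0. Qed.

Lemma annN x : ann x -> ann (- x).
Proof. by move=> ax j; rewrite lN ax oppr0. Qed.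

Lemma ann_sum (J : Type) (s : seq J) (P : pred J) (f : J -> B) :
  (forall i, P i -> ann (f i)) -> ann (\sum_(i <- s | P i) f i).
Proof. by move=> af j; rewrite l_sum big1 // => i Pi; rewrite af. Qed.

Lemma ann_loc c : ann (loc c).
Proof. by apply: ann_sum => i _; apply: annZ. Qed.

Lemma locC a : loc (fun=> a) = a%:A.
Proof. by rewrite /loc -scaler_sumr e_sum. Qed.

Lemma ann1 : ann 1.
Proof. by rewrite -[1]scale1r -locC; apply: ann_loc. Qed.

Lemma annX x k : ann x -> ann (x ^+ k).
Proof.
move=> ax; elim: k => [|k IH]; first by rewrite expr0; apply: ann1.
by rewrite exprS; apply: annM.
Qed.

Lemma ann_prod (J : Type) (s : seq J) (f : J -> B) :
  (forall i, ann (f i)) -> ann (\prod_(i <- s) f i).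
Proof. by move=> af; apply: (@big_ind _ ann _ _ ann1 annM) => i _; apply: af. Qed.

Lemma ann_texp x : ann x -> ann (exp x).
Proof.
move=> ax; apply: ann_sum => k _; rewrite -scalerAl mul1r.
by apply/annZ/annX.
Qed.

Lemma locM c d : loc c * loc d = loc (fun i => c i * d i).
Proof.
rewrite /loc mulr_suml; apply: eq_bigr => i _; rewrite mulr_sumr (bigD1 i) //=.
rewrite big1 ?addr0 => [|j /negbTE ji].
  by rewrite -scalerAl -scalerAr e_orth eqxx scalerA.
by rewrite -scalerAl -scalerAr e_orth eq_sym ji !scaler0.
Qed.

Lemma locD c d : loc c + loc d = loc (fun i => c i + d i).
Proof. by rewrite -big_split; apply: eq_bigr => i _; rewrite scalerDl. Qed.

Lemma locX c k : loc c ^+ k = loc (fun i => c i ^+ k).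
Proof.
elim: k => [|k IH]; first by rewrite expr0 locC scale1r.
by rewrite exprS IH locM; congr loc; apply/funext => i; rewrite exprS.
Qed.

Lemma horner_alg_loc p : horner_alg (loc q) p = loc (fun i => p.[q i]).
Proof.
elim/poly_ind: p => [|p c IH].
  rewrite rmorph0 /loc big1 // => i _; by rewrite horner0 scale0r.
rewrite rmorphD rmorphM /= IH horner_algX horner_algC -locC locM locD.
by congr loc; apply/funext => i; rewrite !hornerE.
Qed.

Lemma horner_alg_nil x y p : nil y -> nil (horner_alg (x + y) p - horner_alg x p).
Proof.
move=> ny; elim/poly_ind: p => [|p c IH].
  by rewrite !rmorph0 subrr; apply: nilr0.
rewrite !rmorphD !rmorphM /= !horner_algX !horner_algC.
set a := horner_alg _ p in IH *; set b := horner_alg _ p in IH *.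
have -> : a * (x + y) + c%:A - (b * x + c%:A) = x * (a - b) + a * y by ring.
by apply: nilrD; apply: nilrMl.
Qed.

(** Subtracting from [p(v)] its semisimple part [p(loc q)] leaves a nilpotent element, and does not
    change the functionals since [ann] contains the idempotents. *)
Lemma nil_dual_basis (eta : 'I_g -> B) :
  (forall x, exists p, x = horner_alg v p) ->
  (forall i j, l i (eta j) = (i == j)%:R) ->
  exists eta' : 'I_g -> B, (forall j, nil (eta' j)) /\
    (forall i j, l i (eta' j) = (i == j)%:R).
Proof.
move=> gen dual; have /choice[p pE] j := gen (eta j).
exists (fun j => eta j - horner_alg (loc q) (p j)); split=> [j|i j].
  by rewrite pE; apply: horner_alg_nil; exists 1; rewrite mul1r.
by rewrite lD lN dual horner_alg_loc ann_loc subr0.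
Qed.

(** * Exponential coordinates on the Jacobian *)

Variable eta : 'I_g -> B.
Hypotheses (eta_nil : forall j, nil (eta j))
  (eta_dual : forall i j, l i (eta j) = (i == j)%:R).

Definition xi (z : 'I_g -> F) : B := \sum_j z j *: eta j.

Definition E (z : 'I_g -> F) : B := exp (xi z).

Lemma nil_xi z : nil (xi z).
Proof. by apply: nilr_sum => j _; apply: nilrZ. Qed.

Lemma l_xi z j : l j (xi z) = z j.
Proof.
rewrite l_sum (bigD1 j) //= big1 ?addr0 => [|k /negbTE kj].
  by rewrite lZ eta_dual eqxx mulr1.
by rewrite lZ eta_dual eq_sym kj mulr0.
Qed.

Lemma xiD z z' : xi (fun j => z j + z' j) = xi z + xi z'.
Proof. by rewrite -big_split; apply: eq_bigr => j _; rewrite scalerDl. Qed.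

Lemma xiZ a z : xi (fun j => a * z j) = a *: xi z.
Proof. by rewrite scaler_sumr; apply: eq_bigr => j _; rewrite scalerA. Qed.

Lemma xiN z : xi (fun j => - z j) = - xi z.
Proof. by rewrite -sumrN; apply: eq_bigr => j _; rewrite scaleNr. Qed.

Lemma ED z z' : E (fun j => z j + z' j) = E z * E z'.
Proof. by rewrite /E xiD (texpD rho_nil n_gt0) //; apply: nil_xi. Qed.

Lemma E0 : E (fun=> 0) = 1.
Proof.
rewrite /E /xi big1 ?(texp0 (@cexp0 _ _)) // => j _.
by rewrite scale0r.
Qed.

Lemma EN z : E z * E (fun j => - z j) = 1.
Proof. by rewrite /E xiN (texpN rho_nil n_gt0) //; apply: nil_xi. Qed.

Lemma xi_mod_ann x : ann (x - xi (fun j => l j x)).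
Proof. by move=> j; rewrite lD lN l_xi subrr. Qed.

(** [B / ann] is a module over [ann] with basis the [eta i] and coordinates the [l i], so [x] may be
    replaced by [\sum_i l i x *: eta i]. *)
Lemma l_mul_ann a x j : ann a -> l j (a * x) = \sum_i l j (a * eta i) * l i x.
Proof.
move=> aa; have := annM aa (xi_mod_ann x); rewrite mulrBr => /(_ j) /eqP.
rewrite lD lN subr_eq0 => /eqP ->; rewrite /xi mulr_sumr l_sum.
by apply: eq_bigr => i _; rewrite -scalerAr lZ mulrC.
Qed.

(* If [exp x] lies in the subring [ann], so do the [exp (k x)], and a
   polynomial in [k] vanishing on the integers is zero. *)
Lemma ann_E z : ann (E z) -> z = (fun=> 0).
Proof.
move=> aE; apply/funext => j.
pose P : {poly F} := \poly_(k < n) (k`!%:R^-1 * l j (xi z ^+ k)).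
have P0 : P = 0.
  apply: poly_eq0_natr => k; rewrite horner_poly.
  have := annX k aE j; rewrite -(texpMn rho_nil n_gt0); last exact: nil_xi.
  rewrite /texp l_sum => e0; rewrite -[RHS]e0; apply: eq_bigr => m _; rewrite -scalerAl mul1r lZ -mulrA.
  have -> : l j ((xi z *+ k) ^+ m) = k%:R ^+ m * l j (xi z ^+ m).
    by rewrite (exprMn_n (xi z)) lMn natrX.
  by rewrite [l _ _ * _]mulrC.
have := congr1 (fun p : {poly F} => p`_1) P0.
by rewrite coef_poly n_gt1 coef0 factS fact0 muln1 mulr1n invr1 mul1r expr1 l_xi.
Qed.

(** * The Abel map, in the coordinate [u = 1/v] and away from the points [v = q i] *)

Definition good (u : F) : Prop := forall i, 1 - u * q i != 0.

(** Closed form of the Abel integral from 0 to [u]: a termwise primitive of the expression in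
    [omegaE]. In [one_sub_uv] it is also minus [l j] of a logarithm, which links the integrals with
    the multiplication of [B]. *)
Definition abel (u : F) (j : 'I_g) : F := \sum_i \sum_(m < n.-1)
  m.+1%:R^-1 * (u / (1 - u * q i)) ^+ m.+1 * l j (e i * rho ^+ m.+1).

Lemma abel0 j : abel 0 j = 0.
Proof.
rewrite /abel big1 // => i _; rewrite big1 // => m _.
by rewrite mul0r expr0n mulr0 mul0r.
Qed.

(** Factor [1 - u v] as a semisimple unit, which lies in [ann], times [1 - x] with [x] nilpotent.
    The logarithm of [1 - x] has [l j]-values [- abel u j], so it differs from [xi (- abel u)] by a
    nilpotent element of [ann], whose exponential is a unit of [ann]. *)
Lemma one_sub_uv u : good u -> exists c c', [/\ ann c, ann c', c * c' = 1 &
  1 - u *: v = c * E (fun j => - abel u j)].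
Proof.
move=> gu.
pose c1 := loc (fun i => 1 - u * q i); pose c1' := loc (fun i => (1 - u * q i)^-1).
have c1c1' : c1 * c1' = 1.
  rewrite locM -[RHS]scale1r -locC; congr loc; apply/funext => i.
  by rewrite mulfV.
pose x := loc (fun i => u / (1 - u * q i)) * rho.
have nx : nil x by exists (loc (fun i => u / (1 - u * q i))).
have uvE : 1 - u *: v = c1 * exp (tlog n x).
  rewrite (texp_log rho_nil n_gt0 nx) mulrBr mulr1 /x mulrA locM.
  have -> : (fun i => (1 - u * q i) * (u / (1 - u * q i))) = fun=> u.
    by apply/funext => i; rewrite mulrCA mulfV ?mulr1.
  rewrite locC -scalerAl mul1r scalerDr opprD addrA; congr (_ - _).
  rewrite -[1]scale1r -locC /c1 /loc scaler_sumr -sumrB; apply: eq_bigr => i _.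
  by rewrite scalerA -scalerBl.
have lx j : l j (tlog n x) = - abel u j.
  rewrite lN l_sum; congr (- _); rewrite /abel exchange_big /=.
  apply: eq_bigr => m _; rewrite lZ exprMn locX /loc mulr_suml l_sum mulr_sumr.
  by apply: eq_bigr => i _; rewrite -scalerAl lZ mulrA.
pose a := tlog n x - xi (fun j => - abel u j).
have aa : ann a by move=> j; rewrite lD lN l_xi lx subrr.
have na : nil a.
  by apply: nilrD; [apply: nil_tlog | apply/nilrN/nil_xi].
exists (c1 * exp a), (c1' * exp (- a)); split.
- by apply: annM; [apply: ann_loc | apply: ann_texp].
- by apply: annM; [apply: ann_loc | apply/ann_texp/annN].
- by rewrite mulrACA c1c1' mul1r (texpN rho_nil n_gt0).
rewrite uvE -mulrA; congr (_ * _).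
by rewrite /E -(texpD rho_nil n_gt0) ?subrK //; apply: nil_xi.
Qed.

Lemma one_sub_uv_unit u : good u -> 1 - u *: v \is a GRing.unit.
Proof.
move=> /one_sub_uv[c [c' [_ _ cc' ->]]].
apply/unitrPr; exists (c' * E (abel u)); rewrite mulrACA cc' mul1r.
have := EN (fun j => - abel u j); congr (_ * E _ = 1).
by apply/funext => j; rewrite opprK.
Qed.

Definition abel_sum (N : nat) (u : 'I_N -> F) : 'I_g -> F :=
  fun j => \sum_k abel (u k) j.

Lemma prod_one_sub_uv N (u : 'I_N -> F) : (forall k, good (u k)) ->
  exists c c', [/\ ann c, ann c', c * c' = 1 &
    E (abel_sum u) * \prod_k (1 - u k *: v) = c].
Proof.
move=> gu; have /choice[c /choice[c' cP]] k := one_sub_uv (gu k).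
exists (\prod_k c k), (\prod_k c' k); split.
- by apply: ann_prod => k; have [] := cP k.
- by apply: ann_prod => k; have [] := cP k.
- by rewrite -big_split big1 // => k _; have [] := cP k.
have -> : \prod_k (1 - u k *: v) = \prod_k c k * \prod_k E (fun j => - abel (u k) j).
  by rewrite -big_split; apply: eq_bigr => k _; have [_ _ _ ->] := cP k.
have -> : E (abel_sum u) = \prod_k E (abel (u k)).
  rewrite /E -(texp_sum rho_nil n_gt0); last by move=> k; apply: nil_xi.
  congr exp; rewrite /xi /abel_sum exchange_big; apply: eq_bigr => j _.
  by rewrite scaler_suml.
rewrite mulrCA -big_split [X in _ * X]big1 ?mulr1 // => k _; exact: EN.
Qed.

(* Inversion: the divisor of a section determines its class. *)
Lemma abel_sum_of_section z N (u : 'I_N -> F) a : a != 0 ->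
  (forall k, good (u k)) -> ann (a *: (E z * \prod_k (1 - u k *: v))) ->
  z = abel_sum u.
Proof.
move=> a0 gu /(annZ a^-1); rewrite scalerA mulVf // scale1r.
have [c [c' [_ ac' cc' cE]]] := prod_one_sub_uv gu => annP.
have : ann (E (fun j => z j + - abel_sum u j)).
  have -> : E (fun j => z j + - abel_sum u j) =
      (E z * \prod_k (1 - u k *: v)) * c'.
    have : E (fun j => z j + - abel_sum u j) * E (abel_sum u) = E z.
      by rewrite -ED; congr E; apply/funext => j; rewrite subrK.
    by move=> <-; rewrite -(mulrA _ (E (abel_sum u))) cE -mulrA cc' mulr1.
  exact: annM.
move=> /ann_E ez; apply/funext => j.
by have /eqP := congr1 (fun f => f j) ez; rewrite subr_eq0 => /eqP.
Qed.

(* Functions of [z] with values in [B] that are polynomial. *)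
Definition polyfun (f : ('I_g -> F) -> B) : Prop :=
  exists s : seq (mpoly g F * B), forall z, f z = \sum_(x <- s) ev z x.1 *: x.2.

Lemma polyfun_cst b : polyfun (fun=> b).
Proof.
by exists [:: (1, b)] => z; rewrite big_seq1 /= mpoly.meval1 scale1r.
Qed.

Lemma polyfunD f h : polyfun f -> polyfun h -> polyfun (fun z => f z + h z).
Proof. by move=> [s fE] [t hE]; exists (s ++ t) => z; rewrite big_cat fE hE. Qed.

Lemma polyfunM f h : polyfun f -> polyfun h -> polyfun (fun z => f z * h z).
Proof.
move=> [s fE] [t hE]; exists [seq (x.1 * y.1, x.2 * y.2) | x <- s, y <- t] => z.
rewrite fE hE big_allpairs_dep mulr_suml; apply: eq_bigr => x _.
rewrite mulr_sumr; apply: eq_bigr => y _ /=.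
by rewrite mpoly.mevalM -scalerAl -scalerAr scalerA.
Qed.

Lemma polyfunX f k : polyfun f -> polyfun (fun z => f z ^+ k).
Proof.
move=> pf; elim: k => [|k IH]; first exact: polyfun_cst.
rewrite (_ : (fun z => _) = fun z => f z * f z ^+ k); first exact: polyfunM.
by apply/funext => z; rewrite exprS.
Qed.

Lemma polyfun_sum (J : Type) (r : seq J) (f : J -> ('I_g -> F) -> B) :
  (forall i, polyfun (f i)) -> polyfun (fun z => \sum_(i <- r) f i z).
Proof.
move=> pf; elim: r => [|i r IH].
  rewrite (_ : (fun z => _) = fun=> 0); first exact: polyfun_cst.
  by apply/funext => z; rewrite big_nil.
rewrite (_ : (fun z => _) = fun z => f i z + \sum_(i <- r) f i z).
  exact: polyfunD.
by apply/funext => z; rewrite big_cons.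
Qed.

Lemma polyfun_E : polyfun E.
Proof.
apply: polyfun_sum => k; apply: polyfunM; first exact: polyfun_cst.
apply: polyfunX; apply: polyfun_sum => j; exists [:: (mX j, eta j)] => z.
by rewrite big_seq1 /= mpoly.mevalXU.
Qed.

Lemma l_polyfun j f : polyfun f -> exists p : mpoly g F, forall z, ev z p = l j (f z).
Proof.
move=> [s fE]; exists (\sum_(x <- s) x.1 * mpoly.mpolyC g (l j x.2)) => z.
rewrite fE l_sum raddf_sum; apply: eq_bigr => x _ /=.
by rewrite mpoly.mevalM mpoly.mevalC lZ.
Qed.

(** * The determinant [Theta] and its zeros *)

Lemma entry_ex j k : exists p : mpoly g F, forall z, ev z p = l j (v ^+ k * E z).
Proof.
by apply: l_polyfun; apply: polyfunM; [apply: polyfun_cst | apply: polyfun_E].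
Qed.

Definition entry (j : 'I_g) (k : nat) : mpoly g F := projT1 (cid (entry_ex j k)).

Lemma ev_entry z j k : ev z (entry j k) = l j (v ^+ k * E z).
Proof. by rewrite /entry; case: cid. Qed.

(** The determinant of [p -> p(v) E z], from polynomials of degree less than [g] to [B / ann]; its
    kernel is the space of sections of the line bundle of degree [g - 1] with class [z]. *)
Definition Theta : mpoly g F := \det (\matrix_(j < g, k < g) entry j k).

Local Notation values z := (fun j k => l j (v ^+ k * E z)).
Local Notation pb := (horner_alg v).

Lemma ev_Theta z : ev z Theta = \det (colblock (values z) g 0).
Proof.
rewrite /Theta -det_map_mx; congr (\det _); apply/matrixP => j k.
by rewrite !mxE /= ev_entry addn0.
Qed.

Lemma pbZ a p : pb (a *: p) = a *: pb p.
Proof. by rewrite linearZ /= -scalerAl mul1r. Qed.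

Lemma pbE (p : {poly F}) m : (size p <= m)%N -> pb p = \sum_(k < m) p`_k *: v ^+ k.
Proof.
move=> sp; rewrite {1}(_ : p = \sum_(k < m) p`_k *: 'X^k).
  rewrite linear_sum; apply: eq_bigr => k _ /=.
  by rewrite pbZ rmorphXn /= horner_algX.
rewrite -(poly_def m); apply/polyP => k; rewrite coef_poly.
by case: ltnP => // lek; rewrite nth_default // (leq_trans sp).
Qed.

(** The exponents [N k] are left free to cover both [Theta] and the minor with exponents [jump]. *)
Lemma kernel_det (N : nat -> nat) z (c : 'I_g -> F) :
  (exists k, c k != 0) -> ann ((\sum_k c k *: v ^+ N k) * E z) ->
  \det (\matrix_(j < g, k < g) values z j (N k)) = 0.
Proof.
move=> [k ck] aP; apply/eqP; rewrite -det_tr; apply/det0P.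
exists (\row_k c k).
  by apply: contraNneq ck => /rowP/(_ k); rewrite !mxE => ->.
apply/rowP => j; rewrite !mxE -[RHS](aP j) mulr_suml l_sum.
by apply: eq_bigr => i _; rewrite !mxE -scalerAl lZ.
Qed.

Lemma det_kernel (N : nat -> nat) z :
  \det (\matrix_(j < g, k < g) values z j (N k)) = 0 ->
  exists c : 'I_g -> F, (exists k, c k != 0) /\
    ann ((\sum_k c k *: v ^+ N k) * E z).
Proof.
move=> /eqP; rewrite -det_tr => /det0P[c c0 /rowP e0].
exists (c 0); split; first by apply/rV0Pn.
move=> j; have := e0 j; rewrite !mxE => e1; rewrite -[RHS]e1 mulr_suml l_sum.
by apply: eq_bigr => i _; rewrite !mxE -scalerAl lZ.
Qed.

Lemma Theta_colblock z : ev z Theta = \det (\matrix_(j < g, k < g) values z j k).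
Proof. by rewrite ev_Theta; congr (\det _); apply/matrixP => j k; rewrite !mxE addn0. Qed.

Lemma Theta_eq0 z (p : {poly F}) : p != 0 -> (size p <= g)%N -> ann (pb p * E z) -> ev z Theta = 0.
Proof.
move=> p0 sp; rewrite (pbE sp) Theta_colblock; apply: (@kernel_det id).
have sp0 : (0 < size p)%N by rewrite size_poly_gt0.
have lt : ((size p).-1 < g)%N by rewrite prednK.
by exists (Ordinal lt); rewrite /= -lead_coefE lead_coef_eq0.
Qed.

Lemma Theta_section z : ev z Theta = 0 ->
  exists p : {poly F}, [/\ p != 0, (size p <= g)%N & ann (pb p * E z)].
Proof.
rewrite Theta_colblock => /(@det_kernel id)[c [[k ck] ac]].
pose p : {poly F} := \poly_(i < g) (if insub i is Some j then c j else 0).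
have pc (i : 'I_g) : p`_i = c i.
  by rewrite coef_poly ltn_ord; case: insubP => [j _ /val_inj-> //|]; rewrite ltn_ord.
exists p; split; last 1 first.
- rewrite (pbE (size_poly _ _)); move: ac; congr ann; congr (_ * _).
  by apply: eq_bigr => i _; rewrite pc.
- by apply: contraNneq ck => p0; rewrite -pc p0 coef0.
exact: size_poly.
Qed.

Lemma pb_prod (J : finType) (P : pred J) (u : J -> F) :
  pb (\prod_(k | P k) (1 - u k *: 'X)) = \prod_(k | P k) (1 - u k *: v).
Proof.
rewrite rmorph_prod; apply: eq_bigr => k _.
by rewrite rmorphB rmorph1 /= pbZ horner_algX.
Qed.

Definition effective (N : nat) (z : 'I_g -> F) : Prop :=
  exists u : 'I_N -> F, (forall k, good (u k)) /\ z = abel_sum u.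

Hypothesis g_gt0 : (0 < g)%N.

Lemma Theta_effective z : effective g.-1 z -> ev z Theta = 0.
Proof.
move=> [u [gu ->]]; pose p := \prod_k (1 - u k *: 'X).
apply: (@Theta_eq0 _ p).
- apply/prodf_neq0 => k _; apply/eqP => e0.
  have : (1 - u k *: 'X).[0] = 1 by rewrite !hornerE ?mulr0 ?oppr0 ?addr0.
  by rewrite e0 horner0 => /eqP; rewrite eq_sym oner_eq0.
- have := size_prod_one_sub xpredT u.
  by rewrite cardT size_enum_ord prednK.
have [c [c' [ac _ _ cE]]] := prod_one_sub_uv gu.
by rewrite pb_prod mulrC cE.
Qed.

(** Along [d] the derivative of [E z] is [xi d * E z], with [xi d = v ^+ h - a]. Multiplication by
    [v ^+ h] shifts the column index; multiplication by [a] acts on the functionals by a constant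
    matrix, by [l_mul_ann]. *)
Lemma entry_flow (d : 'I_g -> F) h a j k : v ^+ h = a + xi d -> ann a ->
  dird d (entry j k) = entry j (k + h) -
    \sum_i mpoly.mpolyC g (l j (a * eta i)) * entry i k.
Proof.
move=> vh aa; apply: ev_ext => z.
(* [P] expands the entry at [z + s d] in powers of [s]; its coefficient of degree 1 is the
   derivative. *)
pose P : {poly F} := \poly_(m < n) (m`!%:R^-1 * l j (v ^+ k * E z * xi d ^+ m)).
have lineP : line z d (entry j k) = P.
  apply: poly_ext => s; rewrite lineE ev_entry horner_poly ED mulrA.
  have -> : E (fun i => s * d i) = exp (s *: xi d) by rewrite /E xiZ.
  rewrite /texp mulr_sumr l_sum; apply: eq_bigr => m _.
  rewrite exprZn -scalerAl mul1r scalerA -scalerAr lZ.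
  by rewrite mulrAC.
rewrite dirdE lineP horner_coef0 coef_deriv coef_poly n_gt1 factS fact0 muln1.
rewrite mulr1n invr1 mul1r expr1.
have -> : v ^+ k * E z * xi d = v ^+ (k + h) * E z - a * (v ^+ k * E z).
  by rewrite exprD vh; ring.
rewrite lD lN mpoly.mevalB ev_entry; congr (_ - _).
rewrite (l_mul_ann _ j aa) raddf_sum; apply: eq_bigr => i _ /=.
by rewrite mpoly.mevalM mpoly.mevalC ev_entry.
Qed.

(** * Values of the differentials, and a simple zero of [Theta] *)

Variable m : nat.
Hypothesis v_gen : forall x, exists p : {poly F}, (size p <= m)%N /\ x = pb p.

Lemma good_eventually : exists k0, forall k, (k0 <= k)%N -> good k%:R.
Proof.
have nz : \prod_i (1 - q i *: 'X) != 0 :> {poly F}.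
  apply/prodf_neq0 => i _; apply/eqP => e0.
  have : (1 - q i *: 'X).[0] = 1 by rewrite !hornerE ?mulr0 ?oppr0 ?addr0.
  by rewrite e0 horner0 => /eqP; rewrite eq_sym oner_eq0.
have [k0 k0P] := poly_neq0_eventually nz; exists k0 => k /k0P.
rewrite horner_prod => /prodf_neq0 gk i; have := gk i isT.
by rewrite !hornerE mulrC.
Qed.

(* The coefficients of the differentials, as functions of [u]. *)
Definition omega (u : F) (j : 'I_g) : F := l j (v / (1 - u *: v)).

Lemma inv_one_sub_uv u : good u -> (1 - u *: v)^-1 = 1 + u *: (v / (1 - u *: v)).
Proof.
move=> /one_sub_uv_unit uu; apply: (mulrI uu).
by rewrite mulrV // mulrDr mulr1 -scalerAr mulrCA mulrV // mulr1 subrK.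
Qed.

Lemma l_inv_one_sub_uv u j : good u -> l j (1 - u *: v)^-1 = u * omega u j.
Proof. by move=> /inv_one_sub_uv->; rewrite lD lZ ann1 add0r. Qed.

Lemma pb_prod_unit (J : finType) (P : pred J) (u : J -> F) :
  (forall k, good (u k)) -> pb (\prod_(k | P k) (1 - u k *: 'X)) \is a GRing.unit.
Proof.
by move=> gu; rewrite pb_prod; apply: rpred_prod => k _; apply: one_sub_uv_unit.
Qed.

Lemma div_partial_fractions N (u r : 'I_N -> F) : (forall k, good (u k)) ->
  pb (\sum_k r k *: \prod_(j | j != k) (1 - u j *: 'X)) /
    pb (\prod_k (1 - u k *: 'X)) = \sum_k r k *: (1 - u k *: v)^-1.
Proof.
move=> gu; rewrite linear_sum mulr_suml; apply: eq_bigr => k _.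
rewrite /= pbZ -scalerAl; congr (_ *: _).
rewrite !pb_prod [X in _ / X](bigD1 k) //= invrM.
- by rewrite mulrA mulrV ?mul1r //; apply: rpred_prod => j _; apply: one_sub_uv_unit.
- exact: one_sub_uv_unit.
by apply: rpred_prod => j _; apply: one_sub_uv_unit.
Qed.

(** As [v] generates [B], partial fractions write [eta j] as a combination of elements
    [(1 - u_k v)^-1] with good nonzero [u_k], and [l i] of these is [u_k * omega u_k i]. *)
Lemma omega_sep (c : 'I_g -> F) :
  (forall u, good u -> u != 0 -> \sum_j c j * omega u j = 0) -> forall j, c j = 0.
Proof.
move=> c0 j.
have [k0 gk] := good_eventually.
pose u (k : 'I_m) : F := (k0 + k.+1)%:R.
have gu k : good (u k) by apply: gk; rewrite leq_addr.
have u0 k : u k != 0 by rewrite pnatr_eq0 addnS.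
have inju : injective u.
  move=> a b /eqP; rewrite eqr_nat eqn_add2l eqSS => /eqP; exact: val_inj.
have [p [sp pE]] := v_gen (eta j * pb (\prod_k (1 - u k *: 'X))).
have [r rE] := partial_fractions inju u0 sp.
have etaE : eta j = \sum_k r k *: (1 - u k *: v)^-1.
  rewrite -(div_partial_fractions _ gu) -rE -pE mulrK //.
  exact: pb_prod_unit.
have : \sum_i c i * l i (eta j) = 0.
  rewrite etaE; under eq_bigr do rewrite l_sum mulr_sumr.
  rewrite exchange_big big1 // => k _ /=.
  under eq_bigr do rewrite lZ (l_inv_one_sub_uv _ (gu k)) mulrCA [c _ * _]mulrCA.
  by rewrite -mulr_sumr -mulr_sumr c0 // !mulr0.
rewrite (bigD1 j) //= big1 ?addr0 ?eta_dual ?eqxx ?mulr1 // => i /negbTE ij.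
by rewrite eta_dual ij mulr0.
Qed.

Lemma omega0_neq0 : exists j, omega 0 j != 0.
Proof.
apply: contrapT => nex.
have av : ann v.
  move=> j; apply/eqP; apply: contrapT => /negP vj; apply: nex; exists j.
  by rewrite /omega scale0r subr0 divr1.
have [p [_ pE]] := v_gen (eta (Ordinal g_gt0)).
have := eta_dual (Ordinal g_gt0) (Ordinal g_gt0); rewrite eqxx pE.
rewrite (pbE (leqnn _)) (ann_sum _) => [/eqP|k _]; last by apply/annZ/annX.
by rewrite eq_sym oner_eq0.
Qed.

Let rowG (u : F) : 'rV[F]_g := \row_j omega u j.

(** Greedy choice starting from the base point: by [omega_sep] no proper subspace contains all the
    vectors [rowG u]. *)
Lemma independent_points : exists f : nat -> F,
  [/\ f 0%N = 0, forall k, (k < g)%N -> (0 < k)%N -> good (f k) /\ f k != 0 &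
      \rank (\matrix_(i < g) rowG (f i)) = g].
Proof.
suff [f [f0 fg fi]] : exists f : nat -> F, [/\ f 0%N = 0,
    forall k, (k < g)%N -> (0 < k)%N -> good (f k) /\ f k != 0 &
    forall k, (k < g)%N -> ~~ (rowG (f k) <= \matrix_(i < k) rowG (f i))%MS].
  by exists f; split=> //; apply: (rank_indep (f := rowG \o f)).
suff ext b : (b <= g)%N -> exists f : nat -> F, [/\ f 0%N = 0,
    forall k, (k < b)%N -> (0 < k)%N -> good (f k) /\ f k != 0 &
    forall k, (k < b)%N -> ~~ (rowG (f k) <= \matrix_(i < k) rowG (f i))%MS].
  exact: ext.
elim: b => [|b IH] ltbg; first by exists (fun=> 0); split.
have [f [f0 fg fi]] := IH (ltnW ltbg).
have [b0|b0] := posnP b.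
  exists (fun=> 0); split=> // [k|k]; rewrite b0 ltnS leqn0 => /eqP-> //.
  rewrite [X in (_ <= X)%MS]flatmx0; have [j /eqP nz] := omega0_neq0.
  by apply/negP => /submx0null/rowP/(_ j); rewrite !mxE.
have [u [gu u0 nu]] : exists u, [/\ good u, u != 0 &
    ~~ (rowG u <= \matrix_(i < b) rowG (f i))%MS].
  apply: contrapT => nex.
  have C0 : cokermx (\matrix_(i < b) rowG (f i)) = 0.
    apply/matrixP => i j; rewrite [RHS]mxE.
    pose C := cokermx (\matrix_(i < b) rowG (f i)).
    apply: (omega_sep (c := fun i => C i j) _ i) => u gu u0.
    have : (rowG u <= \matrix_(i < b) rowG (f i))%MS.
      by apply: contrapT => /negP nu; apply: nex; exists u.
    rewrite submxE => /eqP/matrixP/(_ 0 j); rewrite !mxE => e0.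
    by rewrite -[RHS]e0; apply: eq_bigr => k _; rewrite !mxE mulrC.
  have := mxrank_coker (\matrix_(i < b) rowG (f i)); rewrite C0 mxrank0 => /eqP.
  rewrite eq_sym subn_eq0 leqNgt => /negP; apply.
  by apply: leq_ltn_trans (rank_leq_row _) _.
exists (fun k => if k == b then u else f k); split.
- by rewrite ltn_eqF.
- by move=> k; rewrite ltnS leq_eqVlt; case: eqP => //= _ ltkb; apply: fg.
move=> k; rewrite ltnS leq_eqVlt => lekb.
have -> : \matrix_(i < k) rowG (if (i : nat) == b then u else f i) =
    \matrix_(i < k) rowG (f i).
  apply/matrixP => i j; rewrite !mxE ltn_eqF //.
  by case/orP: lekb => [/eqP<-//|/(ltn_trans (ltn_ord i))].
by case: eqP lekb => [->|_] //= ltkb; apply: fi.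
Qed.
Lemma size_prod_one_sub_neq0 N (u : 'I_N -> F) : (forall k, u k != 0) ->
  size (\prod_k (1 - u k *: 'X)) = N.+1.
Proof.
move=> u0; have sz k : size (1 - u k *: 'X) = 2.
  rewrite addrC size_polyDl size_polyN size_scale ?size_polyX ?size_poly1 //.
rewrite size_prod => [|k _]; last by rewrite -size_poly_eq0 sz.
rewrite (eq_bigr (fun=> 2)) => [|k _]; last exact: sz.
by rewrite sum_nat_const cardT size_enum_ord; lia.
Qed.

Let jump (k : nat) : nat := if (k.+1 < g)%N then k else g.

(* The last exponent is moved from [g - 1] to [g]: this minor is the
   derivative of [Theta] along the curve at its base point. *)
Lemma jump_minor_neq0 : exists2 w, effective g.-1 w &
  \det (\matrix_(j < g, k < g) values w j (jump k)) != 0.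
Proof.
have [f [f0 fg rk]] := independent_points.
have lt (k : 'I_g.-1) : (k.+1 < g)%N by have := ltn_ord k; have := g_gt0; lia.
pose u (k : 'I_g.-1) := f k.+1.
have gu k : good (u k) by have [] := fg k.+1 (lt k) isT.
have u0 k : u k != 0 by have [] := fg k.+1 (lt k) isT.
have inju : injective u.
  move=> a b ab; apply: val_inj; apply: contrapT => /eqP nab.
  have frM : row_free (\matrix_(i < g) rowG (f i)) by rewrite -row_leq_rank rk.
  have := row_free_inj frM.
  pose da : 'rV[F]_g := delta_mx 0 (Ordinal (lt a)).
  pose db : 'rV[F]_g := delta_mx 0 (Ordinal (lt b)).
  move=> /(_ _ da db); rewrite -!rowE !rowK /= -/(u a) -/(u b) ab => /(_ erefl).
  move=> /rowP/(_ (Ordinal (lt a))); rewrite !mxE !eqxx /=.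
  have -> : (Ordinal (lt a) == Ordinal (lt b)) = false.
    by apply/negbTE; rewrite -val_eqE /= eqSS.
  by move/eqP; rewrite oner_eq0.
exists (abel_sum u); first by exists u.
(* A kernel vector is a polynomial [P] of degree at most [g] without term of degree [g - 1], such
   that [P / Pi] lies in [ann]. *)
apply/eqP => /(@det_kernel jump)[c [[k0 ck0] aP]].
pose Pi : {poly F} := \prod_k (1 - u k *: 'X).
have sPi : size Pi = g by rewrite /Pi size_prod_one_sub_neq0 // prednK.
have Pi0 : Pi != 0 by rewrite -size_poly_eq0 sPi -lt0n.
have Piu : pb Pi \is a GRing.unit by apply: pb_prod_unit.
pose P : {poly F} := \sum_(k < g) c k *: 'X^(jump k).
have jle k : (jump k <= g)%N by rewrite /jump; case: ifP => // /ltnW/ltnW.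
have jinj : injective (fun k : 'I_g => jump k).
  move=> a b; rewrite /jump => jab; apply: val_inj => /=.
  have := ltn_ord a; have := ltn_ord b; move: jab.
  by case: ifP; case: ifP; lia.
have pbP : pb P = \sum_k c k *: v ^+ jump k.
  rewrite linear_sum; apply: eq_bigr => k _.
  by rewrite /= pbZ rmorphXn /= horner_algX.
have Pc (k : 'I_g) : P`_(jump k) = c k.
  rewrite coef_sum (bigD1 k) //= big1 ?addr0 => [|i ik].
    by rewrite coefZ coefXn eqxx mulr1.
  by rewrite coefZ coefXn (inj_eq jinj) eq_sym (negbTE ik) mulr0.
have Pg : P`_g.-1 = 0.
  rewrite coef_sum big1 // => k _; rewrite coefZ coefXn.
  suff -> : (g.-1 == jump k) = false by rewrite mulr0.
  by apply/negbTE; rewrite /jump; case: ifP; have := g_gt0; lia.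
have sP : (size P <= g.+1)%N.
  apply: (leq_trans (size_sum _ _ _)); apply/bigmax_leqP => k _.
  by rewrite (leq_trans (size_scale_leq _ _)) // size_polyXn ltnS.
have aPPi : ann (pb P / pb Pi).
  have [a [a' [_ aa' aE cE]]] := prod_one_sub_uv gu.
  rewrite -pb_prod -/Pi in cE.
  have -> : pb P / pb Pi = pb P * E (abel_sum u) * a'.
    apply: (mulIr Piu); rewrite divrK //.
    rewrite -!mulrA [a' * _]mulrC [E _ * _]mulrA cE.
    by rewrite aE mulr1.
  by apply: annM => //; rewrite pbP.
pose Q := P %/ Pi; pose R := P %% Pi.
have PQR : P = Q * Pi + R := divp_eq P Pi.
have sR : (size R <= g.-1)%N.
  by have := ltn_modp P Pi; rewrite -/R Pi0 sPi; have := g_gt0; lia.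
have sQ : (size Q <= 2)%N.
  rewrite size_divp // sPi leq_subLR; apply: (leq_trans sP).
  by have := g_gt0; lia.
have [r rE] := partial_fractions inju u0 sR.
(* Apply [l j] to [P / Pi = Q + R / Pi], with [R / Pi] in partial fractions. Independence of the
   differentials at 0 and the [u k] then makes [Q] constant and [R = 0]. *)
have key j : Q`_1 * omega 0 j + \sum_k r k * (u k * omega (u k) j) = 0.
  have := aPPi j; rewrite PQR rmorphD rmorphM /= mulrDl mulrK // rE.
  rewrite (div_partial_fractions _ gu) lD l_sum (pbE sQ) !big_ord_recl big_ord0.
  rewrite addr0 expr0 /= lD lZ ann1 mulr0 add0r lZ => e0; rewrite -[RHS]e0.
  rewrite /omega scale0r subr0 divr1 expr1; congr (_ + _).
  by apply: eq_bigr => k _; rewrite lZ (l_inv_one_sub_uv _ (gu k)).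
pose rn k := if insub k is Some i then r i else 0.
pose a : 'rV[F]_g := \row_(i < g) if (i : nat) is k.+1 then rn k * f k.+1 else Q`_1.
have rnE (i : 'I_g.-1) : rn i = r i.
  by rewrite /rn; case: insubP => [i' _ /val_inj->|]; rewrite ?ltn_ord.
have a0 : a = 0.
  have frM : row_free (\matrix_(i < g) rowG (f i)) by rewrite -row_leq_rank rk.
  apply: (row_free_inj frM); rewrite mul0mx; apply/rowP => j; rewrite !mxE.
  pose T (i : nat) := (if i is k.+1 then rn k * f k.+1 else Q`_1) * omega (f i) j.
  rewrite (eq_bigr (fun i : 'I_g => T i)) => [|i _]; last by rewrite !mxE.
  rewrite -(big_mkord xpredT T) -(prednK g_gt0) big_nat_recl // big_mkord.
  rewrite -[RHS](key j) /T f0; congr (_ + _); apply: eq_bigr => k _.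
  by rewrite rnE -mulrA.
have Q1 : Q`_1 = 0 by have := congr1 (fun A : 'rV_g => A 0 (Ordinal g_gt0)) a0; rewrite !mxE.
have r0 k : r k = 0.
  have := congr1 (fun A : 'rV_g => A 0 (Ordinal (lt k))) a0; rewrite !mxE /= rnE.
  by move/eqP; rewrite mulf_eq0 (negbTE (u0 k)) orbF => /eqP.
have QC : Q = (Q`_0)%:P.
  apply/polyP => -[|[|i]]; rewrite coefC //= nth_default //.
  by apply: leq_trans sQ _.
have PE : P = Q`_0 *: Pi.
  rewrite {1}PQR rE big1 ?addr0 => [|k _]; last by rewrite r0 scale0r.
  by rewrite {1}QC mul_polyC.
(* [Pi] has degree exactly [g - 1], a degree missing in [P]. *)
have Q0 : Q`_0 = 0.
  have := Pg; rewrite PE coefZ => /eqP; rewrite mulf_eq0 => /orP[/eqP//|].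
  by rewrite -sPi -lead_coefE lead_coef_eq0 (negbTE Pi0).
by move: ck0; rewrite -Pc PE Q0 scale0r coef0 eqxx.
Qed.

Lemma dird_derivation (d : 'I_g -> F) : derivation (@dird g F d).
Proof.
split=> p r; rewrite /dird.
  by rewrite -big_split; apply: eq_bigr => i _; rewrite mpoly.mderivD scalerDr.
rewrite mulr_suml mulr_sumr -big_split; apply: eq_bigr => i _ /=.
by rewrite mpoly.mderivM scalerDr scalerAl scalerAr.
Qed.

(** Differentiate the determinant along the flow of [v]. As [\det M0 = 0] at an effective point, the
    frame change contributes nothing; each shifted column but the last repeats a column of [M0], and
    the last gives the minor with exponents [jump]. *)
Lemma Theta_smooth_point : exists w d,
  effective g.-1 w /\ ev w (dird d Theta) != 0.
Proof.
have [w ew nz] := jump_minor_neq0; exists w, (fun j => l j v); split=> //.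
have flow j k := entry_flow j k (esym (subrK (xi (fun j => l j v)) (v ^+ 1)))
  (xi_mod_ann (v ^+ 1)).
pose S : 'M[F]_g := \matrix_(j, i) l j ((v ^+ 1 - xi (fun j => l j v)) * eta i).
pose M0 := colblock (values w) g 0.
have det0 : \det M0 = 0 by rewrite -ev_Theta Theta_effective.
have -> : ev w (dird (fun j => l j v) Theta) =
    \tr ((colblock (values w) g 1 - S *m M0) *m \adj M0).
  rewrite /Theta (der_det (dird_derivation _)) raddf_sum; apply: eq_bigr => i _.
  rewrite mxE raddf_sum; apply: eq_bigr => j _ /=.
  rewrite mpoly.mevalM; congr (_ * _).
    rewrite mxE flow mpoly.mevalB ev_entry !mxE; congr (_ - _).
    rewrite raddf_sum; apply: eq_bigr => k _.
    by rewrite !mxE /= mpoly.mevalM mpoly.mevalC ev_entry addn0.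
  rewrite mxE -cofactor_map_mx; congr (cofactor _ _ _).
  by apply/matrixP => a b; rewrite !mxE /= ev_entry addn0.
rewrite mulmxBl raddfB /= -mulmxA mul_mx_adj det0 raddf0 mulmx0 raddf0 subr0.
rewrite mxtrace_mulC; pose lst : 'I_g := rev_ord (Ordinal g_gt0).
have lstE : lst.+1 = g by rewrite /=; have := g_gt0; lia.
rewrite /mxtrace (bigD1 lst) //= big1 ?addr0.
  suff -> : (\adj M0 *m colblock (values w) g 1) lst lst =
      \det (\matrix_(j < g, k < g) values w j (jump k)) by [].
  rewrite (expand_det_col _ lst) mxE; apply: eq_bigr => i _.
  rewrite !mxE mulrC; congr (_ * _).
    by rewrite /jump lstE ltnn addn1 lstE.
  rewrite /cofactor; congr (_ * \det _); apply/matrixP => a b; rewrite !mxE addn0.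
  congr (l _ (v ^+ _ * _)); rewrite /jump ifT //.
  have ne : (lst : nat) <> lift lst b.
    by move=> /val_inj eb; have := neq_lift lst b; rewrite -eb eqxx.
  by have := ltn_ord (lift lst b); move: ne lstE; case: (lift lst b) => x ltx; lia.
move=> k kl; have hk : (k.+1 < g)%N.
  rewrite ltn_neqAle ltn_ord andbT; apply: contra kl => /eqP ek.
  by apply/eqP/val_inj => /=; lia.
transitivity ((\adj M0 *m M0) k (Ordinal hk)); last first.
  by rewrite mul_adj_mx det0 raddf0 mxE.
by rewrite !mxE; apply: eq_bigr => i _; rewrite !mxE addn0 addn1.
Qed.

(** * Irreducibility of the set of effective classes *)

Let Delta : {poly F} := \prod_i (1 - q i *: 'X).

Let Delta_good u : good u <-> Delta.[u] != 0.
Proof.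
rewrite horner_prod; split=> [gu|/prodf_neq0 nz i].
  by apply/prodf_neq0 => i _; rewrite !hornerE mulrC.
by have := nz i isT; rewrite !hornerE mulrC.
Qed.

Definition rational_on_good (h : F -> F) : Prop :=
  exists P N, forall u, good u -> h u * Delta.[u] ^+ N = P.[u].

Lemma rational_cst c : rational_on_good (fun=> c).
Proof. by exists c%:P, 0%N => u _; rewrite expr0 mulr1 hornerC. Qed.

Lemma rationalD h1 h2 : rational_on_good h1 -> rational_on_good h2 ->
  rational_on_good (fun u => h1 u + h2 u).
Proof.
move=> [P1 [N1 e1]] [P2 [N2 e2]].
exists (P1 * Delta ^+ N2 + P2 * Delta ^+ N1), (N1 + N2)%N => u gu.
by rewrite !hornerE -e1 // -e2 // exprD; ring.
Qed.

Lemma rationalM h1 h2 : rational_on_good h1 -> rational_on_good h2 ->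
  rational_on_good (fun u => h1 u * h2 u).
Proof.
move=> [P1 [N1 e1]] [P2 [N2 e2]].
exists (P1 * P2), (N1 + N2)%N => u gu.
by rewrite hornerM -e1 // -e2 // exprD; ring.
Qed.

Lemma rational_sum (J : Type) (r : seq J) (h : J -> F -> F) :
  (forall i, rational_on_good (h i)) ->
  rational_on_good (fun u => \sum_(i <- r) h i u).
Proof.
move=> rh; elim: r => [|i r IH].
  rewrite (_ : (fun u => _) = fun=> 0); first exact: rational_cst.
  by apply/funext => u; rewrite big_nil.
rewrite (_ : (fun u => _) = fun u => h i u + \sum_(i <- r) h i u).
  exact: rationalD.
by apply/funext => u; rewrite big_cons.
Qed.

Lemma rational_abel j : rational_on_good (fun u => abel u j).
Proof.
apply: rational_sum => i; apply: rational_sum => k.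
apply: rationalM; last exact: rational_cst.
apply: rationalM; first exact: rational_cst.
have rx : rational_on_good (fun u => u / (1 - u * q i)).
  exists ('X * \prod_(j | j != i) (1 - q j *: 'X)), 1%N => u gu.
  rewrite expr1 /Delta (bigD1 i) //= !hornerM hornerX.
  have -> : (1 - q i *: 'X).[u] = 1 - u * q i by rewrite !hornerE mulrC.
  by rewrite mulrA divfK.
elim: (k.+1) => [|N IH]; first exact: rational_cst.
rewrite (_ : (fun u => _) = fun u => u / (1 - u * q i) * (u / (1 - u * q i)) ^+ N).
  exact: rationalM.
by apply/funext => u; rewrite exprS.
Qed.

Lemma rational_translate (p : mpoly g F) z :
  rational_on_good (fun u => ev (fun j => z j + abel u j) p).
Proof.
elim/mpoly_ring_ind: p => [c|i|p r IHp IHr|p r IHp IHr].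
- rewrite (_ : (fun u => _) = fun=> c); first exact: rational_cst.
  by apply/funext => u; rewrite mpoly.mevalC.
- rewrite (_ : (fun u => _) = fun u => z i + abel u i).
    by apply: rationalD; [apply: rational_cst | apply: rational_abel].
  by apply/funext => u; rewrite mpoly.mevalXU.
- rewrite (_ : (fun u => _) = fun u => ev (fun j => z j + abel u j) p +
    ev (fun j => z j + abel u j) r); first exact: rationalD.
  by apply/funext => u; rewrite mpoly.mevalD.
rewrite (_ : (fun u => _) = fun u => ev (fun j => z j + abel u j) p *
  ev (fun j => z j + abel u j) r); first exact: rationalM.
by apply/funext => u; rewrite mpoly.mevalM.
Qed.

Lemma rational_eq0 h : rational_on_good h ->
  (forall k, exists2 k' : nat, (k <= k')%N & good k'%:R /\ h k'%:R = 0) ->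
  forall u, good u -> h u = 0.
Proof.
move=> [P [N hE]] inf u gu.
have P0 : P = 0.
  apply: poly_eq0_infinite => k; have [k' lek [gk hk]] := inf k.
  by exists k' => //; rewrite -hE // hk mul0r.
have /eqP := hE u gu; rewrite P0 horner0 mulf_eq0 expf_eq0.
by have /Delta_good/negbTE-> := gu; rewrite andbF orbF => /eqP.
Qed.

Let shift (x : F) (p : mpoly g F) : mpoly g F :=
  mpoly.comp_mpoly [tuple mX i + mpoly.mpolyC g (abel x i) | i < g] p.

Let shiftE x p w : ev w (shift x p) = ev (fun j => w j + abel x j) p.
Proof.
rewrite /shift mpoly.comp_mpoly_meval; apply: mpoly.meval_eq => i.
by rewrite tnth_mktuple mpoly.mevalD mpoly.mevalXU mpoly.mevalC.
Qed.

Let effectiveS N w x : good x -> effective N w -> effective N.+1 (fun j => w j + abel x j).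
Proof.
move=> gx [u [gu ->]].
exists (fun k => if unlift ord0 k is Some k' then u k' else x); split=> [k|].
  by case: unliftP => [k' _|_].
apply/funext => j; rewrite /abel_sum big_ord_recl unlift_none addrC.
by congr (_ + _); apply: eq_bigr => k _; rewrite liftK.
Qed.

(** Induction on the number of points. With one point fixed at a good integer, one factor vanishes;
    so one of them does for arbitrarily large integers and, being rational in that point, vanishes
    identically. *)
Lemma effective_irreducible N (p r : mpoly g F) :
  (forall w, effective N w -> ev w p * ev w r = 0) ->
  (forall w, effective N w -> ev w p = 0) \/ (forall w, effective N w -> ev w r = 0).
Proof.
elim: N p r => [|N IH] p r pr0.
  have e0 : effective 0 (abel_sum (fun i : 'I_0 => 0)) by exists (fun=> 0); split=> // -[].
  have eq0 w : effective 0 w -> w = abel_sum (fun i : 'I_0 => 0).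
    by move=> [u [_ ->]]; apply/funext => j; rewrite /abel_sum !big_ord0.
  have /eqP := pr0 _ e0; rewrite mulf_eq0 => /orP[] /eqP z0.
    by left=> w /eq0->.
  by right=> w /eq0->.
pose vanish (s : mpoly g F) (k : nat) :=
  forall w, effective N w -> ev w (shift k%:R s) = 0.
have alt k : good k%:R -> vanish p k \/ vanish r k.
  move=> gk; apply: IH => w ew; rewrite !shiftE; apply: pr0.
  exact: effectiveS.
have inf s : (forall k, exists2 k' : nat, (k <= k')%N & good k'%:R /\ vanish s k') ->
    forall w, effective N.+1 w -> ev w s = 0.
  move=> hs w [u [gu ->]].
  pose w0 := abel_sum (fun k => u (lift ord0 k)).
  have -> : abel_sum u = fun j => w0 j + abel (u ord0) j.
    by apply/funext => j; rewrite /abel_sum big_ord_recl addrC.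
  apply: (rational_eq0 (rational_translate s w0)) (gu ord0) => k.
  have [k' lek [gk vk]] := hs k; exists k' => //; split=> //.
  by rewrite -shiftE; apply: vk; exists (fun k => u (lift ord0 k)).
have [k0 gk0] := good_eventually.
have [infp|fin] := pselect (forall k, exists2 k' : nat, (k <= k')%N & good k'%:R /\ vanish p k').
  by left; apply: inf.
right; apply: inf => k.
move/existsNP: fin => [b /forall2NP nb].
pose k' := maxn k (maxn b k0).
have gk : good k'%:R by apply: gk0; rewrite /k' !leq_max leqnn !orbT.
exists k'; first exact: leq_maxl.
split=> //; have [vp|//] := alt k' gk.
have [/negP|nv] := nb k'; first by rewrite /k' !leq_max leqnn orbT.
by case: nv.
Qed.

(** * Zeros of [Theta] as limits of effective classes *)

Hypotheses (e_neq0 : forall i, e i != 0) (q_has0 : exists i, q i = 0).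

Lemma texp_sub1_nil x : nil x -> nil (exp x - 1).
Proof.
move=> nx; rewrite /texp -(prednK n_gt0) big_ord_recl expr0 mulr1 cexp0.
rewrite addrC addKr; apply: nilr_sum => k _ /=.
by rewrite exprS mulrCA mulrC; apply: nilrMl.
Qed.

(** [E z - 1] is nilpotent, so modulo nilpotents [p] takes the value 1 at each [q i]. *)
Lemma value_at_point (p : {poly F}) z i : pb p = E z -> p.[q i] = 1.
Proof.
move=> pE; pose c i := p.[q i] - 1.
have [y yE] : nil (loc c).
  have -> : loc c = (E z - 1) - (pb p - horner_alg (loc q) p).
    have -> : loc c = loc (fun i => p.[q i]) - 1.
      rewrite -[1]scale1r -locC /loc -sumrB; apply: eq_bigr => j _.
      by rewrite -scalerBl.
    by rewrite horner_alg_loc pE; ring.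
  apply: nilrD; first by apply: texp_sub1_nil; apply: nil_xi.
  by apply/nilrN/horner_alg_nil; exists 1; rewrite mul1r.
have : (loc c) ^+ n * e i = 0 by rewrite yE exprMn rho_nil mulr0 mul0r.
rewrite locX mulrC /loc mulr_sumr (bigD1 i) //= big1 ?addr0 => [|j /negbTE ji].
  rewrite -scalerAr e_orth eqxx => /eqP; rewrite scaler_eq0 (negbTE (e_neq0 i)).
  by rewrite orbF expf_eq0 => /andP[_]; rewrite subr_eq0 => /eqP.
by rewrite -scalerAr e_orth eq_sym ji scaler0.
Qed.

Lemma effective_seq (s : seq F) : (forall u, u \in s -> good u) ->
  (size s <= g.-1)%N -> effective g.-1 (fun j => \sum_(u <- s) abel u j).
Proof.
(* Missing points are filled with the base point 0, where [abel] vanishes. *)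
move=> gs ss; exists (fun k => nth 0 s k); split=> [k|].
  case: (ltnP k (size s)) => lek; first by apply/gs/mem_nth.
  by rewrite nth_default // => i; rewrite mul0r subr0 oner_neq0.
apply/funext => j; rewrite /abel_sum (big_nth 0) big_mkord.
rewrite (big_ord_widen _ (fun k => abel (nth 0 s k) j) ss) big_mkcond /=.
apply: eq_bigr => k _; case: ltnP => // lek.
by rewrite nth_default // abel0.
Qed.

Lemma abel_vanishes_at0 j : vanishes_at0 (fun u => abel u j).
Proof.
apply: vanishes_at0_sum => i; apply: vanishes_at0_sum => k.
have -> : (fun u => k.+1%:R^-1 * (u / (1 - u * q i)) ^+ k.+1 * l j (e i * rho ^+ k.+1))
    = fun u => (k.+1%:R^-1 * l j (e i * rho ^+ k.+1)) * (u / (1 - u * q i)) ^+ k.+1.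
  by apply/funext => u; rewrite mulrAC.
apply/vanishes_at0Z; apply: (vanishes_at0X (h := fun u => u / (1 - u * q i))).
exact: vanishes_at0_moebius.
Qed.

(* A section vanishing at a singular point or of too small a degree is deformed
   to [P + eps Q], where [Q] trivializes the line bundle near the singular
   points: the class does not change, and the extra zeros go to the base
   point. *)
Lemma Theta_closure z : ev z Theta = 0 -> forall eps, 0 < eps ->
  exists2 w, effective g.-1 w & forall j, `|w j - z j| < eps.
Proof.
move=> /Theta_section[P [P0 sP aP]] eps eps0.
(* [Q] represents the inverse of [E z], so [(P + t Q) E z] stays in [ann] for every constant [t]. *)
have [Q [sQ QE]] := v_gen (E (fun j => - z j)).
have aQ : ann (pb Q * E z) by rewrite -QE mulrC EN; apply: ann1.
pose N := maxn (size P) (size Q).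
have N1 : 0 < N.+1%:R :> F by rewrite ltr0Sn.
have [d d0 abel_d] : exists2 d, 0 < d &
    forall u, `|u| < d -> forall j, `|abel u j| < eps / N.+1%:R.
  have e0 : 0 < eps / N.+1%:R by rewrite divr_gt0.
  suff [d d0 dP] : exists2 d, 0 < d & forall u, `|u| < d ->
      forall j, j \in enum 'I_g -> `|abel u j| < eps / N.+1%:R.
    by exists d => // u ud j; apply: dP => //; rewrite mem_enum.
  elim: (enum 'I_g) => [|j s [d d0 dP]]; first by exists 1.
  have [d' d'0 d'P] := abel_vanishes_at0 j e0.
  have [d2 [d20 dd2 d'd2]] := common_bound d0 d'0; exists d2 => // u ud i.
  rewrite inE => /orP[/eqP->|]; first exact: d'P (lt_le_trans ud d'd2).
  exact: dP (lt_le_trans ud dd2) _.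
have [d1 d10 few] := few_bounded_roots Q P0 (ltW (divr_gt0 (@ltr01 F) d0) : 0 <= 1 / d).
(* [t] is sought as [d1 / (k + 2)] with [k] an integer; [Z] at [k] tests that no [P.[q i] + t]
   vanishes, so that the zeros of [P + t Q] avoid the singular points. *)
have [t [t0 td tnz]] : exists t, [/\ t != 0, `|t| < d1 & forall i, P.[q i] + t != 0].
  have [c cE] : exists c : F, c = 2 by exists 2.
  pose Z : {poly F} := \prod_i (P.[q i] *: ('X + c%:P) + d1%:P).
  have Z0 : Z != 0.
    apply/prodf_neq0 => i _; apply/eqP => e0.
    have : (P.[q i] *: ('X + c%:P) + d1%:P).[- c] = d1.
      by rewrite !hornerE addNr mulr0 add0r.
    by rewrite e0 horner0 => e1; move: d10; rewrite -e1 ltxx.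
  have [k0 k0P] := poly_neq0_eventually Z0.
  have k20 : k0%:R + c != 0 by rewrite cE -natrD pnatr_eq0 addn2.
  exists (d1 / (k0%:R + c)); split.
  - by rewrite mulf_neq0 ?invr_eq0 // gt_eqF.
  - rewrite cE gtr0_norm ?divr_gt0 // ?ltr_wpDl //.
    by rewrite ltr_pdivrMr ?ltr_wpDl // ltr_pMr // ltr_wpDl // ltr1n.
  move=> i; have := k0P k0 (leqnn _); rewrite horner_prod => /prodf_neq0/(_ i isT).
  rewrite !hornerE => nz; apply: contraNneq nz => e0; apply/eqP.
  transitivity ((P.[q i] + d1 / (k0%:R + c)) * (k0%:R + c)).
    by rewrite mulrDl divfK.
  by rewrite e0 mul0r.
pose Ft := P + t *: Q.
have Ftq i : Ft.[q i] != 0.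
  by rewrite /Ft hornerD hornerZ (value_at_point i (esym QE)) mulr1.
have aF : ann (pb Ft * E z).
  rewrite /Ft rmorphD /= pbZ mulrDl -scalerAl; apply: annD => //.
  exact: annZ.
have [s Fs] := closed_field_poly_normal Ft.
have Ft0 : Ft != 0.
  by have [i _] := q_has0; apply: contraNneq (Ftq i) => ->; rewrite horner0.
have lc0 : lead_coef Ft != 0 by rewrite lead_coef_eq0.
have rs x : x \in s -> Ft.[x] = 0.
  by rewrite -root_prod_XsubC => /rootP sx; rewrite Fs hornerZ sx mulr0.
have s0 x : x \in s -> x != 0.
  move=> /rs Fx; have [i qi] := q_has0.
  by apply: contraNneq (Ftq i) => x0; rewrite x0 in Fx; rewrite qi Fx.
have sgood x : x \in s -> good x^-1.
  move=> xs i; apply: contraNneq (Ftq i) => /eqP; rewrite subr_eq0 => /eqP e1.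
  have -> : q i = x by rewrite -[LHS](mulVKf (s0 x xs)) -e1 mulr1.
  by rewrite rs.
(* The roots of modulus at most [1 / d] number at most [g - 1]; the others have inverses of modulus
   less than [d], where [abel] is small. *)
pose sm := [seq x <- s | `|x| <= 1 / d]; pose bg := [seq x <- s | ~~ (`|x| <= 1 / d)].
have perm_s : perm_eq (sm ++ bg) s by rewrite perm_filterC.
have zE : z = fun j => \sum_(x <- s) abel x^-1 j.
  pose u (k : 'I_(size s)) := (nth 0 s k)^-1.
  have -> : (fun j => \sum_(x <- s) abel x^-1 j) = abel_sum u.
    by apply/funext => j; rewrite /abel_sum (big_nth 0) big_mkord.
  pose a := lead_coef Ft * \prod_(x <- s) (- x).
  apply: (@abel_sum_of_section z _ u a).
  - rewrite mulf_neq0 // prodf_seq_neq0; apply/allP => x /s0 x0.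
    by rewrite oppr_eq0.
  - by move=> k; apply/sgood/mem_nth.
  move: aF; congr ann; rewrite mulrC scalerAr; congr (_ * _).
  rewrite -pb_prod -pbZ; congr pb; rewrite [LHS]Fs /a -scalerA; congr (_ *: _).
  rewrite (big_nth 0) big_mkord [X in X *: _](big_nth 0) big_mkord.
  rewrite -scaler_prod; apply: eq_bigr => k _.
  have nk0 : nth 0 s k != 0 by apply/s0/mem_nth.
  by rewrite scalerBr scalerA /u mulNr mulfV // scaleN1r opprK addrC
    -mul_polyC mulr1 polyCN.
pose w j := \sum_(x <- sm) abel x^-1 j.
have szs : (size s < N.+1)%N.
  have : size Ft = (size s).+1 by rewrite Fs size_scale // size_prod_XsubC.
  move=> sF; rewrite ltnS; apply: leq_trans (_ : (size Ft).-1 <= _)%N; first by rewrite sF.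
  rewrite (leq_trans (leq_pred _)) // /Ft (leq_trans (size_polyD _ _)) //.
  by rewrite geq_max leq_maxl /= (leq_trans (size_scale_leq _ _)) ?leq_maxr.
exists w.
  have -> : w = fun j => \sum_(u <- [seq x^-1 | x <- sm]) abel u j.
    by apply/funext => j; rewrite big_map.
  apply: effective_seq => [_ /mapP[x xs ->]|].
    by apply: sgood; move: xs; rewrite mem_filter => /andP[].
  rewrite size_map -ltnS prednK //; apply: leq_trans sP.
  apply: (few t sm (lead_coef Ft *: \prod_(x <- bg) ('X - x%:P))) => //.
    exact: filter_all.
  rewrite -scalerAr -big_cat /= (perm_big _ perm_s) /=; exact: Fs.
move=> j; have -> : w j - z j = - \sum_(x <- bg) abel x^-1 j.
  rewrite {1}zE /= -(perm_big _ perm_s) big_cat /= /w opprD addrA subrr add0r //.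
rewrite normrN (le_lt_trans (ler_norm_sum _ _ _)) //.
apply: (le_lt_trans (y := \sum_(x <- bg) eps / N.+1%:R)).
  rewrite big_seq [X in _ <= X]big_seq; apply: ler_sum => x.
  rewrite mem_filter => /andP[xb xs]; apply/ltW/abel_d.
  rewrite normfV; have x0 : 0 < `|x| by rewrite normr_gt0 s0.
  have : 1 / d < `|x| by rewrite real_ltNge ?ger0_real // divr_ge0 // ltW.
  by rewrite ltr_pdivrMr // -[`|x|^-1]mul1r ltr_pdivrMr // mulrC.
rewrite big_const_seq count_predT iter_addr_0 -(mulr_natr (eps / N.+1%:R)).
have szb : (size bg < N.+1)%N.
  by apply: leq_ltn_trans szs; rewrite size_filter count_size.
by rewrite mulrAC ltr_pdivrMr // ltr_pM2l // ltr_nat.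
Qed.
(** By continuity of polynomials, [Theta_closure] makes the effective classes Zariski dense in the
    zeros of [Theta]; [reduced_equation] applies with them as [W]. *)
Lemma theta_proportional (S : mpoly g F) :
  (forall a b, S = a ^+ 2 * b -> a \is a GRing.unit) ->
  (forall z, ev z S = 0 <->
     forall p, (forall w, effective g.-1 w -> ev w p = 0) -> ev z p = 0) ->
  exists2 c, c != 0 & S = mpoly.mpolyC g c * Theta.
Proof.
move=> Sred Szero.
have closure p : (forall w, effective g.-1 w -> ev w p = 0) ->
    forall z, ev z Theta = 0 -> ev z p = 0.
  move=> pW z /Theta_closure zW; apply/eqP; apply: contraT => nz.
  have nz0 : 0 < `|ev z p| by rewrite normr_gt0.
  have [d d0 pd] := ev_continuous p z nz0.
  have [w ew wd] := zW d d0; have := pd w wd.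
  by rewrite pW // sub0r normrN ltxx.
apply: (reduced_equation (W := effective g.-1)) => //.
- exact: Theta_effective.
- exact: effective_irreducible.
- exact: Theta_smooth_point.
move=> z; split=> [/Szero zS|Tz].
  exact/zS/Theta_effective.
by apply/Szero => p pW; apply: closure.
Qed.

(** * Restriction to the variables [x], [y], [t] *)

Section Restriction.
Variables (dd : 'I_3 -> 'I_g -> F).

Definition linear_forms : g.-tuple (mpoly 3 F) :=
  [tuple dd var_x j *: mX var_x + dd var_y j *: mX var_y + dd var_t j *: mX var_t | j < g].

Local Notation restr := (mpoly.comp_mpoly linear_forms).

Lemma mderiv_restr i p : mpoly.mderiv i (restr p) = restr (dird (dd i) p).
Proof.
rewrite /mpoly.comp_mpoly (mmap_chain_rule _ _ (mderiv_derivation F i)); last first.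
  by move=> c; rewrite mpoly.mderivC.
rewrite raddf_sum; apply: eq_bigr => j _ /=; rewrite mpoly.mmapZ; congr (_ * _).
rewrite tnth_mktuple !mpoly.mderivD !mpoly.mderivZ !mpoly.mderivX !mpoly.mnm1E.
have m1 (k : 'I_3) : mpoly.mpolyX F (mpoly.mnm_sub (mpoly.mnm1 k) (mpoly.mnm1 k)) = 1.
  rewrite -mpoly.mpolyX0; congr mpoly.mpolyX.
  by apply/mpoly.mnmP => k'; rewrite mpoly.mnmBE mpoly.mnm0E subnn.
case: i => -[|[|[|//]]] lt; rewrite -!val_eqE /= !scale0r !scale1r !scaler0 ?add0r ?addr0.
- by rewrite (_ : Ordinal lt = var_x) ?m1 -?mpoly.mul_mpolyC ?mulr1 //; apply: val_inj.
- by rewrite (_ : Ordinal lt = var_y) ?m1 -?mpoly.mul_mpolyC ?mulr1 //; apply: val_inj.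
by rewrite (_ : Ordinal lt = var_t) ?m1 -?mpoly.mul_mpolyC ?mulr1 //; apply: val_inj.
Qed.

Lemma ev_restr0 p : ev (fun=> 0) (restr p) = ev (fun=> 0) p.
Proof.
rewrite mpoly.comp_mpoly_meval; apply: mpoly.meval_eq => j.
by rewrite tnth_mktuple !mpoly.mevalD !mpoly.mevalZ !mpoly.mevalXU !mulr0 !addr0.
Qed.

Lemma restrC c : restr (mpoly.mpolyC g c) = mpoly.mpolyC 3 c.
Proof. exact: mpoly.comp_mpolyC. Qed.

Lemma restrM p r : restr (p * r) = restr p * restr r.
Proof. exact: rmorphM. Qed.

Local Notation tofrac := (@FracField.tofrac (mpoly 3 F)).
Local Notation K := (ratfun3 F).

Definition fentry (j : 'I_g) (k : nat) : K := tofrac (restr (entry j k)).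

Lemma partial_tofrac i p : partial i (tofrac p) = tofrac (mpoly.mderiv i p).
Proof. exact: (fracder_tofrac (mderiv_derivation F i)). Qed.

Lemma partial_derivation i : derivation (@partial F i).
Proof. exact: (fracderP (mderiv_derivation F i)). Qed.

Lemma partial_cst i c : partial i (tofrac (mpoly.mpolyC 3 c)) = 0.
Proof. by rewrite partial_tofrac mpoly.mderivC tofrac0. Qed.

Lemma fentry_flow i h : (forall j, dd i j = l j (v ^+ h)) ->
  exists2 S : 'M[K]_g, is_flow fentry (partial i) h S & partial i (\tr S) = 0.
Proof.
move=> ddE; pose a := v ^+ h - xi (dd i).
have aa : ann a by move=> j; rewrite lD lN l_xi ddE subrr.
exists (\matrix_(j, k) tofrac (mpoly.mpolyC 3 (l j (a * eta k)))); last first.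
  rewrite (der_sum (partial_derivation i)) big1 // => j _.
  by rewrite mxE partial_cst.
move=> j k; rewrite /fentry partial_tofrac mderiv_restr.
rewrite (entry_flow j k (esym (subrK (xi (dd i)) (v ^+ h))) aa).
rewrite raddfB /= tofracB; congr (_ - _).
rewrite (raddf_sum (mpoly.comp_mpoly linear_forms)) (raddf_sum tofrac).
apply: eq_bigr => k' _ /=; rewrite restrM restrC.
by rewrite tofracM mxE.
Qed.

(** At [x = y = t = 0] the entries are [l j (v ^+ k)]. As the powers of [v] span [B], constant
    combinations of the rows form the identity matrix there, so their determinant is not the zero
    polynomial. *)
Lemma fentry_rank : \rank (rowblock fentry m) = g.
Proof.
have /choice[p pP] j := v_gen (eta j).
pose A : 'M[mpoly 3 F]_g :=
  \matrix_(j, j') \sum_(k < m) mpoly.mpolyC 3 (p j)`_k * restr (entry j' k).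
have A1 : map_mx (ev (fun=> 0)) A = 1%:M.
  apply/matrixP => j j'; rewrite !mxE raddf_sum /=.
  transitivity (l j' (eta j)); last by rewrite eta_dual eq_sym.
  have [sp ->] := pP j; rewrite (pbE sp) l_sum; apply: eq_bigr => k _.
  rewrite mpoly.mevalM mpoly.mevalC ev_restr0 ev_entry E0 mulr1 lZ //.
have detA : \det A != 0.
  apply/eqP => /(congr1 (ev (fun=> 0))); rewrite -det_map_mx A1 det1 mpoly.meval0.
  by move/eqP; rewrite oner_eq0.
apply/eqP; rewrite eqn_leq rank_leq_col /=.
pose C : 'M[K]_(g, m) := \matrix_(j, k) tofrac (mpoly.mpolyC 3 (p j)`_k).
have CX : C *m rowblock fentry m = map_mx tofrac A.
  apply/matrixP => j j'; rewrite !mxE (raddf_sum tofrac); apply: eq_bigr => k _.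
  by rewrite !mxE /= tofracM.
have : C *m rowblock fentry m \in unitmx.
  by rewrite CX unitmxE det_map_mx unitfE tofrac_eq0.
by move/mxrank_unit => {1}<-; apply: mxrankM_maxr.
Qed.

Lemma det_fentry : \det (colblock fentry g 0) = tofrac (restr Theta).
Proof.
rewrite /Theta -!det_map_mx; congr (\det _); apply/matrixP => j k.
by rewrite !mxE addn0.
Qed.

Lemma theta_KP (S : mpoly g F) :
  (forall a b, S = a ^+ 2 * b -> a \is a GRing.unit) ->
  (forall z, ev z S = 0 <->
     forall p, (forall w, effective g.-1 w -> ev w p = 0) -> ev z p = 0) ->
  (forall j, [/\ dd var_x j = l j v, dd var_y j = l j (v ^+ 2) &
     dd var_t j = l j (v ^+ 3)]) ->
  let T := tofrac (restr S) in T != 0 /\ KP_solution (2%:R * dxx_log T).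
Proof.
move=> Sred Szero ddE T.
have [c c0 SE] := theta_proportional Sred Szero.
have [S1 fl1 trS1] : exists2 S : 'M[K]_g, is_flow fentry (partial var_x) 1 S &
    partial var_x (\tr S) = 0.
  by apply: fentry_flow => j; have [-> _ _] := ddE j; rewrite expr1.
have [S2 fl2 _] : exists2 S : 'M[K]_g, is_flow fentry (partial var_y) 2 S &
    partial var_y (\tr S) = 0.
  by apply: fentry_flow => j; have [_ -> _] := ddE j.
have [S3 fl3 _] : exists2 S : 'M[K]_g, is_flow fentry (partial var_t) 3 S &
    partial var_t (\tr S) = 0.
  by apply: fentry_flow => j; have [_ _ ->] := ddE j.
have M0u := flow_rank (partial_derivation var_x) fl1 fentry_rank.
pose tau := \det (colblock fentry g 0).
have tau0 : tau != 0 by rewrite -unitfE -unitmxE.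
pose cK := tofrac (mpoly.mpolyC 3 c).
have cK0 : cK != 0 by rewrite tofrac_eq0 mpoly.mpolyC_eq0.
have TE : T = cK * tau.
  by rewrite /T SE restrM restrC tofracM /tau det_fentry.
split; first by rewrite TE; exact: mulf_neq0 cK0 tau0.
have -> : 2%:R * dxx_log T =
    2%:R * partial var_x (partial var_x tau / tau).
  rewrite /dxx_log TE (derM (partial_derivation var_x) cK) /cK partial_cst mul0r add0r.
  by rewrite -mulf_div divff // mul1r.
exact: (flow_KP (partial_derivation var_x) (partial_derivation var_y)
  (partial_derivation var_t) fl1 fl2 fl3 M0u g_gt0 trS1).
Qed.

End Restriction.
(** Invert [1 - u v = loc w * (1 - x)] by the geometric series of the nilpotent [x]. The semisimple
    part of [v / (1 - u v)] lies in [ann], and the terms in [e i * rho ^+ m.+1] remain. *)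
Lemma omegaE u j : good u -> omega u j = \sum_i \sum_(m < n.-1)
  (u / (1 - u * q i)) ^+ m / (1 - u * q i) ^+ 2 * l j (e i * rho ^+ m.+1).
Proof.
move=> gu; pose w i := 1 - u * q i.
pose x := loc (fun i => u / w i) * rho; pose S := \sum_(m < n) x ^+ m.
have xS : (1 - x) * S = 1.
  have := subrX1 x n; rewrite -/S /x exprMn rho_nil mulr0 sub0r -/x => h.
  by apply: oppr_inj; rewrite h -mulNr opprB.
have locB c d : loc c - loc d = loc (fun i => c i - d i).
  by rewrite /loc -sumrB; apply: eq_bigr => i _; rewrite scalerBl.
have uvE : 1 - u *: v = loc w * (1 - x).
  rewrite mulrBr mulr1 /x mulrA locM.
  have -> : (fun i => w i * (u / w i)) = fun=> u.
    by apply/funext => i; rewrite mulrCA mulfV ?mulr1 //; apply: gu.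
  rewrite locC -scalerAl mul1r scalerDr opprD addrA; congr (_ - _).
  rewrite -[1]scale1r -locC /loc scaler_sumr -sumrB; apply: eq_bigr => i _.
  by rewrite scalerA -scalerBl.
have vE : v = (1 - u *: v) *
    (loc (fun i => q i / w i) + loc (fun i => (w i)^-1 ^+ 2) * rho * S).
  rewrite uvE mulrDr -!mulrA [(1 - x) * (_ * _)]mulrCA [(1 - x) * (rho * _)]mulrCA xS mulr1.
  rewrite [(1 - x) * _]mulrC !mulrA !locM mulrBr mulr1 /x mulrA locM.
  rewrite -addrA; congr (_ + _).
    by congr loc; apply/funext => i; rewrite mulrCA mulfV ?mulr1 //; apply: gu.
  rewrite addrC -mulrBl locB -[LHS]mul1r; congr (_ * _).
  rewrite -[LHS]scale1r -locC; congr loc; apply/funext => i.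
  have := gu i; rewrite -/(w i) => wi.
  have -> : w i * (w i)^-1 ^+ 2 = (w i)^-1 by rewrite expr2 mulVKf.
  rewrite [w i * (q i / _)]mulrCA mulfV // mulr1 mulrA -[X in X - _]mul1r -mulrBl [q i * u]mulrC mulfV //.
rewrite /omega {1}vE mulrC mulKr ?one_sub_uv_unit // lD ann_loc add0r.
rewrite /S mulr_sumr l_sum -(prednK n_gt0) big_ord_recr /=.
rewrite (_ : l j _ = 0) ?addr0; last first.
  rewrite /x exprMn -mulrA [rho * _]mulrCA -exprS prednK // rho_nil !mulr0.
  by rewrite l0.
rewrite exchange_big /=; apply: eq_bigr => k _.
rewrite /x exprMn -mulrA [rho * _]mulrCA -exprS mulrA locX locM.
rewrite /loc mulr_suml l_sum; apply: eq_bigr => i _.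
by rewrite -scalerAl lZ -exprVn [_ ^+ 2 * _]mulrC.
Qed.
End LocalAlgebra.

(** * Integrals along paths in the complex plane *)

Section ComplexPaths.
Import numFieldNormedType.Exports.
Variable R : realType.
Implicit Types (h k : R -> R[i]) (s : R).

Lemma ReD (x y : R[i]) : complex.Re (x + y) = complex.Re x + complex.Re y.
Proof. by case: x y => [a b] [c d]. Qed.

Lemma ImD (x y : R[i]) : complex.Im (x + y) = complex.Im x + complex.Im y.
Proof. by case: x y => [a b] [c d]. Qed.

Lemma ReN (x : R[i]) : complex.Re (- x) = - complex.Re x.
Proof. by case: x. Qed.

Lemma ImN (x : R[i]) : complex.Im (- x) = - complex.Im x.
Proof. by case: x. Qed.

Lemma ReM (x y : R[i]) :
  complex.Re (x * y) = complex.Re x * complex.Re y - complex.Im x * complex.Im y.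
Proof. by case: x y => [a b] [c d]. Qed.

Lemma ImM (x y : R[i]) :
  complex.Im (x * y) = complex.Re x * complex.Im y + complex.Im x * complex.Re y.
Proof. by case: x y => [a b] [c d]. Qed.

Lemma ReV (x : R[i]) :
  complex.Re x^-1 = complex.Re x * (complex.Re x ^+ 2 + complex.Im x ^+ 2)^-1.
Proof. by case: x. Qed.

Lemma ImV (x : R[i]) :
  complex.Im x^-1 = - (complex.Im x * (complex.Re x ^+ 2 + complex.Im x ^+ 2)^-1).
Proof. by case: x. Qed.

Lemma sqr_modulus_neq0 (x : R[i]) : x != 0 ->
  complex.Re x ^+ 2 + complex.Im x ^+ 2 != 0.
Proof.
by case: x => a b; rewrite eq_complex /= paddr_eq0 ?sqr_ge0 // !sqrf_eq0.
Qed.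

Definition path_deriv h s (d : R[i]) : Prop :=
  is_derive s 1 (fun s => complex.Re (h s)) (complex.Re d) /\
  is_derive s 1 (fun s => complex.Im (h s)) (complex.Im d).

Definition path_cont h s : Prop :=
  (complex.Re (h t) @[t --> s] --> complex.Re (h s))%classic /\
  (complex.Im (h t) @[t --> s] --> complex.Im (h s))%classic.

Lemma path_cont_cst c s : path_cont (fun=> c) s.
Proof. by split; apply: cvg_cst. Qed.

Lemma path_contD h k s : path_cont h s -> path_cont k s ->
  path_cont (fun s => h s + k s) s.
Proof.
move=> [h1 h2] [k1 k2]; split.
  by under eq_fun do rewrite ReD; rewrite ReD; apply: cvgD.
by under eq_fun do rewrite ImD; rewrite ImD; apply: cvgD.
Qed.

Lemma path_contM h k s : path_cont h s -> path_cont k s ->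
  path_cont (fun s => h s * k s) s.
Proof.
move=> [h1 h2] [k1 k2]; split.
  under eq_fun do rewrite ReM.
  by rewrite ReM; apply: cvgB; apply: cvgM.
under eq_fun do rewrite ImM.
by rewrite ImM; apply: cvgD; apply: cvgM.
Qed.

Lemma path_contX h s n : path_cont h s -> path_cont (fun s => h s ^+ n) s.
Proof.
move=> ch; elim: n => [|n IH]; first exact: path_cont_cst.
by under eq_fun do rewrite exprS; apply: path_contM.
Qed.

Lemma path_contV h s : h s != 0 -> path_cont h s -> path_cont (fun s => (h s)^-1) s.
Proof.
move=> h0 [h1 h2].
have ci : ((complex.Re (h t) ^+ 2 + complex.Im (h t) ^+ 2)^-1 @[t --> s] -->
    (complex.Re (h s) ^+ 2 + complex.Im (h s) ^+ 2)^-1)%classic.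
  by apply: cvgV (sqr_modulus_neq0 h0) _; apply: cvgD; apply: cvgM.
split.
  by under eq_fun do rewrite ReV; rewrite ReV; apply: cvgM.
by under eq_fun do rewrite ImV; rewrite ImV; apply: cvgN; apply: cvgM.
Qed.

Lemma path_cont_sum (J : Type) (r : seq J) (h : J -> R -> R[i]) s :
  (forall i, path_cont (h i) s) -> path_cont (fun s => \sum_(i <- r) h i s) s.
Proof.
move=> ch; elim: r => [|i r IH].
  by under eq_fun do rewrite big_nil; apply: path_cont_cst.
by under eq_fun do rewrite big_cons; apply: path_contD.
Qed.

Lemma path_deriv_cont h s d : path_deriv h s d -> path_cont h s.
Proof.
case=> [[d1 _] [d2 _]]; split.
  exact: (differentiable_continuous (proj1 (derivable1_diffP _ _) d1)).
exact: (differentiable_continuous (proj1 (derivable1_diffP _ _) d2)).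
Qed.

Lemma path_deriv_cst c s : path_deriv (fun=> c) s 0.
Proof. by split; apply: is_derive_cst. Qed.

Lemma path_derivD h k s d e : path_deriv h s d -> path_deriv k s e ->
  path_deriv (fun s => h s + k s) s (d + e).
Proof.
move=> [h1 h2] [k1 k2]; split.
  by under eq_fun do rewrite ReD; rewrite ReD; apply: is_deriveD.
by under eq_fun do rewrite ImD; rewrite ImD; apply: is_deriveD.
Qed.

Lemma path_derivM h k s d e : path_deriv h s d -> path_deriv k s e ->
  path_deriv (fun s => h s * k s) s (d * k s + h s * e).
Proof.
move=> [h1 h2] [k1 k2]; split.
  under eq_fun do rewrite ReM.
  apply: (is_derive_eq (is_deriveB (is_deriveM h1 k1) (is_deriveM h2 k2))).
  rewrite /GRing.scale /=.
  by case: d e (h s) (k s) {h1 h2 k1 k2} => [? ?] [? ?] [? ?] [? ?] /=; ring.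
under eq_fun do rewrite ImM.
apply: (is_derive_eq (is_deriveD (is_deriveM h1 k2) (is_deriveM h2 k1))).
rewrite /GRing.scale /=.
by case: d e (h s) (k s) {h1 h2 k1 k2} => [? ?] [? ?] [? ?] [? ?] /=; ring.
Qed.

Lemma path_derivX h s d n : path_deriv h s d ->
  path_deriv (fun s => h s ^+ n.+1) s (n.+1%:R * h s ^+ n * d).
Proof.
move=> dh; elim: n => [|n IH].
  by rewrite mulr1 mul1r; under eq_fun do rewrite expr1.
have := path_derivM dh IH; under eq_fun do rewrite -exprS.
by congr path_deriv; rewrite [n.+2%:R]mulrS exprS; ring.
Qed.

Lemma path_deriv_sum (J : Type) (r : seq J) (h : J -> R -> R[i]) d s :
  (forall i, path_deriv (h i) s (d i)) ->
  path_deriv (fun s => \sum_(i <- r) h i s) s (\sum_(i <- r) d i).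
Proof.
move=> dh; elim: r => [|i r IH].
  by under eq_fun do rewrite big_nil; rewrite big_nil; apply: path_deriv_cst.
by under eq_fun do rewrite big_cons; rewrite big_cons; apply: path_derivD.
Qed.

Lemma path_derivV h s d : h s != 0 -> path_deriv h s d ->
  path_deriv (fun s => (h s)^-1) s (- d / h s ^+ 2).
Proof.
move=> h0 [h1 h2].
have m0 := sqr_modulus_neq0 h0.
pose m t := complex.Re (h t) ^+ 2 + complex.Im (h t) ^+ 2.
have dm : is_derive s 1 m (2 * complex.Re (h s) * complex.Re d
    + 2 * complex.Im (h s) * complex.Im d).
  apply: (is_derive_eq (is_deriveD (is_deriveM h1 h1) (is_deriveM h2 h2))).
  by rewrite /GRing.scale /=; ring.
have di := @is_deriveV _ m s _ 1 m0 dm.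
have dE : - d / h s ^+ 2 = - d * ((h s)^-1 * (h s)^-1) by rewrite -invfM.
rewrite dE; split.
  under eq_fun do rewrite ReV.
  apply: (is_derive_eq (is_deriveM h1 di)).
  rewrite ReM ImM ReM ImN ReN ReV ImV /GRing.scale /= /m.
  by field.
under eq_fun do rewrite ImV.
apply: (is_derive_eq (is_deriveN (is_deriveM h2 di))).
rewrite ImM ImM ReM ImN ReN ReV ImV /GRing.scale /= /m.
by field.
Qed.

Lemma real_FTC (f F : R -> R) :
  (forall s, 0 <= s <= 1 -> is_derive s 1 F (f s)) ->
  (forall s, 0 <= s <= 1 -> f t @[t --> s] --> f s)%classic ->
  Rintegral lebesgue_measure `[0%R, 1%R] f = F 1 - F 0.
Proof.
move=> dF cf.
have cF s : 0 <= s <= 1 -> (F t @[t --> s] --> F s)%classic.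
  move=> s01; have [dFs _] := dF s s01.
  by apply/differentiable_continuous/derivable1_diffP.
rewrite /Rintegral (@continuous_FTC2 _ f F) //.
- apply: continuous_in_subspaceT => s; rewrite inE /= in_itv /= => s01.
  exact: cf.
- split.
  + move=> s; rewrite in_itv /= => /andP[s0 s1].
    by have [|] := dF s; rewrite ?(ltW s0) ?(ltW s1).
  + by apply: cvg_at_right_filter; apply: cF; rewrite lexx ler01.
  + by apply: cvg_at_left_filter; apply: cF; rewrite lexx ler01.
move=> s; rewrite in_itv /= => /andP[s0 s1].
by have [|_ <-] := dF s; rewrite ?(ltW s0) ?(ltW s1) ?derive1E.
Qed.

(** The fundamental theorem of calculus on real and imaginary parts. [phi] is compared with the
    explicit, continuous [G] on the path only, because [coef_u] is known in closed form only at
    smooth points. *)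
Lemma path_integral_FTC (H p : R -> R[i]) (phi G : R[i] -> R[i]) : C1_path p ->
  (forall s, 0 <= s <= 1 -> phi (p s) = G (p s)) ->
  (forall s d, 0 <= s <= 1 -> path_deriv p s d -> path_deriv H s (G (p s) * d)) ->
  (forall s, 0 <= s <= 1 -> path_cont p s -> path_cont (fun t => G (p t)) s) ->
  path_integral p phi = H 1 - H 0.
Proof.
move=> [dx dy cx cy] phiG dH cG.
pose dp t := Complex (derive1 (fun s => complex.Re (p s)) t)
  (derive1 (fun s => complex.Im (p s)) t).
have dpP s : path_deriv p s (dp s).
  by split => /=; rewrite derive1E; apply/derivableP.
have cf s : 0 <= s <= 1 -> path_cont (fun t => G (p t) * dp t) s.
  move=> s01; apply: path_contM; first exact: cG (path_deriv_cont (dpP s)).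
  by split; [exact: cx|exact: cy].
have df s s01 := dH s _ s01 (dpP s).
have eI (f f' : R -> R) : (forall s, 0 <= s <= 1 -> f s = f' s) ->
    Rintegral lebesgue_measure `[0%R, 1%R] f = Rintegral lebesgue_measure `[0%R, 1%R] f'.
  by move=> ff'; apply: eq_Rintegral => s; rewrite inE /= in_itv /=; apply: ff'.
rewrite /path_integral -/dp.
rewrite (eI _ (fun s => complex.Re (G (p s) * dp s))) => [|s s01]; last by rewrite phiG.
rewrite [X in Complex _ X](eI _ (fun s => complex.Im (G (p s) * dp s))); last first.
  by move=> s s01; rewrite phiG.
rewrite (real_FTC (fun s s01 => proj1 (df s s01)) (fun s s01 => proj1 (cf s s01))).
rewrite (real_FTC (fun s s01 => proj2 (df s s01)) (fun s s01 => proj2 (cf s s01))).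
by case: (H 1) (H 0) => [a b] [c d].
Qed.

Lemma path_deriv_real s : path_deriv (fun t => Complex t 0) s 1.
Proof. by split; [exact: is_derive_id|exact: is_derive_cst]. Qed.

Lemma path_deriv_C1 p dp : (forall s, path_deriv p s (dp s)) ->
  (forall s, path_cont dp s) -> C1_path p.
Proof.
move=> pd cd.
have ReE : derive1 (fun s => complex.Re (p s)) = fun s => complex.Re (dp s).
  by apply/funext => s; have [[_ <-] _] := pd s; rewrite derive1E.
have ImE : derive1 (fun s => complex.Im (p s)) = fun s => complex.Im (dp s).
  by apply/funext => s; have [_ [_ <-]] := pd s; rewrite derive1E.
split; rewrite ?ReE ?ImE => s.
- by have [[]] := pd s.
- by have [_ []] := pd s.
- by have [] := cd s.
by have [] := cd s.
Qed.

(* A parabolic arc from 0 to [u]; each point to be avoided lies on at most one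
   of the arcs obtained by varying the coefficient [c]. *)
Lemma path_avoiding (u : R[i]) (qs : seq R[i]) :
  (forall q, q \in qs -> 1 - u * q != 0) ->
  exists p, [/\ C1_path p, p 0 = 0, p 1 = u &
    forall s q, q \in qs -> 1 - p s * q != 0].
Proof.
move=> gu.
(* [p s * q = 1] means [arc s = (u q)^-1]; as [arc s = s + i c s (1 - s)], this determines [s] and
   then [c = bad q]. The chosen [c] exceeds every [|bad q|]. *)
pose bad q := complex.Im (u * q)^-1 /
  (complex.Re (u * q)^-1 * (1 - complex.Re (u * q)^-1)).
pose c : R := 1 + \sum_(q <- qs) `|bad q|.
pose arc (s : R) : R[i] := Complex s 0 + Complex 0 c * (Complex s 0 * (1 - Complex s 0)).
pose p s := u * arc s.
have arcE s : arc s = Complex s (c * (s * (1 - s))).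
  by rewrite /arc; congr Complex; ring.
have dS s := path_deriv_real s.
have d1 s : path_deriv (fun t => 1 + Complex (-1) 0 * Complex t 0) s
    (0 + (0 * Complex s 0 + Complex (-1) 0 * 1)).
  by apply: path_derivD (path_deriv_cst _ _) (path_derivM (path_deriv_cst _ _) _).
have pE : p = fun s => u * (Complex s 0 + Complex 0 c * (Complex s 0 *
    (1 + Complex (-1) 0 * Complex s 0))).
  apply/funext => s; rewrite /p /arc; congr (_ * (_ + _ * (_ * (_ + _)))).
  by apply/eqP; rewrite eq_complex /=; apply/andP; split; apply/eqP; ring.
have dp s := path_derivM (path_deriv_cst u s) (path_derivD (dS s)
  (path_derivM (path_deriv_cst (Complex 0 c) s) (path_derivM (dS s) (d1 s)))).
exists p; split.
- rewrite pE; apply: (path_deriv_C1 dp) => s.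
  have cS : path_cont (fun t => Complex t 0) s := path_deriv_cont (dS s).
  have cc z : path_cont (fun=> z) s := path_cont_cst z s.
  apply: path_contD.
    apply: (path_contM (cc 0) _); apply: (path_contD cS _).
    apply: (path_contM (cc _) _); apply: (path_contM cS _).
    by apply: (path_contD (cc 1) _); apply: (path_contM (cc _) cS).
  apply: (path_contM (cc u) _); apply: (path_contD (cc 1) _); apply: path_contD.
    apply: (path_contM (cc 0) _); apply: (path_contM cS _).
    by apply: (path_contD (cc 1) _); apply: (path_contM (cc _) cS).
  apply: (path_contM (cc _) _); apply: path_contD.
    by apply: (path_contM (cc 1) _); apply: (path_contD (cc 1) _); apply: (path_contM (cc _) cS).
  apply: (path_contM cS _); apply: (path_contD (cc 0) _); apply: path_contD.
    exact: path_contM (cc 0) cS.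
  exact: path_contM (cc _) (cc 1).
- by rewrite /p arcE mul0r mulr0 (_ : Complex 0 0 = 0) ?mulr0.
- by rewrite /p arcE subrr !mulr0 (_ : Complex 1 0 = 1) ?mulr1.
move=> s q qqs; apply/eqP => /eqP; rewrite subr_eq0 => /eqP pq.
have uq1 : 1 - u * q != 0 := gu q qqs.
have uq0 : u * q != 0.
  apply/eqP => uq0; move: pq; rewrite /p mulrAC uq0 mul0r => /eqP.
  by rewrite oner_eq0.
have arcV : (u * q)^-1 = Complex s (c * (s * (1 - s))).
  by rewrite -arcE; apply: (mulfI uq0); rewrite mulfV // pq /p mulrAC.
have badE : bad q = c * (s * (1 - s)) / (s * (1 - s)) by rewrite /bad arcV.
(* The ends of the arc are harmless: [arc 0 = 0] is not an inverse, and [arc 1 = 1] would mean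
   [u q = 1]. *)
have ss : s * (1 - s) != 0.
  apply/eqP => /eqP; rewrite mulf_eq0 => /orP[]/eqP s0.
    by move: (invr_neq0 uq0); rewrite arcV s0 mul0r mulr0 eqxx.
  have s1 : s = 1 by apply/esym/eqP; rewrite -subr_eq0 s0.
  move/eqP: uq1; apply; apply/eqP; rewrite subr_eq0.
  by rewrite -[u * q]invrK arcV s1 subrr !mulr0 (_ : Complex 1 0 = 1) ?invr1.
have : `|bad q| < c.
  rewrite /c (big_rem q) //= addrA ltr_wpDr ?sumr_ge0 //.
  by rewrite ltrDr.
rewrite badE mulfK // => h; have := le_lt_trans (ler_norm c) h.
by rewrite ltxx.
Qed.

Lemma path_deriv_moebius p s d q c m : 1 - p s * q != 0 -> path_deriv p s d ->
  path_deriv (fun t => m.+1%:R^-1 * (p t / (1 - p t * q)) ^+ m.+1 * c) s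
    ((p s / (1 - p s * q)) ^+ m / (1 - p s * q) ^+ 2 * c * d).
Proof.
move=> g0 dp.
have dg : path_deriv (fun t => 1 - p t * q) s (- (d * q)).
  have : path_deriv (fun t => 1 + (-1) * (p t * q)) s
      (0 + (0 * (p s * q) + (-1) * (d * q + p s * 0))).
    apply: path_derivD (path_deriv_cst _ _) _.
    apply: path_derivM (path_deriv_cst _ _) _.
    exact: path_derivM dp (path_deriv_cst _ _).
  under eq_fun do rewrite mulN1r.
  by congr path_deriv; ring.
have dm := path_derivM dp (path_derivV g0 dg).
have dX := path_derivM (path_derivM (path_deriv_cst m.+1%:R^-1 s)
  (path_derivX m dm)) (path_deriv_cst c s).
have : path_deriv (fun t => m.+1%:R^-1 * (p t / (1 - p t * q)) ^+ m.+1 * c) s _ := dX.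
congr path_deriv; have m0 : (m.+1%:R : R[i]) != 0 by rewrite pnatr_eq0.
move: (m.+1%:R : R[i]) m0 (_ ^+ m) => N N0 y; move: (p s) g0 => x g0 {dp dg dm dX}.
by field; rewrite N0 g0.
Qed.

Lemma path_cont_moebius p s q c m : 1 - p s * q != 0 -> path_cont p s ->
  path_cont (fun t => (p t / (1 - p t * q)) ^+ m / (1 - p t * q) ^+ 2 * c) s.
Proof.
move=> g0 cp.
have cg : path_cont (fun t => 1 - p t * q) s.
  have : path_cont (fun t => 1 + p t * (- q)) s.
    apply: path_contD; first exact: path_cont_cst.
    by apply: path_contM => //; exact: path_cont_cst.
  by under eq_fun do rewrite mulrN.
apply: path_contM (path_cont_cst _ _); apply: path_contM.
  by apply: path_contX; apply: path_contM => //; apply: path_contV.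
by apply: path_contV; [rewrite expf_neq0|apply: path_contX].
Qed.

End ComplexPaths.

(** * The image of the Abel map *)

Section AbelImage.
Variables (R : realType) (B : comUnitAlgType R[i]) (I : finType).
Variables (q : I -> R[i]) (e : I -> B) (rho : B) (n g : nat) (l : 'I_g -> B -> R[i]).

Local Notation good := (good q).
Local Notation abel := (abel q e rho n l).

Variables (C : unibranch_rational_curve R[i]) (w : 'I_g -> ratfun R[i]).
Hypothesis smoothP : forall u, smooth_point C (point_u u) <-> good u.
Hypothesis coefE : forall u j, good u -> coef_u (w j) u = \sum_i \sum_(m < n.-1)
  (u / (1 - u * q i)) ^+ m / (1 - u * q i) ^+ 2 * l j (e i * rho ^+ m.+1).

Lemma path_integral_coef (p : R -> R[i]) j : C1_path p ->
  (forall s, 0 <= s <= 1 -> good (p s)) ->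
  path_integral p (coef_u (w j)) = abel (p 1) j - abel (p 0) j.
Proof.
move=> p1 gp; pose G u := \sum_i \sum_(m < n.-1)
  (u / (1 - u * q i)) ^+ m / (1 - u * q i) ^+ 2 * l j (e i * rho ^+ m.+1).
apply: (path_integral_FTC (H := fun s => abel (p s) j) (G := G) p1).
- by move=> s s01; rewrite coefE //; exact: gp.
- move=> s d s01 dp; rewrite mulr_suml; apply: path_deriv_sum => i.
  rewrite mulr_suml; apply: path_deriv_sum => m.
  by apply: path_deriv_moebius dp; apply: gp.
move=> s s01 cp; apply: path_cont_sum => i; apply: path_cont_sum => m.
by apply: path_cont_moebius cp; apply: gp.
Qed.

(** The integrals depend on the endpoints only, through the primitive [abel], and [path_avoiding]
    joins the base point to every smooth point. *)
Lemma abel_image_effective : abel_image C w = effective q e rho n l g.-1.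
Proof.
apply/seteqP; split=> z /=.
  move=> [P [p [sp zE]]]; exists (fun k => p k 1); split=> [k|].
    by apply/smoothP; have [_ _ _ h] := sp k; apply: h; rewrite ler01 lexx.
  apply/funext => j; rewrite zE; apply: eq_bigr => k _.
  have [cp p0 _ sm] := sp k; rewrite path_integral_coef // ?p0 ?abel0 ?subr0 //.
  by move=> s s01; apply/smoothP/sm.
move=> [u [gu ->]].
have /choice[p pP] k : exists p, [/\ C1_path p, p 0 = 0, p 1 = u k &
    forall s x, x \in [seq q i | i : I] -> 1 - p s * x != 0].
  by apply: (@path_avoiding R (u k) [seq q i | i : I]) => x /fintype.imageP[i _ ->]; apply: gu.
have gp k s : good (p k s).
  by move=> i; case: (pP k) => _ _ _ /(_ s (q i)); apply; apply: fintype.image_f.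
exists (fun k => point_u (u k)), p; split=> [k|j].
  have [cp p0 p1 _] := pP k; split=> //; first by rewrite p1.
  by move=> s _; exact: (proj2 (smoothP _) (gp k s)).
apply: eq_bigr => k _; have [cp p0 p1 _] := pP k.
by rewrite path_integral_coef // p0 p1 abel0 subr0.
Qed.

End AbelImage.

(** * Local rings and residues on the projective line *)

Section Residues.
Variable F : fieldType.
Local Notation tofrac := (@FracField.tofrac {poly F}).
Local Notation cst := (@Defs.cst F).
Local Notation coord := (@Defs.coord F).
Implicit Types (P : P1 F) (h k : ratfun F) (p q : {poly F}).

Lemma cstD (a b : F) : cst (a + b) = cst a + cst b.
Proof. by rewrite /Defs.cst polyCD tofracD. Qed.

Lemma cstN (a : F) : cst (- a) = - cst a.
Proof. by rewrite /Defs.cst polyCN tofracN. Qed.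

Lemma cst0 : cst (0 : F) = 0. Proof. exact: tofrac0. Qed.

Lemma cst1 : cst (1 : F) = 1. Proof. exact: tofrac1. Qed.

Lemma unif_Some a : unif (Some a) = tofrac ('X - a%:P).
Proof. by rewrite /unif /Defs.coord /Defs.cst -tofracB. Qed.

Lemma unif_neq0 P : unif P != 0.
Proof.
case: P => [a|]; first by rewrite unif_Some tofrac_eq0 polyXsubC_eq0.
by rewrite invr_eq0 tofrac_eq0 polyX_eq0.
Qed.

Lemma local_coef_Some a h : local_coef (Some a) h = h.
Proof.
rewrite /local_coef unif_Some fracder_tofrac; last exact: deriv_derivation.
by rewrite derivXsubC tofrac1 divr1.
Qed.

Lemma local_coef_None h : local_coef None h = - (coord ^+ 2 * h).
Proof.
have X0 : 'X != 0 :> {poly F} by rewrite polyX_eq0.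
have XF0 : coord != 0 :> ratfun F by rewrite tofrac_eq0.
rewrite /local_coef /unif -[coord^-1]mul1r -(tofrac1 {poly F}).
rewrite (fracderE (deriv_derivation F) 1 X0) derivX derivC mul0r mulr1 sub0r.
rewrite tofracN tofrac1 mulN1r invrN invrK mulrN mulrC; congr (- (_ * _)).
Qed.

Lemma local_coefM P f h : local_coef P (f * h) = f * local_coef P h.
Proof. by rewrite /local_coef mulrA. Qed.

Lemma local_coefB P h k : local_coef P (h - k) = local_coef P h - local_coef P k.
Proof. by rewrite /local_coef mulrBl. Qed.

Lemma frac_addE p q p' q' : q != 0 -> q' != 0 ->
  tofrac p / tofrac q + tofrac p' / tofrac q' =
  tofrac (p * q' + p' * q) / tofrac (q * q').
Proof.
move=> q0 q'0; rewrite addf_div ?tofrac_eq0 //.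
by rewrite tofracD !tofracM.
Qed.

Lemma frac_mulE p q p' q' :
  tofrac p / tofrac q * (tofrac p' / tofrac q') = tofrac (p * p') / tofrac (q * q').
Proof. by rewrite mulf_div !tofracM. Qed.

Lemma horner_neq0 q (a : F) : q.[a] != 0 -> q != 0.
Proof. by apply: contraNneq => ->; rewrite horner0. Qed.

Lemma regularD P h k : regular P h -> regular P k -> regular P (h + k).
Proof.
case: P => [a|].
  move=> [p [q [qa ->]]] [p' [q' [q'a ->]]].
  exists (p * q' + p' * q), (q * q'); split; first by rewrite hornerM mulf_neq0.
  by apply: frac_addE; [apply: horner_neq0 qa | apply: horner_neq0 q'a].
move=> [p [q [q0 pq ->]]] [p' [q' [q'0 pq' ->]]].
exists (p * q' + p' * q), (q * q'); split; [by rewrite mulf_neq0| |exact: frac_addE].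
have le (x y z : {poly F}) : z != 0 -> (size x <= size y)%N -> (size (x * z)%R <= (size y + size z).-1)%N.
  move=> z0 xy; apply: leq_trans (size_polyMleq _ _) _.
  by rewrite -!subn1 leq_sub2r // leq_add2r.
rewrite [leqRHS]size_mul //; apply: leq_trans (size_polyD _ _) _; rewrite geq_max le //=.
by rewrite addnC le.
Qed.

Lemma regularM P h k : regular P h -> regular P k -> regular P (h * k).
Proof.
case: P => [a|].
  move=> [p [q [qa ->]]] [p' [q' [q'a ->]]].
  exists (p * p'), (q * q'); split; first by rewrite hornerM mulf_neq0.
  exact: frac_mulE.
move=> [p [q [q0 pq ->]]] [p' [q' [q'0 pq' ->]]].
exists (p * p'), (q * q'); split; [by rewrite mulf_neq0| |exact: frac_mulE].
rewrite [leqRHS]size_mul //; apply: leq_trans (size_polyMleq _ _) _.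
by rewrite -!subn1 leq_sub2r // leq_add.
Qed.

Lemma regular_cst P c : regular P (cst c).
Proof.
case: P => [a|]; exists c%:P, 1; rewrite tofrac1 divr1.
  by rewrite hornerC oner_neq0.
by rewrite oner_neq0 size_poly1 size_polyC; split=> //; case: (c == 0).
Qed.

Lemma regularN P h : regular P h -> regular P (- h).
Proof.
by move=> rh; rewrite -mulN1r -cst1 -cstN; apply: regularM rh; apply: regular_cst.
Qed.

Lemma regularB P h k : regular P h -> regular P k -> regular P (h - k).
Proof. by move=> rh /regularN; apply: regularD. Qed.

Lemma regular_poly a p : regular (Some a) (tofrac p).
Proof.
by exists p, 1; rewrite hornerC oner_neq0 tofrac1 divr1.
Qed.

Lemma regular_unif P : regular P (unif P).
Proof.
case: P => [a|]; first by rewrite unif_Some; apply: regular_poly.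
exists 1, 'X; rewrite tofrac1 mul1r polyX_eq0; split=> //.
by rewrite size_poly1 size_polyX.
Qed.

Lemma regularX P h n : regular P h -> regular P (h ^+ n).
Proof.
move=> rh; elim: n => [|n IH]; first by rewrite expr0 -cst1; apply: regular_cst.
by rewrite exprS; apply: regularM.
Qed.

Lemma regular_sum P (J : Type) (r : seq J) (Q : pred J) (h : J -> ratfun F) :
  (forall i, Q i -> regular P (h i)) -> regular P (\sum_(i <- r | Q i) h i).
Proof.
move=> rh; apply: (big_ind (regular P)) => //; last exact: regularD.
by rewrite -cst0; apply: regular_cst.
Qed.

Lemma max_pow0 P h : max_pow P 0 h <-> regular P h.
Proof.
split=> [[k rk ->]|rh]; first by rewrite expr0 mul1r.
by exists h; rewrite ?expr0 ?mul1r.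
Qed.

Lemma max_powD P n h k : max_pow P n h -> max_pow P n k -> max_pow P n (h + k).
Proof.
move=> [h' rh ->] [k' rk ->]; exists (h' + k'); first exact: regularD.
by rewrite mulrDr.
Qed.

Lemma max_powM P n h k : max_pow P n h -> regular P k -> max_pow P n (h * k).
Proof.
by move=> [h' rh ->] rk; exists (h' * k); rewrite ?mulrA //; apply: regularM.
Qed.

Lemma max_pow_le P m n h : (m <= n)%N -> max_pow P n h -> max_pow P m h.
Proof.
move=> le [k rk ->]; exists (unif P ^+ (n - m) * k).
  by apply: regularM rk; apply/regularX/regular_unif.
by rewrite mulrA -exprD subnKC.
Qed.

Lemma max_pow1_cst P c : max_pow P 1 (cst c) -> c = 0.
Proof.
case: P => [a|] [k].
  move=> [p [q [qa ->]]]; rewrite expr1 unif_Some mulrA -tofracM => /eqP.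
  rewrite -[cst c]divr1 -(tofrac1 {poly F}) eqr_div ?tofrac_eq0 ?oner_neq0 //;
    last exact: horner_neq0 qa.
  rewrite -!tofracM mulr1 tofrac_eq => /eqP/(congr1 (fun p => p.[a])).
  rewrite !hornerM hornerC hornerXsubC subrr mul0r => /eqP.
  by rewrite mulf_eq0 (negbTE qa) orbF => /eqP.
move=> [p [q [q0 pq ->]]]; rewrite expr1 /unif.
have X0 : coord != 0 :> ratfun F by rewrite tofrac_eq0 polyX_eq0.
move=> /(congr1 (fun h => coord * tofrac q * h)).
rewrite mulrA [coord * _]mulrC -[_ * coord / coord]mulrA mulfV // mulr1 mulrCA.
rewrite mulfV ?mulr1 ?tofrac_eq0 // -!tofracM => /eqP; rewrite tofrac_eq => /eqP e.
apply/eqP; apply: contraT => c0; move: pq.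
by rewrite -e mulrC mul_polyC size_scale // size_mulX // ltnn.
Qed.

Lemma value_eq P h c : max_pow P 1 (h - cst c) -> value P h = c.
Proof.
move=> hc; rewrite /value; apply: xget_unique => // c' hc'.
have : max_pow P 1 (cst (c - c')).
  have -> : cst (c - c') = (h - cst c') + (h - cst c) * cst (- 1).
    by rewrite cstD !cstN cst1; ring.
  by apply: max_powD => //; apply: max_powM => //; apply: regular_cst.
by move/max_pow1_cst/eqP; rewrite subr_eq0 => /eqP.
Qed.

(** Multiplying by the highest power of the parameter puts the last coefficient, a constant, in the
    maximal ideal; so it is 0, and induction removes the others. *)
Lemma principal_part_eq0 P M (d : nat -> F) :
  regular P (\sum_(i < M) cst (d i) / unif P ^+ i.+1) -> forall i, (i < M)%N -> d i = 0.
Proof.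
have u0 := unif_neq0 P.
elim: M => // M IH rs.
have dM : d M = 0.
  apply: (@max_pow1_cst P).
  have -> : cst (d M) = unif P ^+ M.+1 * (\sum_(i < M.+1) cst (d i) / unif P ^+ i.+1)
      - \sum_(i < M) cst (d i) * unif P ^+ (M - i).
    rewrite big_ord_recr /= mulrDr mulrCA mulfV ?expf_neq0 // mulr1.
    rewrite mulr_sumr addrAC -sumrB big1 ?add0r // => i _.
    rewrite mulrCA (_ : M.+1 = (M - i + i.+1)%N) ?exprD ?mulfK ?expf_neq0 ?subrr //.
    by rewrite addnS subnK // ltnW.
  apply: max_powD.
    by exists (unif P ^+ M * (\sum_(i < M.+1) cst (d i) / unif P ^+ i.+1));
      [apply: regularM rs; apply/regularX/regular_unif | rewrite expr1 mulrA exprS].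
  have -> : - (\sum_(i < M) cst (d i) * unif P ^+ (M - i)) =
      unif P * \sum_(i < M) cst (- d i) * unif P ^+ (M - i).-1.
    rewrite mulr_sumr -sumrN; apply: eq_bigr => i _; rewrite mulrCA -exprS.
    by rewrite prednK ?subn_gt0 // cstN mulNr.
  exists (\sum_(i < M) cst (- d i) * unif P ^+ (M - i).-1); last by rewrite expr1.
  apply: regular_sum => i _; apply: regularM (regular_cst _ _) _.
  exact/regularX/regular_unif.
move=> i; rewrite ltnS leq_eqVlt => /orP[/eqP->//|]; apply: IH.
by move: rs; rewrite big_ord_recr /= dM cst0 mul0r addr0.
Qed.

Definition pad (n : nat) (c : nat -> F) (i : nat) : F := if (i < n)%N then c i else 0.

Lemma sum_pad P n M (c : nat -> F) : (n <= M)%N ->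
  \sum_(i < n) cst (c i) / unif P ^+ i.+1 = \sum_(i < M) cst (pad n c i) / unif P ^+ i.+1.
Proof.
move=> le; rewrite (big_ord_widen _ (fun i => cst (c i) / unif P ^+ i.+1) le).
rewrite big_mkcond /=; apply: eq_bigr => i _; rewrite /pad; case: ifP => // _.
by rewrite cst0 mul0r.
Qed.

Lemma is_residue_unique P h r r' : is_residue P h r -> is_residue P h r' -> r = r'.
Proof.
move=> [n [c [rc <-]]] [n' [c' [rc' <-]]]; set M := (n + n').+1.
apply/eqP; rewrite -subr_eq0; apply/eqP.
have -> : c 0%N - c' 0%N = pad n.+1 c 0 - pad n'.+1 c' 0 by [].
have := @principal_part_eq0 P M (fun i => pad n.+1 c i - pad n'.+1 c' i).
apply => //.
have -> : \sum_(i < M) cst (pad n.+1 c i - pad n'.+1 c' i) / unif P ^+ i.+1 =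
    \sum_(i < n.+1) cst (c i) / unif P ^+ i.+1 -
    \sum_(i < n'.+1) cst (c' i) / unif P ^+ i.+1.
  rewrite (@sum_pad P n.+1 M) ?ltnS ?leq_addr // (@sum_pad P n'.+1 M) ?ltnS ?leq_addl //.
  by rewrite -sumrB; apply: eq_bigr => i _; rewrite cstD cstN mulrBl.
have := regularB rc' rc; congr regular.
by rewrite opprB addrC addrA subrK addrC.
Qed.

Lemma is_residueD P h k r : is_residue P h r -> regular P (local_coef P k) ->
  is_residue P (h + k) r.
Proof.
move=> [n [c [rc cr]]] rk; exists n, c; split=> //.
rewrite -[k]opprK -[h - _]/(h - (- k)) local_coefB addrAC; apply: regularB => //.
by rewrite -sub0r local_coefB /local_coef mul0r sub0r; apply: regularN.
Qed.

(** With [p] the local parameter, the residue of [p^i h dv] is the coefficient of [p^-(i+1)] in the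
    principal part. *)
Lemma regular_of_residues P h :
  (forall i : nat, is_residue P (unif P ^+ i * h) 0) -> regular P (local_coef P h).
Proof.
move=> res; have [M [c [rc _]]] := res 0%N; move: rc; rewrite expr0 mul1r => rc.
have u0 := unif_neq0 P.
suff c0 i : (i < M.+1)%N -> c i = 0.
  move: rc; rewrite big1 ?subr0 // => i _.
  by rewrite c0 // cst0 mul0r.
move=> iM; apply: (is_residue_unique _ (res i)); exists M, (fun j => pad M.+1 c (i + j)).
split; last by rewrite addn0 /pad iM.
have -> : local_coef P (unif P ^+ i * h) - \sum_(j < M.+1) cst (pad M.+1 c (i + j)) / unif P ^+ j.+1
   = unif P ^+ i * (local_coef P h - \sum_(j < M.+1) cst (c j) / unif P ^+ j.+1)
   + \sum_(j < i) cst (c j) * unif P ^+ (i - j.+1).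
  rewrite local_coefM mulrBr -addrA; congr (_ + _).
  rewrite (@sum_pad P M.+1 (i + M.+1) c) ?leq_addl // big_split_ord /= mulrDr.
  rewrite [X in _ = - (X + _) + _](_ : _ = \sum_(j < i) cst (c j) * unif P ^+ (i - j.+1)).
    rewrite opprD addrAC addNr sub0r; congr (- _); rewrite mulr_sumr.
    apply: eq_bigr => j _; rewrite mulrCA -addnS exprD invfM.
    by rewrite mulVKf; [congr (_ * _) | exact: expf_neq0].
  rewrite mulr_sumr; apply: eq_bigr => j _.
  rewrite /pad (ltn_trans (ltn_ord j) iM) mulrCA; congr (_ * _).
  by rewrite -[X in unif P ^+ X / _](subnK (ltn_ord j)) exprD mulfK ?expf_neq0.
apply: regularD; first by apply: regularM rc; apply/regularX/regular_unif.
apply: regular_sum => j _; apply: regularM (regular_cst _ _) _.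
exact/regularX/regular_unif.
Qed.

End Residues.

(** * Idempotents and the residue pairing modulo [modulus] *)

Section Idempotents.
Variables (F : fieldType) (I : finType) (q : I -> F) (n : nat).
Hypotheses (q_inj : injective q) (n_gt0 : (0 < n)%N).
Implicit Types (y z r : {poly F}).

Local Notation pX i := (('X - (q i)%:P) ^+ n).

Definition modulus : {poly F} := \prod_i pX i.

Definition cofac i : {poly F} := \prod_(j | j != i) pX j.

Lemma modulusE i : modulus = pX i * cofac i.
Proof. by rewrite /modulus (bigD1 i). Qed.

Lemma modulus_monic : modulus \is monic.
Proof. by apply: monic_prod => i _; apply: monic_exp; apply: monicXsubC. Qed.

Lemma cofac_monic i : cofac i \is monic.
Proof. by apply: monic_prod => j _; apply: monic_exp; apply: monicXsubC. Qed.

Lemma cofac_neq0 i : (cofac i).[q i] != 0.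
Proof.
rewrite /cofac horner_prod; apply/prodf_neq0 => j ji.
by rewrite horner_exp hornerXsubC expf_neq0 // subr_eq0 eq_sym (inj_eq q_inj).
Qed.

Lemma modulus_neq0 b : (forall i, b != q i) -> modulus.[b] != 0.
Proof.
move=> bq; rewrite horner_prod; apply/prodf_neq0 => j _.
by rewrite horner_exp hornerXsubC expf_neq0 // subr_eq0.
Qed.

Lemma modulus_root i : modulus.[q i] = 0.
Proof.
by rewrite (modulusE i) hornerM horner_exp hornerXsubC subrr expr0n gtn_eqF ?mul0r.
Qed.

Lemma modulus_dvdp y : (forall i, pX i %| y) -> modulus %| y.
Proof.
move=> dy; rewrite /modulus; have := index_enum_uniq I.
elim: (index_enum I) => [|i r IH] /=; first by rewrite big_nil dvd1p.
move=> /andP[ir ur]; rewrite big_cons Gauss_dvdp ?dy ?IH //.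
apply: coprimep_expl; rewrite coprimep_sym coprimep_XsubC /root horner_prod.
rewrite prodf_seq_neq0; apply/allP => j jr /=.
rewrite horner_exp hornerXsubC expf_neq0 // subr_eq0 (inj_eq q_inj).
by apply: contraNneq ir => ->.
Qed.

Lemma idempotents : exists eps : I -> {poly F},
  (forall i, cofac i %| eps i) /\ (forall i, pX i %| 1 - eps i).
Proof.
suff /choice[eps epsP] i : exists eps, cofac i %| eps /\ pX i %| 1 - eps.
  by exists eps; split=> i; have [] := epsP i.
have : coprimep (pX i) (cofac i).
  by apply: coprimep_expl; rewrite coprimep_sym coprimep_XsubC /root cofac_neq0.
move/Bezout_eq1_coprimepP => [[a b] /= ab]; exists (b * cofac i); split.
  exact: dvdp_mulIr.
by rewrite -ab addrK dvdp_mulIr.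
Qed.

Variable eps : I -> {poly F}.
Hypotheses (eps0 : forall i, cofac i %| eps i) (eps1 : forall i, pX i %| 1 - eps i).

Lemma dvdp_eps i j : j != i -> pX j %| eps i.
Proof.
by move=> ji; apply: dvdp_trans (eps0 i); rewrite /cofac (bigD1 j) //= dvdp_mulIl.
Qed.

Lemma eps_orth i j : modulus %| eps i * eps j - (if i == j then eps i else 0).
Proof.
case: eqP => [<-|/eqP ij].
  rewrite -[X in _ - X]mulr1 -mulrBr -opprB mulrN dvdpNr mulrC (modulusE i).
  by rewrite dvdp_mul.
by rewrite subr0 (modulusE j) dvdp_mul // dvdp_eps // eq_sym.
Qed.

Lemma eps_sum : modulus %| 1 - \sum_i eps i.
Proof.
apply: modulus_dvdp => i; rewrite (bigD1 i) //= opprD addrA dvdp_sub ?eps1 //.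
by apply: (big_ind (fun x => pX i %| x)) => [|x y|j ji]; [exact: dvdp0|exact: dvdp_add|apply: dvdp_eps; rewrite eq_sym].
Qed.

Lemma eps_mul i y : pX i %| y -> modulus %| eps i * y.
Proof. by move=> dy; rewrite (modulusE i) mulrC dvdp_mul. Qed.

Lemma eps_value i : (eps i).[q i] = 1.
Proof.
have [k kE] := dvdpP _ _ (eps1 i).
have : (1 - eps i).[q i] = 0.
  by rewrite kE hornerM horner_exp hornerXsubC subrr expr0n gtn_eqF ?mulr0.
by rewrite hornerD hornerN hornerC => /eqP; rewrite subr_eq0 => /eqP.
Qed.

(* The coefficient of [X^(N-1)] modulo the modulus of degree [N]; it computes
   the sum of the residues of [y / modulus]. *)
Local Notation N := (size modulus).-1.

Definition top y : F := (y %% modulus)`_N.-1.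

Lemma topD y z : top (y + z) = top y + top z.
Proof. by rewrite /top modpD coefD. Qed.

Lemma topZ a y : top (a *: y) = a * top y.
Proof. by rewrite /top modpZl coefZ. Qed.

Lemma top_sum (J : Type) (r : seq J) (P : pred J) (f : J -> {poly F}) :
  top (\sum_(i <- r | P i) f i) = \sum_(i <- r | P i) top (f i).
Proof.
apply: (big_morph top topD); rewrite /top mod0p coef0 //.
Qed.

Lemma top_dvdp y : modulus %| y -> top y = 0.
Proof. by rewrite /dvdp /top => /eqP->; rewrite coef0. Qed.

Lemma top_congr y z : modulus %| y - z -> top y = top z.
Proof. by move=> /top_dvdp h; rewrite -[y](subrK z) topD h add0r. Qed.

Lemma top_small y : (size y < size modulus)%N -> top y = y`_N.-1.
Proof. by move=> sy; rewrite /top modp_small. Qed.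

Lemma top_eps y : top y = \sum_i top (eps i * y).
Proof.
rewrite -top_sum -mulr_suml; apply: top_congr; rewrite -{1}[y]mul1r -mulrBl.
exact/dvdp_mulr/eps_sum.
Qed.

(** A power of [X] moves the leading term of [r] to degree [N - 1], where [top] reads it without
    reduction. *)
Lemma top_nondegenerate r : (size r < size modulus)%N ->
  (forall k, (k < N)%N -> top ('X^k * r) = 0) -> r = 0.
Proof.
move=> sr tr; apply/eqP; apply: contraT => r0.
have r1 : (0 < size r)%N by rewrite size_poly_gt0.
have N1 : (0 < size modulus)%N by apply: leq_trans sr.
have kN : (N - size r < N)%N by move: sr r1; lia.
have := tr _ kN; rewrite top_small; last first.
  by rewrite mulrC size_mulXn //; move: sr r1; lia.
have -> : N.-1 = ((size r).-1 + (N - size r))%N by move: sr r1; lia.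
rewrite coefXnM ltnNge leq_addl /= addnK => /eqP.
by rewrite -/(lead_coef r) lead_coef_eq0 (negbTE r0).
Qed.

End Idempotents.
Lemma divX_cancel (K : fieldType) (a x : K) m : x != 0 ->
  a * x ^+ m.+1 / x ^+ m.+2 = a / x.
Proof. by move=> x0; rewrite [x ^+ m.+2]exprS invfM mulrCA mulfK ?expf_neq0 // mulrC. Qed.

Lemma partial_fraction2 (K : fieldType) (a b p x c : K) : x != 0 -> c != 0 ->
  ((a * x + p) * c + b * x) / (x * c) = p / x + (a + b / c).
Proof. by move=> x0 c0; field; rewrite x0 c0. Qed.

(** * Residues of differentials with denominator [modulus] *)

Section DualizingSheaf.
Variable F : closedFieldType.
Local Notation tofrac := (@FracField.tofrac {poly F}).
Local Notation cst := (@Defs.cst F).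
Implicit Types (p y z r : {poly F}).

(** By regularity each root of the denominator is a root of the numerator; cancel until the
    denominator is constant. *)
Lemma regular_everywhere_poly (h : ratfun F) : (forall a, regular (Some a) h) ->
  exists p, h = tofrac p.
Proof.
have [y [z [z0 ->]]] := frac_ind h.
move: {2}(size z) (leqnn (size z)) => m.
elim: m y z z0 => [|m IH] y z z0; first by rewrite leqn0 size_poly_eq0 (negbTE z0).
move=> zm rh; have [z1|z1] := eqVneq (size z) 1%N.
  move/eqP/size_poly1P: z1 => [c c0 ->]; exists (c^-1 *: y).
  rewrite -[RHS]divr1 -(tofrac1 {poly F}); apply/eqP; rewrite eqr_div ?tofrac_eq0 ?oner_neq0 ?polyC_eq0 //.
  by rewrite -!tofracM tofrac_eq mulr1 -mul_polyC mulrAC -polyCM mulVf // mul1r.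
have /closed_rootP[a za] := z1.
have [y' yE] : exists y', y = y' * ('X - a%:P).
  apply/factor_theorem; have [p [r [ra /eqP]]] := rh a.
  have r0 := horner_neq0 ra.
  rewrite eqr_div ?tofrac_eq0 // -!tofracM tofrac_eq => /eqP/(congr1 (fun p => p.[a])).
  rewrite !hornerM (eqP za) mulr0 => /eqP.
  by rewrite mulf_eq0 (negbTE ra) orbF.
move/factor_theorem: za => [z' zE].
have z'0 : z' != 0 by apply: contraNneq z0 => z'0; rewrite zE z'0 mul0r.
have e : tofrac y / tofrac z = tofrac y' / tofrac z'.
  apply/eqP; rewrite eqr_div ?tofrac_eq0 // -!tofracM tofrac_eq yE zE.
  by apply/eqP; rewrite mulrAC -!mulrA [z' * _]mulrC.
rewrite e in rh *; apply: IH => //; move: zm.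
by rewrite zE size_mul ?polyXsubC_eq0 // size_XsubC addn2.
Qed.

Lemma residue_proper (a : F) p m : (size p <= m.+1)%N ->
  exists2 c : nat -> F, c 0%N = p`_m & tofrac p / tofrac (('X - a%:P) ^+ m.+1) =
    \sum_(i < m.+1) cst (c i) / unif (Some a) ^+ i.+1.
Proof.
have x0 : tofrac ('X - a%:P) != 0 by rewrite tofrac_eq0 polyXsubC_eq0.
elim: m p => [|m IH] p sp.
  exists (fun=> p`_0); first by [].
  rewrite big_ord1 unif_Some !expr1.
  by rewrite [in LHS](size1_polyC sp).
pose p' := p - p`_m.+1 *: ('X - a%:P) ^+ m.+1.
have sX : size (('X - a%:P) ^+ m.+1) = m.+2 by rewrite size_exp_XsubC.
have sp' : (size p' <= m.+1)%N.
  apply/leq_sizeP => j; rewrite leq_eqVlt coefB coefZ => /orP[/eqP<-|mj].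
    have -> : (('X - a%:P) ^+ m.+1)`_m.+1 = 1.
      have /monicP := monic_exp m.+1 (monicXsubC a).
      by rewrite /lead_coef sX.
    by rewrite mulr1 subrr.
  by rewrite (nth_default _ (leq_trans sp mj)) [X in _ * X]nth_default ?sX // mulr0 subrr.
have [c c0 cE] := IH _ sp'.
exists (fun i => if i is j.+1 then c j else p`_m.+1) => //.
rewrite big_ord_recl /= expr1.
have -> : \sum_(i < m.+1) cst (c i) / unif (Some a) ^+ (bump 0 i).+1 =
    (\sum_(i < m.+1) cst (c i) / unif (Some a) ^+ i.+1) / unif (Some a).
  by rewrite mulr_suml; apply: eq_bigr => i _; rewrite -mulrA -invfM -exprSr.
rewrite -cE unif_Some -mulrA -invfM -tofracM -exprSr.
have -> : tofrac p = tofrac p' + cst p`_m.+1 * tofrac (('X - a%:P) ^+ m.+1).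
  by rewrite /Defs.cst -tofracM -tofracD mul_polyC subrK.
rewrite mulrDl addrC; congr (_ + _).
rewrite [tofrac (_ ^+ m.+1)]tofracXn [tofrac (_ ^+ m.+2)]tofracXn -[Defs.coord - _]/(unif (Some a)) unif_Some.
exact: divX_cancel.
Qed.

Lemma coef_mul_monic p r m : p \is monic -> (size r <= m.+1)%N ->
  (p * r)`_((size p).-1 + m) = r`_m.
Proof.
move=> pm; rewrite leq_eqVlt => /orP[/eqP sr|sr]; last first.
  rewrite !nth_default //; apply: leq_trans (size_polyMleq _ _) _.
  by have := size_poly_gt0 p; rewrite monic_neq0 //; move: sr; lia.
have r0 : r != 0 by rewrite -size_poly_gt0 sr.
have := lead_coef_monicM r pm; rewrite /lead_coef size_monicM // sr addnS /=.
by have := size_poly_gt0 p; rewrite monic_neq0 // => s0; rewrite -subn1 -addnBAC ?subn1.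
Qed.

Variables (I : finType) (q : I -> F) (n : nat).
Hypotheses (q_inj : injective q) (n_gt0 : (0 < n)%N).

Local Notation pX i := (('X - (q i)%:P) ^+ n).
Local Notation D := (modulus q n).
Local Notation N := (size D).-1.
Local Notation cofac := (cofac q n).
Local Notation top := (top q n).

Variable eps : I -> {poly F}.
Hypotheses (eps0 : forall i, cofac i %| eps i) (eps1 : forall i, pX i %| 1 - eps i).

Lemma size_modulus i : (size D).-1 = ((size (cofac i)).-1 + n.-1).+1.
Proof.
rewrite (modulusE q n i) size_monicM ?monic_neq0 ?cofac_monic //; last first.
  by apply: monic_exp; apply: monicXsubC.
rewrite size_exp_XsubC; have := size_poly_gt0 (cofac i).
by rewrite monic_neq0 ?cofac_monic //; move: n_gt0; lia.
Qed.

(** With [eps i = k * cofac i], the principal part of [y / D] at [q i] is [p / (X - q i)^n], where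
    [p] is the remainder of [k y]. The residue is the coefficient of degree [n - 1] in [p], hence
    the top coefficient of [cofac i * p], which is congruent to [eps i * y]. *)
Lemma residue_top i y :
  is_residue (Some (q i)) (tofrac y / tofrac D) (top (eps i * y)).
Proof.
have D0 : tofrac D != 0 by rewrite tofrac_eq0 monic_neq0 ?modulus_monic.
have x0 : tofrac (pX i) != 0 by rewrite tofrac_eq0 expf_neq0 // polyXsubC_eq0.
have c0 : tofrac (cofac i) != 0 by rewrite tofrac_eq0 monic_neq0 ?cofac_monic.
have DE : tofrac D = tofrac (pX i) * tofrac (cofac i) by rewrite (modulusE q n i) tofracM.
have [k kE] := dvdpP _ _ (eps0 i); have [t tE] := dvdpP _ _ (eps1 i).
set p := (k * y) %% pX i.
have sp : (size p <= n.-1.+1)%N.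
  have := ltn_modp (k * y) (pX i); rewrite expf_neq0 ?polyXsubC_eq0 //.
  by rewrite size_exp_XsubC prednK.
have kyE : k * y = (k * y) %/ pX i * pX i + p by rewrite -divp_eq.
have -> : top (eps i * y) = p`_n.-1.
  rewrite (@top_congr _ _ q n _ (cofac i * p)); last first.
    rewrite kE mulrAC kyE (modulusE q n i) mulrDl [p * _]mulrC addrK -mulrA.
    exact: dvdp_mulIr.
  rewrite top_small; last first.
    apply: leq_ltn_trans (size_polyMleq _ _) _.
    have sc : (0 < size (cofac i))%N by rewrite size_poly_gt0 monic_neq0 ?cofac_monic.
    have := size_modulus i; move: sp sc; rewrite -/p.
    by move: (size p) (size (cofac i)) (size D) => a b c; lia.
  by rewrite (size_modulus i) coef_mul_monic ?cofac_monic.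
have [c cp cE] := residue_proper (q i) sp.
have -> : tofrac y / tofrac D = tofrac p / tofrac (pX i) +
    (tofrac ((k * y) %/ pX i) + tofrac (t * y) / tofrac (cofac i)).
  have yE : y = ((k * y) %/ pX i * pX i + p) * cofac i + t * y * pX i.
    by rewrite -kyE mulrAC -kE mulrAC -tE -mulrDl addrC subrK mul1r.
  have -> : tofrac y = (tofrac ((k * y) %/ pX i) * tofrac (pX i) + tofrac p) *
      tofrac (cofac i) + tofrac (t * y) * tofrac (pX i).
    by rewrite {1}yE tofracD; congr (_ + _); rewrite tofracM // tofracD tofracM.
  rewrite DE.
  move: x0 c0; move: (tofrac (pX i)) (tofrac (cofac i)) (tofrac (t * y)) (tofrac p).
  move: (tofrac _) => a' x' c' b' d' x'0 c'0; apply: (@partial_fraction2 (ratfun F)) x'0 c'0.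
apply: (@is_residueD F (Some (q i)) (tofrac p / tofrac (pX i))).
  exists n.-1, c; split=> //.
  rewrite -[X in tofrac (_ ^+ X)](prednK n_gt0) cE local_coef_Some subrr.
  by rewrite -(tofrac0 {poly F}); apply: regular_poly.
rewrite local_coef_Some; apply: regularD (regular_poly _ _) _.
by exists (t * y), (cofac i); split=> //; apply: cofac_neq0.
Qed.

End DualizingSheaf.

Lemma subspace_matrix (K : fieldType) m (S : 'rV[K]_m -> Prop) : S 0 ->
  (forall a x y, S x -> S y -> S (a *: x + y)) ->
  exists M : 'M[K]_m, forall x, S x <-> (x <= M)%MS.
Proof.
move=> S0 Slin; pose inS (M : 'M[K]_m) := forall x : 'rV_m, (x <= M)%MS -> S x.
have ex0 : exists k, `[< exists2 M, inS M & \rank M = k >].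
  exists 0%N; apply/asboolP; exists 0; last exact: mxrank0.
  by move=> x; rewrite submx0 => /eqP->.
have bound k : `[< exists2 M, inS M & \rank M = k >] -> (k <= m)%N.
  by move=> /asboolP[M _ <-]; apply: rank_leq_row.
case: (ex_maxnP ex0 bound) => k /asboolP[M MS rM] maxk.
exists M => x; split=> [Sx|]; last exact: MS.
have rle : (\rank (M + x)%MS <= \rank M)%N.
  rewrite rM; apply: maxk; apply/asboolP; exists (M + x)%MS => // y /sub_addsmxP[[u c] /= ->].
  rewrite addrC [c]mx11_scalar mul_scalar_mx; apply: Slin => //.
  exact/MS/submxMl.
have := geq_leqif (mxrank_leqif_sup (addsmxSl M x)); rewrite rle => /esym.
exact: submx_trans (addsmxSr M x).
Qed.

(** * Sections of the dualizing sheaf and the ring of the curve *)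

Section CurveAlgebra.
Variables (F : numClosedFieldType) (C : unibranch_rational_curve F).
Variables (I : finType) (q : I -> F) (n : nat) (i0 : I).
Hypotheses (q_inj : injective q) (n_gt0 : (0 < n)%N).
Hypothesis singP : forall P, ~ smooth_point C P <-> exists i, P = Some (q i).
Hypothesis conductor : forall i h, max_pow (Some (q i)) n h -> C (Some (q i)) h.

Local Notation tofrac := (@FracField.tofrac {poly F}).
Local Notation cst := (@Defs.cst F).
Local Notation coord := (@Defs.coord F).
Local Notation pX i := (('X - (q i)%:P) ^+ n).
Local Notation D := (modulus q n).
Local Notation N := (size D).-1.
Local Notation cofac := (cofac q n).
Local Notation top := (top q n).
Implicit Types (p r y z : {poly F}) (h f : ratfun F).

Variable eps : I -> {poly F}.
Hypotheses (eps0 : forall i, cofac i %| eps i) (eps1 : forall i, pX i %| 1 - eps i).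

Let D0 : D != 0. Proof. exact/monic_neq0/modulus_monic. Qed.

Lemma N_gt0 : (0 < N)%N. Proof. by rewrite (size_modulus q n_gt0 i0). Qed.

Lemma size_D : size D = N.+1.
Proof. by rewrite prednK // size_poly_gt0. Qed.

Lemma smooth_stalk P : (forall i, P <> Some (q i)) -> C P = regular P.
Proof.
move=> Pq; apply: contrapT => sP.
by have /singP[i /Pq] : ~ smooth_point C P by [].
Qed.

Lemma dualizing_regular P m h : (forall k, max_pow P m k -> C P k) ->
  dualizing C P h -> regular P (unif P ^+ m * local_coef P h).
Proof.
move=> cP dh; rewrite -local_coefM; apply: regular_of_residues => i.
rewrite mulrA; apply: dh; apply: cP; exists (unif P ^+ i); last by rewrite mulrC.
exact/regularX/regular_unif.
Qed.

(** The conductor bounds the pole order at [q i] by [n], so [D h] is a polynomial; regularity at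
    infinity, where [dv] has a double pole, bounds its degree. *)
Lemma section_numerator h : dualizing_section C h ->
  exists2 r : {poly F}, (size r < N)%N & h = tofrac r / tofrac D.
Proof.
move=> dh.
have rreg a : regular (Some a) (tofrac D * h).
  have [[i ai]|nai] := pselect (exists i, a = q i).
    have := dualizing_regular (@conductor i) (dh (Some (q i))).
    rewrite local_coef_Some unif_Some -tofracXn => rh.
    rewrite ai (modulusE q n i) mulrC tofracM mulrA [h * _]mulrC.
    by apply: regularM rh (regular_poly _ _).
  apply: regularM (regular_poly _ _) _.
  have sm : C (Some a) = regular (Some a).
    by apply: smooth_stalk => i [ai]; apply: nai; exists i.
  have := @dualizing_regular (Some a) 0 h; rewrite expr0 mul1r local_coef_Some.
  by apply; [move=> k; rewrite sm => /max_pow0 | exact: dh].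
have [r rE] := regular_everywhere_poly rreg.
have hE : h = tofrac r / tofrac D.
  by rewrite -rE mulrAC mulfV ?mul1r // tofrac_eq0.
exists r => //.
have [->|r0] := eqVneq r 0; first by rewrite size_poly0 N_gt0.
have : regular None (local_coef None h).
  have sm : C None = regular None by apply: smooth_stalk.
  have := @dualizing_regular None 0 h; rewrite expr0 mul1r.
  by apply; [move=> k; rewrite sm => /max_pow0 | exact: dh].
rewrite local_coef_None => -[p [z [z0 pz]]] /eqP.
rewrite hE mulrA -mulNr -tofracXn -tofracM -tofracN eqr_div ?tofrac_eq0 //.
rewrite -!tofracM tofrac_eq => /eqP/(congr1 (fun p : {poly F} => size p)).
rewrite mulNr size_polyN -mulrA ['X^2 * _]mulrC size_mulXn ?mulf_neq0 //.
rewrite size_mul // => e; have := size_polyMleq p D; rewrite -e.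
have : (0 < size z)%N by rewrite size_poly_gt0.
have := size_D; move: pz; move: (size D) (size p) (size z) (size r) => a b c d.
by lia.
Qed.

Lemma stalk_opp P h : C P h -> C P (- h).
Proof.
by move=> Ch; rewrite -mulN1r -(cst1 F) -cstN; apply: stalk_mul Ch; apply: stalk_cst.
Qed.

Lemma stalk_dvdp i p : pX i %| p -> C (Some (q i)) (tofrac p).
Proof.
move=> /dvdpP[k ->]; apply: conductor; exists (tofrac k); first exact: regular_poly.
by rewrite unif_Some -tofracXn -tofracM mulrC.
Qed.

(** Modulo [(X - q i)^n], whose multiples lie in the stalk, the denominator is inverted by Bezout.
    Residue conditions thus need testing on polynomials only. *)
Lemma stalk_approx i f : C (Some (q i)) f -> exists p k,
  [/\ C (Some (q i)) (tofrac p), regular (Some (q i)) k & f = tofrac p + tofrac (pX i) * k].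
Proof.
move=> Cf; have [a [b [bq fE]]] := stalk_regular Cf.
have : coprimep (pX i) b.
  by apply: coprimep_expl; rewrite coprimep_sym coprimep_XsubC.
move=> /Bezout_eq1_coprimepP[[u v] /= uv].
have b0 : tofrac b != 0 by rewrite tofrac_eq0 (horner_neq0 bq).
pose k := tofrac (a * u) / tofrac b.
have rk : regular (Some (q i)) k by exists (a * u), b.
have e : f = tofrac (a * v) + tofrac (pX i) * k.
  apply: (mulIf b0); rewrite fE divfK // mulrDl /k [tofrac (pX i) * _]mulrC mulrAC divfK //.
  rewrite -!tofracM -tofracD -[a in LHS]mulr1 -uv; congr (tofrac _); ring.
exists (a * v), k; split=> //.
have -> : tofrac (a * v) = f - tofrac (pX i) * k by rewrite e addrK.
apply: stalk_add Cf _; apply/stalk_opp/conductor; exists k => //.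
by rewrite unif_Some tofracXn.
Qed.

Lemma section_of_numerator r : (size r < N)%N ->
  (forall i p, C (Some (q i)) (tofrac p) -> top (eps i * (p * r)) = 0) ->
  dualizing_section C (tofrac r / tofrac D).
Proof.
move=> sr res P f Cf; set h := tofrac r / tofrac D.
have [[i Pi]|nPi] := pselect (exists i, P = Some (q i)).
  rewrite Pi in Cf *; have [p [k [Cp rk fE]]] := stalk_approx Cf.
  rewrite fE mulrDl; apply: (@is_residueD F (Some (q i)) (tofrac p * h)).
    by rewrite /h mulrA -tofracM -(res i p Cp); apply: residue_top.
  rewrite local_coef_Some mulrAC /h (modulusE q n i) tofracM mulrC.
  apply: regularM rk _; exists r, (cofac i); split; first exact: cofac_neq0.
  rewrite invfM mulrCA mulVKf // tofrac_eq0 expf_neq0 // polyXsubC_eq0 //.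
have sm : C P = regular P by apply: smooth_stalk => i Pi; apply: nPi; exists i.
have rh : regular P (local_coef P h).
  case: P {f Cf sm} nPi => [a|] nPi.
    rewrite local_coef_Some; exists r, D; split=> //; apply: modulus_neq0 => i.
    by apply/eqP => ai; apply: nPi; exists i; rewrite ai.
  rewrite local_coef_None; exists (- ('X^2 * r)), D; split=> //; last first.
    by rewrite /h mulrA -mulNr -tofracXn -tofracM -tofracN.
  have [->|r0] := eqVneq r 0; first by rewrite mulr0 oppr0 size_poly0.
  rewrite size_polyN mulrC size_mulXn //; have := size_D; move: sr.
  by move: (size D) (size r) => b c; lia.
exists 0%N, (fun=> 0); split=> //; rewrite big_ord1 cst0 mul0r subr0 local_coefM.
by apply: regularM rh; rewrite -sm.
Qed.

(** The coordinate ring of the curve minus the point [v = oo]. *)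
Definition global p : Prop := forall i, C (Some (q i)) (tofrac p).

Lemma globalM p r : global p -> global r -> global (p * r).
Proof. by move=> gp gr i; rewrite tofracM; apply: stalk_mul. Qed.

Lemma globalZD a p r : global p -> global r -> global (a *: p + r).
Proof.
move=> gp gr i; rewrite tofracD -mul_polyC tofracM; apply: stalk_add => //.
by apply: stalk_mul => //; apply: stalk_cst.
Qed.

Lemma global_dvdp p : D %| p -> global p.
Proof.
move=> Dp i; apply: stalk_dvdp; apply: dvdp_trans Dp.
by rewrite (modulusE q n i) dvdp_mulIl.
Qed.

Lemma global_congr p r : D %| p - r -> global r -> global p.
Proof.
move=> /global_dvdp d gr; rewrite -[p](subrK r) -[_ - _]scale1r.
exact: globalZD.
Qed.

Lemma global1 : global 1.
Proof. by move=> i; rewrite tofrac1 -(cst1 F); apply: stalk_cst. Qed.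

Lemma global_eps_mul i p : C (Some (q i)) (tofrac p) -> global (eps i * p).
Proof.
move=> Cp j; have [->|ji] := eqVneq j i; last first.
  by apply: stalk_dvdp; apply: dvdp_mulr; apply: dvdp_eps.
rewrite tofracM; apply: stalk_mul Cp.
have -> : eps i = 1 - (1 - eps i) by rewrite opprB addrC subrK.
rewrite tofracB tofrac1 -(cst1 F); apply: stalk_add (stalk_cst _ _ _) _.
exact/stalk_opp/stalk_dvdp.
Qed.

Lemma global_eps i : global (eps i).
Proof. by rewrite -[eps i]mulr1; apply: global_eps_mul; apply: global1. Qed.

Lemma top_section p r : global p -> dualizing_section C (tofrac r / tofrac D) ->
  top (p * r) = 0.
Proof.
move=> gp dr; rewrite (top_eps q_inj eps0 eps1) big1 // => i _.
have := dr (Some (q i)) _ (gp i); rewrite mulrA -tofracM.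
exact: is_residue_unique (residue_top q_inj n_gt0 eps0 eps1 i (p * r)).
Qed.

(** By [top_nondegenerate] the form [top (x * y)] on polynomials modulo [D] has an invertible Gram
    matrix [T]. *)
Lemma top_representation (b : 'cV[F]_N) : exists2 r : {poly F}, (size r <= N)%N &
  forall x : 'rV_N, top (rVpoly x * r) = (x *m b) 0 0.
Proof.
have rVE (x : 'rV[F]_N) : rVpoly x = \sum_k x 0 k *: 'X^k.
  rewrite /rVpoly poly_def; apply: eq_bigr => k _; rewrite insubT //=.
  by move=> lt; congr (x 0 _ *: _); apply: val_inj.
pose T : 'M[F]_N := \matrix_(i, k) top ('X^i * 'X^k).
have TE (x : 'rV_N) k : (x *m T) 0 k = top ('X^k * rVpoly x).
  rewrite mxE rVE mulr_sumr top_sum; apply: eq_bigr => i _.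
  by rewrite mxE -scalerAr topZ ['X^k * _]mulrC.
have sz (x : 'rV[F]_N) : (size (rVpoly x) < size D)%N by apply: leq_ltn_trans (size_poly _ _) _; rewrite size_D.
have Tu : T \in unitmx.
  rewrite -row_free_unit; apply: inj_row_free => x xT.
  apply: (can_inj rVpolyK); rewrite [RHS]linear0.
  apply: (top_nondegenerate n_gt0 (sz x)) => k kN.
  by have := TE x (Ordinal kN); rewrite xT mxE.
exists (rVpoly (b^T *m invmx T)); first by rewrite -ltnS -size_D.
move=> x; rewrite [rVpoly x]rVE mulr_suml top_sum mxE; apply: eq_bigr => k _.
by rewrite -scalerAl topZ -TE mulmxKV // mxE.
Qed.

Variables (g : nat) (w : 'I_g -> ratfun F) (r : 'I_g -> {poly F}).
Hypotheses (w_basis : dualizing_basis C w).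
Hypotheses (rN : forall j, (size (r j) < N)%N)
  (wE : forall j, w j = tofrac (r j) / tofrac D).

Lemma w_section j : dualizing_section C (tofrac (r j) / tofrac D).
Proof. by rewrite -wE; case: w_basis. Qed.

(* A polynomial pairing to zero with all the sections is global: otherwise a
   functional separating it from the global ones is [p |-> top (p * s)] for
   some [s], and [s / D] is a section outside the span of the basis. *)
Lemma double_annihilator p : (forall j, top (p * r j) = 0) -> global p.
Proof.
move=> tp; suff gm : global (p %% D).
  by apply: global_congr gm; rewrite {1}(divp_eq p D) addrK dvdp_mulIr.
pose S (x : 'rV[F]_N) := global (rVpoly x).
have S0 : S 0 by rewrite /S linear0; apply/global_dvdp/dvdp0.
have Slin a x (y : 'rV_N) : S x -> S y -> S (a *: x + y).
  by rewrite /S linearP; apply: globalZD.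
have [M MP] := subspace_matrix S0 Slin.
have sm : (size (p %% D)%R <= N)%N by rewrite -ltnS -size_D ltn_modp.
rewrite -(poly_rV_K sm); apply: (proj2 (MP _)); apply: contraT.
set x := poly_rV _; rewrite submxE => /rV0Pn[k xk].
have [s sN sP] := top_representation (col k (cokermx M)).
have sM (y : 'rV_N) : (y <= M)%MS -> top (rVpoly y * s) = 0.
  by rewrite submxE => /eqP yM; rewrite sP colE mulmxA yM mul0mx mxE.
have sg y : global y -> top (y * s) = 0.
  move=> gy; have sy : (size (y %% D)%R <= N)%N by rewrite -ltnS -size_D ltn_modp.
  have <- : top ((y %% D) * s) = top (y * s).
    apply: top_congr; rewrite -mulrBl; apply: dvdp_mulr.
    by rewrite {2}(divp_eq y D) opprD addrCA subrr addr0 dvdpNr dvdp_mulIr.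
  rewrite -(poly_rV_K sy); apply: sM; apply: (proj1 (MP _)); rewrite /S poly_rV_K //.
  by apply: global_congr gy; rewrite {2}(divp_eq y D) opprD addrCA subrr addr0 dvdpNr dvdp_mulIr.
(* As 1 is global, [top s = 0], which excludes degree [N - 1]; the numerator of a section has degree
   at most [N - 2]. *)
have sN' : (size s < N)%N.
  rewrite ltn_neqAle sN andbT; apply/eqP => sE.
  have ssD : (size s < size D)%N by rewrite sE size_D.
  have := sg 1 global1; rewrite mul1r (top_small ssD) -sE.
  rewrite -/(lead_coef s) => /eqP; rewrite lead_coef_eq0 => /eqP s0.
  by have := N_gt0; rewrite -sE s0 size_poly0.
have ds : dualizing_section C (tofrac s / tofrac D).
  apply: section_of_numerator => // i y Cy; rewrite mulrA.
  exact/sg/global_eps_mul.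
have [_ /(_ _ ds)[c [cE _]]] := w_basis.
have sE : s = \sum_j c j *: r j.
  have D0F : tofrac D != 0 by rewrite tofrac_eq0.
  apply/eqP; rewrite -tofrac_eq -(inj_eq (mulIf (invr_neq0 D0F))) cE.
  rewrite (raddf_sum tofrac) mulr_suml; apply/eqP/eq_bigr => j _ /=.
  by rewrite wE mulrA /Defs.cst -tofracM mul_polyC.
suff : top (p * s) = 0.
  have <- : top (p %% D * s) = top (p * s).
    apply: top_congr; rewrite -mulrBl; apply: dvdp_mulr.
    by rewrite {2}(divp_eq p D) opprD addrCA subrr addr0 dvdpNr dvdp_mulIr.
  rewrite -(poly_rV_K sm) sP colE mulmxA -colE mxE => xk0.
  by rewrite xk0 eqxx in xk.
rewrite sE mulr_sumr top_sum big1 // => j _.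
by rewrite -scalerAr topZ tp mulr0.
Qed.

Lemma numerators_independent (c : 'I_g -> F) : \sum_j c j *: r j = 0 -> forall j, c j = 0.
Proof.
move=> c0; have [_ wb] := w_basis.
have [|b [bE bu]] := wb 0.
  have -> : 0 = tofrac 0 / tofrac D :> ratfun F by rewrite tofrac0 mul0r.
  apply: section_of_numerator => [|i p _]; first by rewrite size_poly0 N_gt0.
  by rewrite !mulr0; apply: top_dvdp; apply: dvdp0.
have u c' : 0 = \sum_j cst ([ffun j => c' j] j) * w j -> b = [ffun j => c' j] by apply: bu.
have b1 : b = [ffun=> 0].
  by apply: u; rewrite big1 // => j _; rewrite ffunE cst0 mul0r.
have b2 : b = [ffun j => c j].
  apply: u; transitivity (tofrac (\sum_j c j *: r j) / tofrac D).
    by rewrite c0 tofrac0 mul0r.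
  rewrite (raddf_sum tofrac) mulr_suml; apply: eq_bigr => j _ /=.
  by rewrite ffunE wE mulrA /Defs.cst -tofracM mul_polyC.
by move=> j; move: b2; rewrite b1 => /ffunP/(_ j); rewrite !ffunE.
Qed.

Lemma dual_polynomials : exists y : 'I_g -> {poly F},
  forall i j, top (y j * r i) = (i == j)%:R.
Proof.
pose L : 'M[F]_(g, N) := \matrix_(j, k) top ('X^k * r j).
have : row_free L.
  apply: inj_row_free => c cL; apply/rowP => j; rewrite mxE.
  apply: (numerators_independent (c := fun j => c 0 j)).
  apply: (@top_nondegenerate _ _ q n n_gt0) => [|k kN].
    rewrite size_D ltnS; apply: leq_trans (size_sum _ _ _) _.
    apply/bigmax_leqP => i _; apply: leq_trans (size_scale_leq _ _) _.
    exact/ltnW/rN.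
  have /rowP/(_ (Ordinal kN)) := cL; rewrite !mxE => <-.
  rewrite mulr_sumr top_sum; apply: eq_bigr => i _.
  by rewrite mxE -scalerAr topZ.
move=> /row_freeP[Y LY]; exists (fun j => \sum_k Y k j *: 'X^k) => i j.
have /matrixP/(_ i j) := LY; rewrite !mxE => <-.
rewrite mulr_suml top_sum; apply: eq_bigr => k _.
by rewrite mxE -scalerAl topZ mulrC.
Qed.

(** * Expansions at infinity and values at points *)

Variable a : nat -> 'I_g -> F.
Hypothesis w_exp : forall j, is_expansion None (w j) (fun i => a i j).

Lemma exprV_mul (K : fieldType) (x : K) k i : x != 0 -> (k <= i)%N ->
  x^-1 ^+ k * x ^+ i = x ^+ (i - k).
Proof.
move=> x0 ki; rewrite -{1}(subnK ki) exprD exprVn mulrCA mulVf ?mulr1 //.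
exact: expf_neq0.
Qed.

Lemma clear_expansion (K : fieldType) (x s d S T p z : K) i : x != 0 -> d != 0 ->
  z != 0 -> S * x ^+ i = T -> - (x ^+ 2 * (s / d)) - S = x^-1 ^+ i.+1 * (p / z) ->
  x * (x ^+ 2 * x ^+ i * s + T * d) * z = - (d * p).
Proof.
move=> x0 d0 z0 <- e.
have -> : p = (- (x ^+ 2 * (s / d)) - S) * (x ^+ i.+1 * z).
  rewrite e exprVn; have := expf_neq0 i.+1 x0; move: (x ^+ i.+1) => y y0.
  by field; rewrite y0 z0.
by rewrite [x ^+ i.+1]exprS; move: (x ^+ i) => y; field.
Qed.

(** [a i j] is the residue of [v^(i+1) w_j] at infinity, and [top] gives the sum of the other
    residues. *)
Lemma top_expansion i j : top ('X^(i.+1) * r j) = - a i j.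
Proof.
have X0 : 'X != 0 :> {poly F} by rewrite polyX_eq0.
have [_ [p [z [z0 pz ->]]] e] := w_exp j i.+1.
(* [T] is [v^i] times the expansion in [1/v] cut after order [i], a polynomial in [v]. *)
pose T : {poly F} := \sum_(k < i.+1) (a k j)%:P * 'X^(i - k).
have XF0 : coord != 0 by rewrite tofrac_eq0.
have TS : (\sum_(k < i.+1) cst (a k j) * unif None ^+ k) * coord ^+ i = tofrac T.
  rewrite /T (raddf_sum tofrac) mulr_suml; apply: eq_bigr => k _ /=.
  by rewrite tofracM tofracXn -mulrA; congr (_ * _); apply: exprV_mul => //; rewrite -ltnS.
pose Y : {poly F} := 'X^2 * 'X^i * r j + T * D.
have YE : 'X * Y * z = - (D * p).
  apply/eqP; rewrite -tofrac_eq tofracN !tofracM tofracD !tofracM !tofracXn; apply/eqP.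
  apply: (clear_expansion XF0 _ _ TS); rewrite ?tofrac_eq0 //.
  by rewrite -[RHS]e local_coef_None wE.
have sY : (size Y <= N)%N.
  have [->|Y0] := eqVneq Y 0; first by rewrite size_poly0.
  have := congr1 (fun p : {poly F} => size p) YE; rewrite size_polyN.
  rewrite -mulrA mulrC size_mulX ?mulf_neq0 // size_mul // => sE.
  have := size_polyMleq D p; rewrite -sE; have := size_D.
  have : (0 < size z)%N by rewrite size_poly_gt0.
  by move: pz; move: (size p) (size z) (size D) (size Y) => A B E G; lia.
set m := 'X^(i.+1) * r j; set rho := m %% D.
have srho : (size rho <= N)%N by rewrite -ltnS -size_D ltn_modp.
(* As [Y] and [rho] have degree less than [N], the relation [Y - rho X = U D] forces [U] to be the
   constant [T(0) = a i j]; then compare coefficients of degree [N]. *)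
pose U := 'X * (m %/ D) + T.
have UE : Y - rho * 'X = U * D.
  have -> : Y = 'X * (m %/ D * D + rho) + T * D.
    by rewrite -divp_eq /m mulrA -exprS /Y -exprD.
  by rewrite /U; ring.
have sU : (size U <= 1)%N.
  have [->|U0] := eqVneq U 0; first by rewrite size_poly0.
  have : (size (U * D)%R <= N.+1)%N.
    rewrite -UE; apply: leq_trans (size_polyD _ _) _; rewrite size_polyN.
    rewrite geq_max leqW //=; apply: leq_trans (size_polyMleq _ _) _.
    by rewrite size_polyX addn2 ltnS.
  rewrite size_mul //; have := size_D; move: (size D) (size U) => A B; lia.
have U0 : U = (a i j)%:P.
  rewrite (size1_polyC sU) -horner_coef0 /U hornerD hornerM hornerX mul0r add0r.
  rewrite /T horner_sum big_ord_recr /= hornerM hornerC subnn expr0 hornerC mulr1.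
  rewrite big1 ?add0r // => k _.
  by rewrite hornerM hornerXn expr0n subn_eq0 leqNgt ltn_ord mulr0.
have := congr1 (fun p : {poly F} => p`_N) UE.
rewrite U0 coefB coefCM coefMX (nth_default _ sY) sub0r gtn_eqF ?N_gt0 //=.
have -> : D`_N = 1 by have /monicP := modulus_monic q n.
by rewrite mulr1 /top -/m -/rho => <-; rewrite opprK.
Qed.

(** [K] inverts [X - b] modulo [D] up to the factor [- D(b)], and pairing with it evaluates at [b],
    as in Cauchy's formula: modulo [D], [K r_j] is [r_j(b) K - D(b) s], with [K] monic of degree
    [N - 1] and [s] of lower degree. *)
Lemma top_cauchy b j : exists K, [/\ K * ('X - b%:P) = D - D.[b]%:P &
  top (K * r j) = (r j).[b]].
Proof.
have /factor_theorem[K KE] : root (D - D.[b]%:P) b.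
  by rewrite /root !hornerE subrr.
have /factor_theorem[s sE] : root (r j - (r j).[b]%:P) b.
  by rewrite /root !hornerE subrr.
have sD : size (D - D.[b]%:P) = size D.
  rewrite size_polyDl // size_polyN size_D ltnS.
  by apply: leq_trans (size_polyC_leq1 _) N_gt0.
have K0 : K != 0.
  by apply: contraNneq D0 => K0; rewrite -size_poly_eq0 -sD KE K0 mul0r size_poly0.
have sK : size K = N.
  by rewrite -sD KE size_mul ?polyXsubC_eq0 // size_XsubC addn2.
have sKD : (size K < size D)%N by rewrite sK size_D.
exists K; split=> //.
have Kr : K * r j = (r j).[b] *: K + (s * D - D.[b] *: s).
  have -> : r j = (r j).[b]%:P + s * ('X - b%:P) by rewrite -sE addrC subrK.
  rewrite hornerD hornerC hornerM hornerXsubC subrr mulr0 addr0.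
  rewrite mulrDr mulrC mul_polyC; congr (_ + _).
  by rewrite mulrCA -KE mulrBr [s * _%:P]mulrC mul_polyC.
have ss : (size s < N)%N.
  have [->|s0] := eqVneq s 0; first by rewrite size_poly0 N_gt0.
  have : (size (r j - (r j).[b]%:P)%R <= maxn (size (r j)) 1)%N.
    apply: leq_trans (size_polyD _ _) _; rewrite size_polyN.
    by rewrite geq_max leq_maxl /=; apply: leq_trans (size_polyC_leq1 _) (leq_maxr _ _).
  rewrite sE size_mul ?polyXsubC_eq0 // size_XsubC addn2 /=.
  by have := rN j; have := N_gt0; move: (size s) (size (r j)) (N) => A B M; lia.
have ssD : (size s < size D)%N by rewrite size_D; apply: leqW.
rewrite Kr !topD topZ -scaleN1r topZ topZ (top_dvdp (dvdp_mulIr _ _)).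
have s0 : s`_N.-1 = 0.
  by apply: nth_default; move: ss N_gt0; move: (size s) (N) => A B; lia.
rewrite (top_small ssD) (top_small sKD) s0 !mulr0 !addr0.
have -> : K`_N.-1 = lead_coef K by rewrite /lead_coef sK.
have /monicP : K \is monic.
  rewrite -(monicMr K (monicXsubC b)) -KE; apply/monicP.
  rewrite lead_coefDl; first exact/monicP/modulus_monic.
  rewrite size_polyN size_D ltnS; exact: leq_trans (size_polyC_leq1 _) N_gt0.
by move=> ->; rewrite mulr1.
Qed.

(** * The quotient algebra as an instance of the local algebra *)

Local Notation B := {poly %/ D}.

Lemma mk_monic_modulus : mk_monic D = D.
Proof. by rewrite /mk_monic modulus_monic size_D ltnS N_gt0. Qed.

Definition proj p : B := in_qpoly D p.

Lemma proj_val p : proj p = p %% D :> {poly F}.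
Proof.
rewrite /proj /= mk_monic_modulus Pdiv.IdomainMonic.modpE //.
exact: modulus_monic.
Qed.

Lemma proj_dvdp p p' : D %| p - p' -> proj p = proj p'.
Proof.
move=> d; apply: val_inj; apply: etrans (proj_val p) (etrans _ (esym (proj_val p'))).
by apply/eqP; rewrite -subr_eq0 -modpN -modpD.
Qed.

Lemma size_quot (x : B) : (size (x : {poly F}) < size D)%N.
Proof.
apply: leq_trans (size_mk_monic x) _.
by apply: eq_leq; congr (size (polyseq _)); exact: mk_monic_modulus.
Qed.

Lemma projK (x : B) : proj x = x.
Proof.
apply: val_inj; apply: etrans (proj_val _) _; rewrite modp_small //.
exact: size_quot.
Qed.

Lemma projD p p' : proj (p + p') = proj p + proj p'.
Proof. exact: rmorphD. Qed.

Lemma projM p p' : proj (p * p') = proj p * proj p'.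
Proof. exact: rmorphM. Qed.

Lemma projZ c p : proj (c *: p) = c *: proj p.
Proof. exact: linearZ. Qed.

Lemma proj1 : proj 1 = 1.
Proof. exact: rmorph1. Qed.

Lemma proj0 : proj 0 = 0.
Proof. exact: rmorph0. Qed.

Lemma projN p : proj (- p) = - proj p.
Proof. exact: rmorphN. Qed.

Lemma projC c : proj c%:P = c%:A.
Proof. by rewrite -alg_polyC projZ proj1. Qed.

Lemma proj_sum (J : Type) (s : seq J) (P : pred J) (f : J -> {poly F}) :
  proj (\sum_(i <- s | P i) f i) = \sum_(i <- s | P i) proj (f i).
Proof. exact: (big_morph proj projD proj0). Qed.

Lemma proj_horner (x : {poly F}) p : horner_alg (proj x) p = proj (p \Po x).
Proof.
elim/poly_ind: p => [|p c IH]; first by rewrite rmorph0 comp_poly0 proj0.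
rewrite rmorphD rmorphM /= horner_algX horner_algC IH comp_poly_MXaddC.
rewrite projD projM; congr (_ + _).
exact/esym/projC.
Qed.

(** By the residue theorem, the residue of [x w_j] at infinity. *)
Definition functional j (x : B) : F := - top ((x : {poly F}) * r j).

Lemma functional_proj j p : functional j (proj p) = - top (p * r j).
Proof.
congr (- _); apply: top_congr; rewrite proj_val -mulrBl; apply: dvdp_mulr.
by rewrite {2}(divp_eq p D) opprD addrCA subrr addr0 dvdpNr dvdp_mulIr.
Qed.

Definition idem i : B := proj (eps i).

Definition nilpart : B := proj 'X - loc idem q.

Local Notation l := functional.
Local Notation e := idem.
Local Notation rho := nilpart.
Local Notation v := (loc e q + rho).

Lemma vE : v = proj 'X.
Proof. by rewrite /nilpart addrC subrK. Qed.

Lemma idem_orth i j : e i * e j = if i == j then e i else 0.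
Proof.
rewrite /idem -projM (proj_dvdp (eps_orth eps0 eps1 i j)).
by case: eqP => // _; apply: proj0.
Qed.

Lemma idem_sum : \sum_i e i = 1.
Proof. by rewrite -proj_sum -(proj_dvdp (eps_sum q_inj eps0 eps1)) proj1. Qed.

Lemma idem_nilpart i k : e i * rho ^+ k = e i * proj (('X - (q i)%:P) ^+ k).
Proof.
have base : e i * rho = e i * proj ('X - (q i)%:P).
  rewrite /nilpart mulrBr /loc mulr_sumr (bigD1 i) //= big1 => [|j ji]; last first.
    by rewrite -scalerAr idem_orth eq_sym (negbTE ji) scaler0.
  rewrite addr0 -scalerAr idem_orth eqxx projD mulrDr; congr (_ + _).
  by rewrite projN projC mulrN -scalerAr mulr1.
elim: k => [|k IH]; first by rewrite !expr0 proj1.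
by rewrite !exprSr projM mulrA IH mulrAC base -!mulrA [proj (_ - _) * _]mulrC.
Qed.

Lemma nilpart_nil : rho ^+ n = 0.
Proof.
rewrite -[LHS]mul1r -idem_sum mulr_suml big1 // => i _.
rewrite idem_nilpart -projM -proj0; apply: proj_dvdp; rewrite subr0.
by apply: (eps_mul eps0).
Qed.

Lemma functional_lin j c (x y : B) : l j (c *: x + y) = c * l j x + l j y.
Proof.
rewrite -[x]projK -[y]projK -projZ -projD !functional_proj.
by rewrite mulrDl -scalerAl topD topZ opprD mulrN.
Qed.

Lemma functional_ann p : ann l (proj p) <-> global p.
Proof.
split=> [ap|gp j].
  apply: double_annihilator => j; have := ap j.
  by rewrite functional_proj => /eqP; rewrite oppr_eq0 => /eqP.
by rewrite functional_proj (top_section gp) ?oppr0 //; apply: w_section.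
Qed.

Lemma annM_functional (x y : B) : ann l x -> ann l y -> ann l (x * y).
Proof.
rewrite -[x]projK -[y]projK -projM => /functional_ann gx /functional_ann gy.
exact/functional_ann/globalM.
Qed.

Lemma ann_idem i : ann l (e i).
Proof. exact/functional_ann/global_eps. Qed.

Lemma proj_gen (x : B) : exists p : {poly F}, (size p <= N)%N /\ x = horner_alg v p.
Proof.
exists x; split; last by rewrite vE proj_horner comp_polyXr projK.
by rewrite -ltnS prednK ?size_quot // (leq_trans _ (size_quot x)).
Qed.

Lemma idem_neq0 i : e i != 0.
Proof.
apply/eqP => /(congr1 (fun x : B => (x : {poly F}).[q i])).
rewrite horner0 /idem proj_val => h.
have := congr1 (fun p => p.[q i]) (divp_eq (eps i) D).
rewrite (eps_value n_gt0 eps1) hornerD hornerM modulus_root // mulr0 h addr0.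
by move/eqP; rewrite oner_eq0.
Qed.

Lemma functional_dual : exists eta : 'I_g -> B, (forall j, nilr rho (eta j)) /\
  forall i j, l i (eta j) = (i == j)%:R.
Proof.
have [y yP] := dual_polynomials.
apply: (@nil_dual_basis F B I q e rho g l idem_orth idem_sum functional_lin ann_idem
  (fun j => proj (- y j))) => [x|i j].
  by have [p [_ ->]] := proj_gen x; exists p.
by rewrite functional_proj mulNr -scaleN1r topZ mulN1r opprK yP.
Qed.

Lemma functional_expansion i j : l j (v ^+ i.+1) = a i j.
Proof.
have projX k : proj ('X ^+ k) = proj 'X ^+ k.
  by elim: k => [|k IH]; rewrite ?expr0 ?proj1 // !exprS projM IH.
by rewrite vE -projX functional_proj top_expansion opprK.
Qed.

Definition chart (u : F) : P1 F := if u == 0 then None else Some u^-1.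

Lemma smooth_chart u : smooth_point C (chart u) <-> good q u.
Proof.
rewrite /chart; split=> [sm i|gu].
  apply/eqP => /eqP; rewrite subr_eq0 => /eqP uq.
  have u0 : u != 0 by apply: contra_eq_neq uq => ->; rewrite mul0r oner_neq0.
  move: sm; rewrite (negbTE u0) => sm.
  have /singP : exists k, Some u^-1 = Some (q k).
    by exists i; congr Some; apply: (mulfI u0); rewrite mulfV.
  exact.
apply: smooth_stalk => i; case: eqP => // /eqP u0 [uq].
by have := gu i; rewrite -uq mulfV // subrr eqxx.
Qed.

Lemma value_frac b p z : z.[b] != 0 -> value (Some b) (tofrac p / tofrac z) = p.[b] / z.[b].
Proof.
move=> zb; apply: value_eq; set c := p.[b] / z.[b].
have z0 : tofrac z != 0 by rewrite tofrac_eq0 (horner_neq0 zb).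
have /factor_theorem[k kE] : root (p - c *: z) b.
  by rewrite /root hornerD hornerN hornerZ divfK // subrr.
exists (tofrac k / tofrac z); first by exists k, z.
rewrite expr1 unif_Some mulrA -tofracM [_ * k]mulrC -kE; apply: (mulIf z0).
by rewrite mulrBl !divfK // -mul_polyC tofracB tofracM.
Qed.

Hypothesis n_gt1 : (1 < n)%N.

(** For [b = 1/u], the [K] of [top_cauchy] gives the inverse of [1 - u v] in [B], and both sides
    become [- b^2 r_j(b) / D(b)]. At [u = 0] both are [a 0 j]. *)
Lemma omega_value j u : good q u ->
  value (chart u) (local_coef None (w j)) = omega q e rho l u j.
Proof.
move=> gu; have [eta [eta_nil eta_dual]] := functional_dual.
rewrite /chart; case: eqP => [->|/eqP u0].
  rewrite /omega scale0r subr0 invr1 mulr1 -[_ + _]expr1 functional_expansion.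
  apply: value_eq; have := w_exp j 1; rewrite big_ord1 expr0 mulr1.
  by [].
set b := u^-1; have ub : u * b = 1 by rewrite mulfV.
have Db : D.[b] != 0.
  apply: modulus_neq0 => i; apply/eqP => bq.
  by have := gu i; rewrite -bq ub subrr eqxx.
have -> : value (Some b) (local_coef None (w j)) = - (b ^+ 2 * (r j).[b]) / D.[b].
  rewrite local_coef_None wE mulrA -mulNr -tofracXn -tofracM -tofracN value_frac //.
  by rewrite hornerN hornerM hornerXn.
have [K [KE Kr]] := top_cauchy b j.
have lE := @l_inv_one_sub_uv F B I q e rho n g l n_gt1 nilpart_nil idem_orth
  idem_sum functional_lin annM_functional ann_idem eta eta_nil eta_dual u j gu.
have uu := @one_sub_uv_unit F B I q e rho n g l n_gt1 nilpart_nil idem_orth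
  idem_sum functional_lin annM_functional ann_idem eta eta_nil eta_dual u gu.
have invE : (1 - u *: v)^-1 = proj ((u * D.[b])^-1 *: K).
  apply: (mulrI uu); rewrite mulrV // vE -proj1 -projZ -projN -projD -projM.
  apply: proj_dvdp; rewrite -scalerAr.
  have -> : 1 - u *: 'X = - u *: ('X - b%:P) :> {poly F}.
    rewrite scalerBr !scaleNr opprK addrC; congr (_ + _).
    by rewrite -mul_polyC -polyCM ub.
  rewrite -scalerAl [_ * K]mulrC KE scalerA scalerBr -[D.[b]%:P]mulr1 mul_polyC scalerA.
  have -> : (u * D.[b])^-1 * - u * D.[b] = -1 by field; rewrite Db u0.
  rewrite scaleN1r opprK [_ + 1]addrC opprD addrA subrr add0r dvdpNr -mul_polyC.
  exact: dvdp_mulIr.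
apply: (mulfI u0); rewrite -lE invE functional_proj -scalerAl topZ Kr.
by rewrite /b; field; rewrite Db u0.
Qed.

End CurveAlgebra.

Lemma common_conductor (F : fieldType) (C : unibranch_rational_curve F) (I : finType)
    (q : I -> F) : exists2 n, (1 < n)%N &
  forall i h, max_pow (Some (q i)) n h -> C (Some (q i)) h.
Proof.
have /choice[m mP] i := stalk_conductor C (Some (q i)).
(* The added 2 ensures [1 < n], so that truncated exponentials keep their linear term. *)
exists (\max_i m i).+2 => // i h hh; apply: mP.
by apply: max_pow_le hh; apply: leqW; apply: leqW; apply: leq_bigmax.
Qed.

Theorem corollary4p12 (R : realType) (C : unibranch_rational_curve R[i])
    (g s : nat) (t : s.-tuple R[i])
    (w : 'I_g -> ratfun R[i]) (a : nat -> 'I_g -> R[i])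
    (theta : mpoly.mpoly g R[i])
    (C_gorenstein : gorenstein C)
    (C_genus : arithmetic_genus C g) (g_ge1 : (1 <= g)%N)
    (t_uniq : uniq (0 :: t))
    (C_sing : forall P : P1 R[i],
        ~ smooth_point C P <-> exists2 b, b \in 0 :: t & P = Some b)
    (w_basis : dualizing_basis C w)
    (w_exp : forall j, is_expansion None (w j) (fun i => a i j))
    (theta_C : theta_function C w theta) :
  let T : ratfun3 R[i] := (restrict_xyt (a 0%N) (a 1%N) (a 2%N) theta)%:F in
  T != 0 /\ KP_solution (2%:R * dxx_log T).
Proof.
move=> T; pose q := tnth [tuple of 0 :: t].
have q_inj : injective q by apply/tuple_uniqP.
have singP P : ~ smooth_point C P <-> exists i, P = Some (q i).
  rewrite C_sing; split=> [[b /tnthP[i ->] ->]|[i ->]]; first by exists i.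
  by exists (q i) => //; apply: mem_tnth.
have [n n1 cond] := common_conductor C q; have n0 := ltnW n1.
have [eps [eps0 eps1]] := idempotents n q_inj.
have [w_dual _] := w_basis.
have /choice[r rP] j : exists r : {poly R[i]}, (size r < (size (modulus q n)).-1)%N /\
    w j = r%:F / (modulus q n)%:F.
  by have [r] := section_numerator ord0 n0 singP cond (w_dual j); exists r.
have rN j : (size (r j) < (size (modulus q n)).-1)%N by have [] := rP j.
have wE j : w j = (r j)%:F / (modulus q n)%:F by have [] := rP j.
have [eta [eta_nil eta_dual]] :=
  functional_dual ord0 q_inj n0 singP cond eps0 eps1 w_basis rN wE.
have smoothP u : smooth_point C (point_u u) <-> good q u := smooth_chart singP u.
have rho_nil := nilpart_nil ord0 q_inj n0 eps0 eps1.
have e_orth := idem_orth ord0 n0 eps0 eps1.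
have e_sum := idem_sum ord0 q_inj n0 eps0 eps1.
have l_lin := functional_lin (q := q) ord0 n0 r.
have annM := annM_functional ord0 q_inj n0 singP cond eps0 eps1 w_basis wE.
have ann_e := ann_idem ord0 q_inj n0 singP cond eps0 eps1 w_basis wE.
have l_exp := functional_expansion ord0 n0 eps wE w_exp.
have [theta_reduced theta_zero] := theta_C.
(* [omega_value] and [omegaE] put the integrands in the closed form of which [abel] is a
   primitive. *)
have abelE : abel_image C w =
    effective q (idem q n eps) (nilpart q n eps) n (functional r) g.-1.
  apply: abel_image_effective => // u j gu.
  rewrite -(omegaE n1 rho_nil e_orth e_sum l_lin annM ann_e eta_nil eta_dual j gu).
  exact: (omega_value ord0 q_inj n0 singP cond eps0 eps1 w_basis rN wE w_exp n1 j gu).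
(* The directions [a 0], [a 1], [a 2] are the values of [l j] at [v], [v ^+ 2], [v ^+ 3] by
   [functional_expansion]; [ord0] indexes the singular point [v = 0]. *)
apply: (theta_KP n1 rho_nil e_orth e_sum l_lin annM ann_e eta_nil eta_dual g_ge1
  (proj_gen ord0 n0 eps) (idem_neq0 ord0 n0 eps1) _ (dd := fun k : 'I_3 => a k)).
- by exists ord0.
- exact: theta_reduced.
- move=> z; rewrite -abelE.
  have : [set z | mpoly.meval z theta = 0]%classic z <-> theta_divisor C w z.
    by rewrite theta_zero.
  by [].
by move=> j; rewrite -!l_exp expr1.
Qed.
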